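(* Let $\lambda^P>0$ and $\lambda^S\in\mathbb{R}\setminus\{0\}$ be constants, and consider the central KL-regularized optimal control problem $$\min_{\underline{\pi}}\ \operatorname*{opt}^{\lambda^S}_{\underline{\tau}}\ \mathbb{E}_{p_{(\underline{\pi},\underline{\tau})}}\Bigl[\underline{c}_T+\tfrac{1}{\lambda^P}\sum_{t=0}^{T-1}\log\tfrac{\pi_t}{\rho_t}+\tfrac{1}{\lambda^S}\sum_{t=0}^{T-1}\log\tfrac{\tau_t}{\iota_t}\Bigr]$$ over policy sequences $\underline{\pi}$ and transition-kernel sequences $\underline{\tau}$. Set the terminal value function $V_T=c_T$. Then, for $t=T-1,\dots,0$, the optimal value function $V_t(x_t)$, action-value function $Q_t(x_t,u_t)$, optimal policy $\pi_t^*(u_t\mid x_t)$ and optimal transition kernel $\tau_t^*(x_{t+1}\mid x_t,u_t)$ satisfy the recursions $$V_t=\min_{\pi_t}\Bigl\{\mathbb{E}_{\pi_t}[Q_t]+\tfrac{1}{\lambda^P}\mathbb{D}^{\pi_t}_{\rho_t}\Bigr\}=\mathcal{R}^{\lambda^P}_{\rho_t}[Q_t],$$ $$Q_t=\operatorname*{opt}^{\lambda^S}_{\tau_t}\Bigl\{\mathbb{E}_{\tau_t}[c_t+V_{t+1}]+\tfrac{1}{\lambda^S}\mathbb{D}^{\tau_t}_{\iota_t}\Bigr\}=\mathcal{R}^{\lambda^S}_{\iota_t}[c_t+V_{t+1}],$$ $$\pi_t^*=\arg\min_{\pi_t}\Bigl\{\mathbb{E}_{\pi_t}[Q_t]+\tfrac{1}{\lambda^P}\mathbb{D}^{\pi_t}_{\rho_t}\Bigr\}=\rho_t\,\frac{e^{-\lambda^P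 Q_t}}{e^{-\lambda^P V_t}},$$ $$\tau_t^*=\arg\operatorname*{opt}^{\lambda^S}_{\tau_t}\Bigl\{\mathbb{E}_{\tau_t}[V_{t+1}]+\tfrac{1}{\lambda^S}\mathbb{D}^{\tau_t}_{\iota_t}\Bigr\}=\iota_t\,\frac{e^{-\lambda^S(c_t+V_{t+1})}}{e^{-\lambda^S Q_t}}.$$
   Context: Setting: a discrete-time controlled stochastic system with finite horizon $T$, states $x_t$, actions $u_t$, and trajectories $\underline{\xi}_T=(x_0,u_0,\dots,x_{T-1},u_{T-1},x_T)$. A policy sequence $\underline{\pi}=(\pi_0,\dots,\pi_{T-1})$ consists of conditional distributions $\pi_t(u_t\mid x_t)$; a transition-kernel sequence $\underline{\tau}=(\tau_0,\dots,\tau_{T-1})$ consists of conditional distributions $\tau_t(x_{t+1}\mid x_t,u_t)$. They induce the trajectory distribution $p_{(\underline{\pi},\underline{\tau})}(\underline{\xi}_T)=p(x_0)\prod_{t=0}^{T-1}\pi_t(u_t\mid x_t)\,\tau_t(x_{t+1}\mid x_t,u_t)$, with a fixed initial state distribution $p(x_0)$. The fixed baseline consists of a reference policy sequence $\underline{\rho}=(\rho_t)$ and the system's true transition kernels $\underline{\iota}=(\iota_t)$; decision variables are required to be absolutely continuous with respect to the baseline ($\pi_t\ll\rho_t$, $\tau_t\ll\iota_t$). Costs: $\underline{c}_T(\underline{\xi}_T)=\sum_{t=0}^{T-1}c_t(x_t,u_t)+c_T(x_T)$ with running costs $c_t\ge 0$ and terminal cost $c_T\ge 0$. Standing assumption: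 $\underline{c}_T$ is such that all trajectory expectations and risk operators that appear are finite for the policies and transitions considered. Notation: $\mathbb{D}^{\mu}_{\sigma}=\mathbb{E}_\mu[\log\frac{\mu}{\sigma}]$ is the Kullback-Leibler divergence; for conditional kernels it is taken conditionally, so $\mathbb{D}^{\pi_t}_{\rho_t}$ is a function of $x_t$ and $\mathbb{D}^{\tau_t}_{\iota_t}$ a function of $(x_t,u_t)$. $\mathbb{E}_{\pi_t}$, $\mathbb{E}_{\rho_t}$ denote expectation over $u_t$ given $x_t$, and $\mathbb{E}_{\tau_t}$, $\mathbb{E}_{\iota_t}$ expectation over $x_{t+1}$ given $(x_t,u_t)$; $V_{t+1}$ is evaluated at $x_{t+1}$ and $c_t$ at $(x_t,u_t)$. The entropic risk operator is $\mathcal{R}^{\lambda}_{\mu}[f]=-\frac1\lambda\log\mathbb{E}_\mu[e^{-\lambda f}]$ for $\lambda\neq 0$. The sign-dependent extremiser is $\operatorname{opt}^{\lambda}_{q}J(q)=\min_q J(q)$ if $\lambda>0$ and $\max_q J(q)$ if $\lambda<0$; $\arg\operatorname{opt}^\lambda$ is the corresponding extremiser. Optimal value function: for $t<T$, $V_t(x_t)=\min_{\pi_t,\dots,\pi_{T-1}}\operatorname{opt}^{\lambda^S}_{\tau_t,\dots,\tau_{T-1}}\mathbb{E}\bigl[c_T+\sum_{k=t}^{T-1}\bigl(c_k+\frac1{\lambda^P}\mathbb{D}^{\pi_k}_{\rho_k}+\frac1{\lambda^S}\mathbb{D}^{\tau_k}_{\iota_k}\bigr)\bigr]$, where the expectation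 is over the trajectory segment from $t$ to $T$ generated by $(\pi_k,\tau_k)_{k\ge t}$ given $x_t$. The action-value function $Q_t(x_t,u_t)$ is the optimal value over $\tau_t$ in the one-step problem with continuation value $V_{t+1}$, i.e. $\operatorname{opt}^{\lambda^S}_{\tau_t}\{\mathbb{E}_{\tau_t}[c_t+V_{t+1}]+\frac1{\lambda^S}\mathbb{D}^{\tau_t}_{\iota_t}\}$. *)

(* Defs.v *)
(* Library: MathComp-Analysis, over an arbitrary R : realType. *)
From HB Require Import structures.
From mathcomp Require Import all_boot all_order all_algebra.
From mathcomp Require Import all_classical all_reals all_analysis.
From mathcomp Require Import measurable_realfun.

Set Implicit Arguments.
Unset Strict Implicit.
Unset Printing Implicit Defensive.
Import Order.TTheory GRing.Theory Num.Theory.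
Import numFieldNormedType.Exports.

Local Open Scope classical_set_scope.
Local Open Scope ring_scope.
Local Open Scope ereal_scope.

(* The measure [k x] with its structure of probability, which is not inferred
   from [k : R.-pker X ~> Y]. *)
Section kernel_at.
Context d d' (X : measurableType d) (Y : measurableType d') (R : realType).
Variables (k : R.-pker X ~> Y) (x : X).

Definition kernel_at : set Y -> \bar R := k x.

HB.instance Definition _ := Measure.copy kernel_at (k x).

Let kernel_atT : kernel_at setT = 1. Proof. exact: prob_kernel. Qed.

HB.instance Definition _ :=
  Measure_isProbability.Build _ _ _ kernel_at kernel_atT.

End kernel_at.

(* A trajectory segment (x_0, u_0, ..., x_{n-1}, u_{n-1}, x_n) is the tuple of
   its n state-action pairs together with its last state. *)
Notation segment X U n := (n.-tuple (X * U) * X)%type.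

Section trajectories.
Context dX dU (X : measurableType dX) (U : measurableType dU) (R : realType).

Definition segment_nil (x : X) : segment X U 0 := ([tuple], x).

Definition segment_cons n (z : X * U) (xi : segment X U n) : segment X U n.+1 :=
  ([the n.+1.-tuple (X * U) of z :: xi.1], xi.2).

Lemma measurable_segment_nil : measurable_fun setT segment_nil.
Proof. by apply: measurable_fun_pair => //; exact: measurable_cst. Qed.

Lemma measurable_segment_cons n :
  measurable_fun setT (fun w : (X * U) * segment X U n => segment_cons w.1 w.2).
Proof.
apply: measurable_fun_pair => /=; last exact: measurableT_comp.
by apply: measurable_cons => //=; exact: measurableT_comp.
Qed.

Lemma measurable_segment_cons2 n (z : X * U) :
  measurable_fun setT (@segment_cons n z).
Proof.
exact: (measurableT_comp (@measurable_segment_cons n) (pair1_measurable z)).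
Qed.

(* Law of [(x, u)] followed by a segment drawn from [k y], at [((x, u), y)]. *)
Section cons_kernel.
Variables (n : nat) (k : R.-pker X ~> segment X U n).
Implicit Type w : (X * U) * X.

Definition cons_kernel w : set (segment X U n.+1) -> \bar R :=
  pushforward (k w.2) (segment_cons w.1).

Let msegment_cons z (A : set (segment X U n.+1)) : measurable A ->
  measurable (segment_cons z @^-1` A).
Proof.
by move=> mA; rewrite -[X in measurable X]setTI; exact: measurable_segment_cons2.
Qed.

Let cons_kernel0 w : cons_kernel w set0 = 0.
Proof. by rewrite /cons_kernel /pushforward preimage_set0 measure0. Qed.

Let cons_kernel_ge0 w A : 0 <= cons_kernel w A.
Proof. by rewrite /cons_kernel /pushforward; exact: measure_ge0. Qed.

Let cons_kernel_sigma_additive w : semi_sigma_additive (cons_kernel w).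
Proof.
move=> F mF tF mUF; rewrite /cons_kernel /pushforward preimage_bigcup.
apply: measure_semi_sigma_additive.
- by move=> i; exact: msegment_cons.
- apply/trivIsetP => /= i j _ _ ij; rewrite -preimage_setI.
  by move/trivIsetP : tF => /(_ _ _ _ _ ij) ->//; rewrite preimage_set0.
- by rewrite -preimage_bigcup; exact: msegment_cons.
Qed.

HB.instance Definition _ w := isMeasure.Build _ _ _ (cons_kernel w)
  (cons_kernel0 w) (cons_kernel_ge0 w) (@cons_kernel_sigma_additive w).

Definition mcons_kernel : (X * U) * X -> {measure set (segment X U n.+1) -> \bar R}
  := cons_kernel.

Let measurable_cons_kernel (A : set (segment X U n.+1)) : measurable A ->
  measurable_fun setT (mcons_kernel ^~ A).
Proof.
move=> mA.
pose B := [set v : ((X * U) * X) * segment X U n | A (segment_cons v.1.1 v.2)].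
have mB : measurable B.
  have mf : measurable_fun setT
      (fun v : ((X * U) * X) * segment X U n => segment_cons v.1.1 v.2).
    apply: (measurableT_comp (@measurable_segment_cons n)
      (g := fun v => (v.1.1, v.2))).
    by apply: measurable_fun_pair => //; exact: measurableT_comp.
  by rewrite -[B]setTI; exact: mf.
rewrite (_ : _ ^~ _ = fun w => kernel.kernel_snd k w (xsection B w)).
  by apply: measurable_fun_xsection_finite_kernel; rewrite inE.
by apply/funext => w; rewrite xsectionE.
Qed.

HB.instance Definition _ :=
  isKernel.Build _ _ _ _ _ mcons_kernel measurable_cons_kernel.

Let cons_kernelT w : mcons_kernel w setT = 1.
Proof. by rewrite /= /cons_kernel /pushforward preimage_setT prob_kernel. Qed.

HB.instance Definition _ :=
  Kernel_isProbability.Build _ _ _ _ _ mcons_kernel cons_kernelT.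

End cons_kernel.

Section step_kernel.
Variables (p : R.-pker X ~> U) (q : R.-pker (X * U) ~> X).
Variables (n : nat) (k : R.-pker X ~> segment X U n).

Definition step_kernel : X -> {measure set (segment X U n.+1) -> \bar R} :=
  mkcomp p (mkcomp q (mcons_kernel k)).

HB.instance Definition _ := SFiniteKernel.on step_kernel.

Let step_kernelT x : step_kernel x setT = 1.
Proof.
rewrite /= /kcomp (eq_integral (cst 1)) => [|u _].
  by rewrite integral_cst// mul1e prob_kernel.
rewrite /= /kcomp (eq_integral (cst 1)) => [|y _].
  by rewrite integral_cst// mul1e prob_kernel.
exact: (prob_kernel (s := mcons_kernel k)).
Qed.

HB.instance Definition _ :=
  Kernel_isProbability.Build _ _ _ _ _ step_kernel step_kernelT.

End step_kernel.
(* The law of the segment (x_t, u_t, ..., x_{t+n}) started at [x_t = x]; it is the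
   measure with density \prod_k pi_k(u_k | x_k) tau_k(x_{k+1} | x_k, u_k). *)
Fixpoint segment_law (pi : nat -> R.-pker X ~> U)
    (tau : nat -> R.-pker (X * U) ~> X) (n t : nat) : R.-pker X ~> segment X U n :=
  match n with
  | 0 => kdirac measurable_segment_nil
  | n'.+1 => step_kernel (pi t) (tau t) (segment_law pi tau n' t.+1)
  end.

Section trajectory_law.
Variables (p0 : probability X R) (n : nat) (k : R.-pker X ~> segment X U n).

Definition init_law (A : set (segment X U n)) : \bar R := \int[p0]_x k x A.

HB.instance Definition _ := Measure.copy init_law
  (mkcomp_noparam
    (kprobability (measurable_cst (p0 : pprobability X R)
       : measurable_fun [set: unit] _)) k tt).

Let init_lawT : init_law setT = 1.
Proof.
rewrite /init_law (eq_integral (cst 1)) => [|x _]; last exact: prob_kernel.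
by rewrite integral_cst// mul1e; exact: probability_setT.
Qed.

HB.instance Definition _ :=
  Measure_isProbability.Build _ _ _ init_law init_lawT.

End trajectory_law.

(* The state x_k of a segment of length [n], for [k <= n]. *)
Definition segment_state n (xi : segment X U n) (k : nat) : X :=
  nth xi.2 [seq z.1 | z <- xi.1] k.

End trajectories.

Section extremisers.
Context {R : realType}.

Definition opt (lam : R) (E : set (\bar R)) : \bar R :=
  if (0 < lam)%R then ereal_inf E else ereal_sup E.

Definition is_argopt (lam : R) {D : Type} (S : set D) (J : D -> \bar R) (q : D) :=
  S q /\ forall q', S q' -> if (0 < lam)%R then J q <= J q' else J q' <= J q.

Definition is_argmin {D : Type} (S : set D) (J : D -> \bar R) (q : D) :=
  S q /\ forall q', S q' -> J q <= J q'.

End extremisers.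

Section divergence.
Context d (Y : measurableType d) (R : realType).
Local Open Scope charge_scope.

(* Only meaningful for [mu `<< sigma]. *)
Definition kl (mu sigma : probability Y R) : \bar R :=
  \int[mu]_y lne (('d (charge_of_finite_measure mu) '/d sigma) y).

Definition entropic_risk (lam : R) (mu : {measure set Y -> \bar R})
    (f : Y -> \bar R) : \bar R :=
  (- lam^-1)%:E * lne (\int[mu]_y expeR ((- lam)%:E * f y)).

End divergence.

Section kernel_domination.
Context d d' (Y : measurableType d) (Z : measurableType d') (R : realType).
Implicit Types k s : R.-pker Y ~> Z.

Definition is_kernel_density k s (p : Y * Z -> R) :=
  [/\ measurable_fun setT p, forall w, (0 <= p w)%R &
      forall y A, measurable A -> k y A = \int[s y]_(z in A) (p (y, z))%:E].

(* Absolute continuity of conditional distributions.  The second clause asks for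
   the derivatives d(k y)/d(s y) to have a version that is jointly measurable in
   (y, z), without which E[log(k/s)] and E[D(k||s)] need not be integrals of
   measurable functions; it follows from the first one when the sigma-algebra of
   [Z] is countably generated, e.g. when [Z] is standard Borel. *)
Definition kernel_dominated k s :=
  (forall y, k y `<< s y) /\ exists p, is_kernel_density k s p.

Definition kernel_density k s : Y * Z -> R :=
  xget (fun=> 0%R) [set p | is_kernel_density k s p].

Definition log_ratio k s (w : Y * Z) : \bar R := lne (kernel_density k s w)%:E.

End kernel_domination.

Section kl_control.
Context dX dU (X : measurableType dX) (U : measurableType dU) (R : realType).
Variables (T : nat) (p0 : probability X R).
Variables (rho : nat -> R.-pker X ~> U) (iota : nat -> R.-pker (X * U) ~> X).
Variables (c : nat -> X * U -> R) (cT : X -> R) (lP lS : R).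

Implicit Types (pi : nat -> R.-pker X ~> U) (tau : nat -> R.-pker (X * U) ~> X).

(* Policies and transition kernels are sequences indexed by all of [nat], of which
   only the indices below the horizon [T] matter. *)
Definition policies : set (nat -> R.-pker X ~> U) :=
  [set pi | forall t, (t < T)%N -> kernel_dominated (pi t) (rho t)].

Definition transitions : set (nat -> R.-pker (X * U) ~> X) :=
  [set tau | forall t, (t < T)%N -> kernel_dominated (tau t) (iota t)].

Definition policy_kl pi t (x : X) : \bar R :=
  kl (kernel_at (pi t) x) (kernel_at (rho t) x).

Definition transition_kl tau t (z : X * U) : \bar R :=
  kl (kernel_at (tau t) z) (kernel_at (iota t) z).

Definition segment_transition_kl tau t n (xi : segment X U n) : \bar R :=
  \sum_(i < n) transition_kl tau (t + i) (tnth xi.1 i).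

Definition segment_objective pi tau t (x : X) : \bar R :=
  \int[segment_law pi tau (T - t) t x]_xi
    ((cT xi.2)%:E +
     \sum_(i < T - t)
       ((c (t + i)%N (tnth xi.1 i))%:E
        + (lP^-1)%:E * policy_kl pi (t + i) (tnth xi.1 i).1
        + (lS^-1)%:E * transition_kl tau (t + i) (tnth xi.1 i))).

(* The transition kernels considered against [pi]: those with a finite expected
   divergence.  Costs, and the divergences of policies, being nonnegative, the
   objective is then a well-defined element of ]-oo, +oo], for either sign of
   [lS].  The baseline [iota] itself always qualifies. *)
Definition segment_transitions pi t (x : X) : set (nat -> R.-pker (X * U) ~> X) :=
  [set tau | transitions tau /\
     \int[segment_law pi tau (T - t) t x]_xi segment_transition_kl tau t xi < +oo].

Definition segment_opt t (x : X) pi : \bar R :=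
  opt lS [set segment_objective pi tau t x | tau in segment_transitions pi t x].

Definition value t (x : X) : \bar R :=
  ereal_inf [set segment_opt t x pi | pi in policies].

Definition trajectory_law pi tau : set (segment X U T) -> \bar R :=
  init_law p0 (segment_law pi tau T 0).

Definition central_objective pi tau : \bar R :=
  \int[trajectory_law pi tau]_xi
    ((cT xi.2 + \sum_(t < T) c t (tnth xi.1 t))%:E
     + (lP^-1)%:E * \sum_(t < T) log_ratio (pi t) (rho t) (tnth xi.1 t)
     + (lS^-1)%:E * \sum_(t < T)
         log_ratio (tau t) (iota t) (tnth xi.1 t, segment_state xi t.+1)).

Definition central_transitions pi : set (nat -> R.-pker (X * U) ~> X) :=
  [set tau | transitions tau /\
     \int[trajectory_law pi tau]_xi segment_transition_kl tau 0 xi < +oo].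

Definition central_opt pi : \bar R :=
  opt lS [set central_objective pi tau | tau in central_transitions pi].

(* The one-step problems at a given state [x], respectively state-action pair [z],
   are over the distributions [mu] of the action, respectively of the next state. *)
Definition action_laws t (x : X) : set (probability U R) :=
  [set mu : probability U R | mu `<< rho t x].

Definition state_laws t (z : X * U) : set (probability X R) :=
  [set mu : probability X R | mu `<< iota t z /\ kl mu (kernel_at (iota t) z) < +oo].

Definition state_objective t z (f : X -> \bar R) (mu : probability X R) : \bar R :=
  \int[mu]_y f y + (lS^-1)%:E * kl mu (kernel_at (iota t) z).

Definition qvalue t (z : X * U) : \bar R :=
  opt lS [set state_objective t z (fun y => (c t z)%:E + value t.+1 y) mu
         | mu in state_laws t z].

Definition action_objective t x (f : U -> \bar R) (mu : probability U R) : \bar R :=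
  \int[mu]_u f u + (lP^-1)%:E * kl mu (kernel_at (rho t) x).

Definition gibbs_policy t (x : X) (A : set U) : \bar R :=
  \int[rho t x]_(u in A)
    (expeR ((- lP)%:E * qvalue t (x, u)) / expeR ((- lP)%:E * value t x)).

Definition gibbs_transition t (z : X * U) (A : set X) : \bar R :=
  \int[iota t z]_(y in A)
    (expeR ((- lS)%:E * ((c t z)%:E + value t.+1 y))
     / expeR ((- lS)%:E * qvalue t z)).

Definition is_gibbs pi tau := forall t, (t < T)%N ->
  (forall x A, measurable A -> pi t x A = gibbs_policy t x A) /\
  (forall z A, measurable A -> tau t z A = gibbs_transition t z A).

Definition finite_risks := forall t, (t < T)%N ->
  (forall x, entropic_risk lP (rho t x) (fun u => qvalue t (x, u)) \is a fin_num) /\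
  (forall z, entropic_risk lS (iota t z) (fun y => (c t z)%:E + value t.+1 y)
     \is a fin_num).

(* Finiteness of the expectations under the tilted kernels: for [lS < 0],
   finiteness of the risk alone does not make the maxima attained. *)
Definition finite_expectations := forall pi tau, is_gibbs pi tau ->
  [/\ forall t z, (t < T)%N -> \int[tau t z]_y value t.+1 y < +oo,
      forall t x, (t < T)%N ->
        \int[segment_law pi tau (T - t) t x]_xi segment_transition_kl tau t xi < +oo &
      \int[trajectory_law pi tau]_xi segment_transition_kl tau 0 xi < +oo].

End kl_control.

(* Main.v *)
Require Import Defs.
From HB Require Import structures.
From mathcomp Require Import all_boot all_order all_algebra.
From mathcomp Require Import all_classical all_reals all_analysis.
From mathcomp Require Import measurable_realfun ring lra.

Set Implicit Arguments.
Unset Strict Implicit.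
Unset Printing Implicit Defensive.
Import Order.TTheory GRing.Theory Num.Theory.
Import numFieldNormedType.Exports.

Local Open Scope classical_set_scope.
Local Open Scope ring_scope.
Local Open Scope ereal_scope.

(** The theorem combines a variational principle for one step with dynamic
    programming over the horizon.

    For one step, let [sigma] be a reference law, [f] a cost, [F] its entropic risk
    and [h = exp (- lam * (f - F))] the density of the Gibbs law.  As
    [ln h = - lam * (f - F)], the chain rule [kl_split] for relative entropy reads
      [E_mu[f] + kl mu sigma / lam = F + kl mu (h sigma) / lam].
    The last term has the sign of [lam] and vanishes only at the Gibbs law: the risk
    is the minimum for [lam > 0], the maximum for [lam < 0], and the Gibbs law is
    the only extremiser ([gibbs_gap_pos], [gibbs_gap_neg], [gibbs_argoptP]).

    Over the horizon, composing the risks backwards in time defines a real-valued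
    cost-to-go.  Every objective is a difference of expectations of nonnegative
    additive functionals of the trajectory, the divergences being put on the side
    where their weight is positive.  Comparing the two expectations one step at a
    time ([verification_le], [verification_ge]) turns the one-step inequalities
    into inequalities between the objective and the cost-to-go ([cost_to_go_ge],
    [cost_to_go_le]), with equality along the Gibbs pair; all terms being
    nonnegative, infinite expectations are covered.

    The lower bound for an arbitrary policy, [optimal_from_le], is delicate when
    [lS < 0]: the maximising transitions may have infinite divergence.  The Gibbs
    transitions of costs truncated at [n] have a divergence bounded by [- lS * n]
    per step, and the truncated cost-to-go converges to the full one, by dominated
    convergence of the partition functions.

    All this is done for a random initial state.  A point mass gives the value
    functions, which are thus identified with the cost-to-go
    ([finite_risks_finite_from], [valueE]); the law [p0] gives the central problem,
    where the expected log-likelihood ratios have first to be replaced by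
    divergences ([central_objectiveE]). *)

(** * Densities and relative entropy *)

Section relative_entropy_integrand.
Context {R : realType}.
Implicit Types x y : R.
Local Open Scope ring_scope.

(** For densities [p] and [h], the integral of [relent p h] is the divergence of
    [p] from [h].  The terms [- x + y], which integrate to zero between
    probabilities, make the integrand itself nonnegative, so that divergences are
    integrals of nonnegative functions, with values in [0, +oo]. *)
Definition relent x y := x * (ln x - ln y) - x + y.

Lemma relent_gt0 x y : 0 <= x -> 0 < y -> x != y -> 0 < relent x y.
Proof.
move=> x0 y0 xy; rewrite /relent; case: (ltgtP x 0) x0 => // [xgt0|->] _; last first.
  by rewrite mul0r oppr0 add0r add0r.
have u0 : ln y - ln x != 0.
  apply: contra xy => /eqP/subr0_eq h; apply/eqP.
  by apply: (@ln_inj R); rewrite ?posrE.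
have := expR_gt1Dx u0; rewrite expRB !lnK ?posrE// ltr_pdivlMr//; lra.
Qed.

Lemma relentxx x : relent x x = 0.
Proof. by rewrite /relent subrr mulr0 add0r addNr. Qed.

Lemma relent_ge0 x y : 0 <= x -> 0 < y -> 0 <= relent x y.
Proof.
move=> x0 y0; have [->|/relent_gt0 h] := eqVneq x y; first by rewrite relentxx.
exact/ltW/h.
Qed.

Lemma relentx1 x : relent x 1 = x * ln x - x + 1.
Proof. by rewrite /relent ln1 subr0. Qed.

Lemma measurable_relent d (T : measurableType d) (f g : T -> R) :
  measurable_fun setT f -> measurable_fun setT g ->
  measurable_fun setT (fun t => relent (f t) (g t)).
Proof.
move=> mf mg; rewrite /relent; apply: measurable_funD => //.
apply: measurable_funB => //; apply: measurable_funM => //.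
by apply: measurable_funB => //; exact: measurableT_comp (@measurable_ln R) _.
Qed.

End relative_entropy_integrand.

Lemma measurable_lne (R : realType) : measurable_fun [set: \bar R] (@lne R).
Proof.
rewrite (_ : @lne R = fun x => if x == +oo then +oo else
    if x <= 0 then -oo else (ln (fine x))%:E); last first.
  apply/funext => -[r| |]//=; rewrite ?lee_fin//.
  by rewrite leNye.
apply: measurable_fun_ifT => //; first exact: measurable_fun_eqe.
apply: measurable_fun_ifT => //; first exact: measurable_fun_lee.
by apply/measurable_EFinP; exact: measurableT_comp.
Qed.

Lemma adde1I (R : realType) (x y : \bar R) : x + 1 = y + 1 -> x = y.
Proof. by move/(congr1 (fun z => z - 1)); rewrite !addeK. Qed.

Lemma integral_cst1 d (Y : measurableType d) (R : realType) (sigma : probability Y R) :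
  \int[sigma]_y 1 = 1.
Proof.
rewrite (integral_cst sigma measurableT 1) mul1e; exact: probability_setT.
Qed.

Lemma maxr_subN (R : realDomainType) (a : R) :
  (Num.max a 0 - Num.max (- a) 0 = a)%R.
Proof.
have [l0|/ltW l0] := leP 0%R a.
  by rewrite max_r ?subr0// oppr_le0.
by rewrite max_l ?sub0r ?opprK// oppr_ge0.
Qed.

Section has_density.
Context d (Y : measurableType d) (R : realType).
Implicit Types (mu sigma : probability Y R) (p : Y -> R).
Local Open Scope charge_scope.

Definition has_density (mu sigma : {measure set Y -> \bar R}) p :=
  [/\ measurable_fun setT p, forall y, (0 <= p y)%R &
      forall A, measurable A -> mu A = \int[sigma]_(y in A) (p y)%:E].

Lemma density_dominates mu sigma p : has_density mu sigma p -> mu `<< sigma.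
Proof.
move=> [mp p0 mup]; apply/null_content_dominatesP => A mA sA0.
rewrite mup// (_ : \int[_]_(_ in A) _ = \int[sigma]_(y in A) `|(p y)%:E|).
  apply: integral_abs_eq0 => //.
  by apply/measurable_EFinP; exact: measurable_funTS.
by apply: eq_integral => y _; rewrite gee0_abs// lee_fin.
Qed.

Lemma dominates_density mu sigma : mu `<< sigma -> exists p, has_density mu sigma p.
Proof.
move=> ms; pose g := Radon_Nikodym_SigmaFinite.f mu sigma.
have gE y : g y = (fine (g y))%:E.
  by rewrite fineK//; exact: Radon_Nikodym_SigmaFinite.f_fin_num.
exists (fine \o g); split.
- apply: measurableT_comp => //; apply: measurable_int.
  exact: Radon_Nikodym_SigmaFinite.f_integrable.
- by move=> y /=; rewrite fine_ge0//; exact: Radon_Nikodym_SigmaFinite.f_ge0.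
- move=> A mA; apply: etrans (Radon_Nikodym_SigmaFinite.f_integral ms mA) _.
  by apply: eq_integral => y _; exact: gE.
Qed.

Lemma density_ae_eq mu sigma (g p : Y -> \bar R) :
  sigma.-integrable setT g -> measurable_fun setT p ->
  (forall A, measurable A -> mu A = \int[sigma]_(y in A) g y) ->
  (forall A, measurable A -> mu A = \int[sigma]_(y in A) p y) ->
  ae_eq sigma setT g p.
Proof.
move=> ig mp gA pA; apply: integral_ae_eq => // E _ mE.
by rewrite -gA// pA.
Qed.

Lemma ge0_integral_density mu sigma p (f : Y -> \bar R) :
  has_density mu sigma p -> (forall y, 0 <= f y) -> measurable_fun setT f ->
  \int[mu]_y f y = \int[sigma]_y (f y * (p y)%:E).
Proof.
move=> hp f0 mf; have ms := density_dominates hp; have [mp p0 mup] := hp.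
rewrite -(Radon_Nikodym_SigmaFinite.change_of_variables ms f0)//.
have mp' : measurable_fun setT (EFin \o p) by exact/measurable_EFinP.
have gi := Radon_Nikodym_SigmaFinite.f_integrable ms.
apply: ae_eq_integral => //.
- by apply: emeasurable_funM => //; exact: measurable_int gi.
- by apply: emeasurable_funM.
- apply: ae_eqe_mul2l; apply: density_ae_eq gi mp' _ mup.
  exact: Radon_Nikodym_SigmaFinite.f_integral.
Qed.

Lemma integral_density_cst mu sigma p : has_density mu sigma p ->
  \int[sigma]_y (p y)%:E = 1.
Proof. move=> [_ _ h]; apply: etrans (esym (h _ measurableT)) _.
exact: probability_setT. Qed.

(** Radon-Nikodym derivatives being unique almost everywhere, any density may
    stand for the one that [kl] is defined with. *)
Lemma klE mu sigma p : has_density mu sigma p ->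
  kl mu sigma = \int[mu]_y lne (p y)%:E.
Proof.
move=> hp; have ms := density_dominates hp; have [mp p0 mup] := hp.
have mp' : measurable_fun setT (EFin \o p) by exact/measurable_EFinP.
have ag : ae_eq mu setT ('d (charge_of_finite_measure mu) '/d sigma) (EFin \o p).
  apply: (null_dominates_ae_eq _ ms) => //.
  have ms' : charge_of_finite_measure mu `<< sigma by [].
  have ig := Radon_Nikodym_integrable ms'.
  apply: density_ae_eq ig mp' _ mup => A mA.
  by rewrite -(Radon_Nikodym_integral ms' mA).
apply: ae_eq_integral => //.
- by apply: measurableT_comp => //; exact: measurable_lne.
- by apply: measurableT_comp => //; exact: measurable_lne.
- by move: ag; apply: filterS => y /= h _; rewrite h.
Qed.

Let lne_neg_density p y : (0 <= p y)%R ->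
  (@lne R \o EFin \o p)^\- y * (p y)%:E = (p y * Num.max (- ln (p y)) 0)%:E.
Proof.
move=> p0; rewrite funenegE /=; case: ifPn => py.
  have -> : p y = 0%R by apply/eqP; rewrite eq_le p0 py.
  by rewrite mule0 mul0r.
by rewrite -EFinN -EFin_max -EFinM mulrC.
Qed.

Let lne_pos_density p y : (0 <= p y)%R ->
  (@lne R \o EFin \o p)^\+ y * (p y)%:E = (p y * Num.max (ln (p y)) 0)%:E.
Proof.
move=> p0; rewrite funeposE /=; case: ifPn => py.
  have -> : p y = 0%R by apply/eqP; rewrite eq_le p0 py.
  by rewrite mule0 mul0r.
by rewrite -EFin_max -EFinM mulrC.
Qed.

Let measurable_lne_density p : measurable_fun setT p ->
  measurable_fun setT (@lne R \o EFin \o p).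
Proof.
move=> mp; apply: (measurableT_comp (@measurable_lne R)).
exact/measurable_EFinP.
Qed.

(** Near the zeros of the density, the logarithm is tamed by the density itself,
    since [- x * ln x <= 1]; hence a divergence is never of the form oo - oo. *)
Lemma integral_lne_neg_le1 mu sigma p : has_density mu sigma p ->
  \int[mu]_y (@lne R \o EFin \o p)^\- y <= 1.
Proof.
move=> hp; have [mp p0 _] := hp.
rewrite (ge0_integral_density hp)//; last exact/measurable_funeneg/measurable_lne_density.
rewrite (eq_integral (fun y => (p y * Num.max (- ln (p y)) 0)%:E)); last first.
  by move=> y _; exact: lne_neg_density.
apply: (@le_trans _ _ (\int[sigma]_y (cst 1 y))); last first.
  by rewrite integral_cst1.
apply: ge0_le_integral => //.
- by move=> y _; rewrite lee_fin mulr_ge0// le_max lexx orbT.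
- apply/measurable_EFinP/measurable_funM => //; apply: measurable_maxr => //.
  by apply: measurableT_comp => //; exact: measurableT_comp.
- move=> y _; rewrite lee_fin; have := relent_ge0 (p0 y) (@ltr01 R).
  have := p0 y.
  by rewrite relentx1 maxEle; case: ifPn => _; lra.
Qed.

Let integral_relent1 mu sigma p : has_density mu sigma p ->
  \int[sigma]_y (relent (p y) 1)%:E + \int[mu]_y (@lne R \o EFin \o p)^\- y =
  \int[mu]_y (@lne R \o EFin \o p)^\+ y.
Proof.
move=> hp; have [mp p0 _] := hp; have mln := measurable_lne_density mp.
have m1 : measurable_fun setT (fun y => (relent (p y) 1)%:E).
  by apply/measurable_EFinP; exact: measurable_relent.
have mr (g : R -> R) : measurable_fun setT g ->
    measurable_fun setT (fun y => (p y * Num.max (g (ln (p y))) 0)%:E).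
  move=> mg; apply/measurable_EFinP/measurable_funM => //.
  by apply: measurable_maxr => //; do 2 apply: measurableT_comp => //.
have r0 y : 0 <= (relent (p y) 1)%:E by rewrite lee_fin relent_ge0.
have m0 (x z : R) : (0 <= z)%R -> 0 <= (z * Num.max x 0)%:E.
  by move=> z0; rewrite lee_fin mulr_ge0// le_max lexx orbT.
rewrite !(ge0_integral_density hp)//; last 2 first.
- exact: measurable_funepos.
- exact: measurable_funeneg.
rewrite (_ : \int[sigma]_y (_^\- y * _) =
    \int[sigma]_y (p y * Num.max (- ln (p y)) 0)%:E); last first.
  by apply: eq_integral => y _; exact: lne_neg_density.
rewrite (_ : \int[sigma]_y (_^\+ y * _) =
    \int[sigma]_y (p y * Num.max (ln (p y)) 0)%:E); last first.
  by apply: eq_integral => y _; exact: lne_pos_density.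
rewrite -ge0_integralD//; last 2 first.
- by move=> y _; exact: m0.
- exact: (mr -%R).
apply: adde1I; rewrite -{1}(integral_density_cst hp) -{1}(integral_cst1 sigma).
have mp' : measurable_fun setT (fun y => (p y)%:E) by exact/measurable_EFinP.
have p0' y : 0 <= (p y)%:E by rewrite lee_fin.
rewrite -!ge0_integralD//=.
- apply: eq_integral => y _; rewrite -!EFinD relentx1; congr EFin.
  have : (Num.max (ln (p y)) 0 - Num.max (- ln (p y)) 0 = ln (p y))%R.
    exact: maxr_subN.
  by move: (Num.max _ _) (Num.max _ _) => a b <-; ring.
- by move=> y _; exact: m0.
- exact: (mr id).
- by move=> y _; rewrite adde_ge0// m0.
- by apply: emeasurable_funD => //; exact: (mr -%R).
Qed.

Lemma kl_relent mu sigma p : has_density mu sigma p ->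
  kl mu sigma = \int[sigma]_y (relent (p y) 1)%:E.
Proof.
move=> hp; rewrite (klE hp) integralE -(integral_relent1 hp).
rewrite addeK// ge0_fin_numE; last by apply: integral_ge0.
by apply: le_lt_trans (integral_lne_neg_le1 hp) _; rewrite ltry.
Qed.

Lemma integral_lne_pos mu sigma p : has_density mu sigma p ->
  \int[mu]_y (@lne R \o EFin \o p)^\+ y =
  kl mu sigma + \int[mu]_y (@lne R \o EFin \o p)^\- y.
Proof. by move=> hp; rewrite (kl_relent hp) integral_relent1. Qed.

Lemma kl_ge0 mu sigma p : has_density mu sigma p -> 0 <= kl mu sigma.
Proof.
move=> hp; rewrite (kl_relent hp); case: hp => _ p0 _.
by apply: integral_ge0 => y _; rewrite lee_fin relent_ge0.
Qed.

(** The chain rule for a change of reference: if [h] is a second density, with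
    [ln h = P - Q], then [kl mu sigma] is [E_mu[ln h]] plus the divergence from
    [mu] to [h sigma], which is the last integral.  Keeping [P] and [Q] on either
    side of the equation makes it valid in [0, +oo] without any integrability. *)
Lemma kl_split mu sigma p (h P Q : Y -> R) : has_density mu sigma p ->
  measurable_fun setT h -> measurable_fun setT P -> measurable_fun setT Q ->
  (forall y, 0 < h y)%R -> (forall y, 0 <= P y)%R -> (forall y, 0 <= Q y)%R ->
  (forall y, ln (h y) = P y - Q y)%R ->
  \int[sigma]_y (h y)%:E = 1 ->
  kl mu sigma + \int[mu]_y (Q y)%:E =
  \int[mu]_y (P y)%:E + \int[sigma]_y (relent (p y) (h y))%:E.
Proof.
move=> hp mh mP mQ h0 P0 Q0 lnh h1; have [mp p0 _] := hp.
have m1 : measurable_fun setT (fun y => (relent (p y) 1)%:E).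
  by apply/measurable_EFinP; exact: measurable_relent.
have m2 : measurable_fun setT (fun y => (relent (p y) (h y))%:E).
  by apply/measurable_EFinP; exact: measurable_relent.
have mM (g : Y -> R) : measurable_fun setT g ->
    measurable_fun setT (fun y => (g y)%:E * (p y)%:E).
  move=> mg; rewrite [X in measurable_fun _ X](_ : _ = EFin \o (g \* p)%R)//.
  by apply/measurable_EFinP; exact: measurable_funM.
have M0 (g : Y -> R) y : (forall y, 0 <= g y)%R -> 0 <= (g y)%:E * (p y)%:E.
  by move=> g0; rewrite -EFinM lee_fin mulr_ge0.
have r1 y : 0 <= (relent (p y) 1)%:E by rewrite lee_fin relent_ge0.
have r2 y : 0 <= (relent (p y) (h y))%:E by rewrite lee_fin relent_ge0.
have mh' : measurable_fun setT (fun y => (h y)%:E) by exact/measurable_EFinP.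
have h0' y : 0 <= (h y)%:E by rewrite lee_fin ltW.
have muM (g : Y -> R) : measurable_fun setT g -> (forall y, 0 <= g y)%R ->
    \int[mu]_y (g y)%:E = \int[sigma]_y ((g y)%:E * (p y)%:E).
  move=> mg g0; apply: (ge0_integral_density hp) => [y|]; first by rewrite lee_fin.
  exact/measurable_EFinP.
rewrite (kl_relent hp) (muM _ mP P0) (muM _ mQ Q0).
apply: adde1I; rewrite -{1}h1 -{1}(integral_cst1 sigma).
rewrite -!ge0_integralD//=.
- apply: eq_integral => y _; rewrite -!EFinM -!EFinD; congr EFin.
  by rewrite /relent ln1 lnh; ring.
- by move=> y _; rewrite adde_ge0// M0.
- by apply: emeasurable_funD => //; exact: mM.
- by move=> y _; rewrite M0.
- exact: mM.
- by move=> y _; rewrite adde_ge0// M0.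
- by apply: emeasurable_funD => //; exact: mM.
- by move=> y _; rewrite M0.
- exact: mM.
Qed.

(** The integrand is nonnegative and vanishes only on the diagonal, so that [p]
    and [h] agree almost everywhere. *)
Lemma relent_integral_eq0 mu sigma p (h : Y -> R) : has_density mu sigma p ->
  measurable_fun setT h -> (forall y, 0 < h y)%R ->
  \int[sigma]_y (relent (p y) (h y))%:E = 0 ->
  forall A, measurable A -> mu A = \int[sigma]_(y in A) (h y)%:E.
Proof.
move=> hp mh h0 int0 A mA; have [mp p0 muE] := hp; rewrite muE//.
have mr : measurable_fun setT (fun y => (relent (p y) (h y))%:E).
  by apply/measurable_EFinP; exact: measurable_relent.
have : \int[sigma]_y `|(relent (p y) (h y))%:E| = 0.
  rewrite -[RHS]int0; apply: eq_integral => y _.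
  by rewrite gee0_abs// lee_fin relent_ge0.
move/(ae_eq_integral_abs sigma measurableT mr) => rel0.
apply: ae_eq_integral => //.
- exact/measurable_funTS/measurable_EFinP.
- exact/measurable_funTS/measurable_EFinP.
apply: (ae_eq_subset (@subsetT _ A)).
move: rel0; apply: filterS => y /= /(_ I) [] rel0 _.
have [->//|ph] := eqVneq (p y) (h y).
by have := relent_gt0 (p0 y) (h0 y) ph; rewrite rel0 ltxx.
Qed.

Lemma density_ae_unique mu sigma p h : has_density mu sigma p ->
  has_density mu sigma h -> ae_eq sigma setT (EFin \o p) (EFin \o h).
Proof.
move=> hp [mh h0 muh]; have [mp p0 mup] := hp.
apply: density_ae_eq mup muh; last exact/measurable_EFinP.
apply/integrableP; split; first exact/measurable_EFinP.
rewrite (eq_integral (EFin \o p)); last first.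
  by move=> y _ /=; rewrite ger0_norm.
by rewrite (integral_density_cst hp) ltry.
Qed.

Lemma relent_integral_self mu sigma p h : has_density mu sigma p ->
  has_density mu sigma h ->
  \int[sigma]_y (relent (p y) (h y))%:E = 0.
Proof.
move=> hp hh; have [mp _ _] := hp; have [mh _ _] := hh.
rewrite (ae_eq_integral (cst 0))// ?integral0//.
- by apply/measurable_EFinP; exact: measurable_relent.
- move: (density_ae_unique hp hh); apply: filterS => y /= /(_ I) [->] _.
  by rewrite relentxx.
Qed.

End has_density.

(** * Kernels given by a density *)

Section density_kernel.
Context d d' (X : measurableType d) (Y : measurableType d') (R : realType).
Variables (s : R.-pker X ~> Y) (h : X * Y -> R).
Hypotheses (mh : measurable_fun setT h) (h0 : forall w, (0 <= h w)%R).
Hypothesis h1 : forall x, \int[s x]_y (h (x, y))%:E = 1.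

(** The proofs that [h] is a density are arguments of the constant, so that the
    measure structures declared on it can refer to them. *)
Definition density_kernel_def of (measurable_fun setT h)
    & (forall w, (0 <= h w)%R) & (forall x, \int[s x]_y (h (x, y))%:E = 1) :=
  fun (x : X) (A : set Y) => \int[s x]_(y in A) (h (x, y))%:E.

Let dk := density_kernel_def mh h0 h1.

Let mhx x : measurable_fun setT (fun y => (h (x, y))%:E).
Proof. by apply/measurable_EFinP; apply: measurable_fun_pair2. Qed.

Let dk0 x : dk x set0 = 0. Proof. by rewrite /dk /density_kernel_def integral_set0. Qed.

Let dk_ge0 x A : 0 <= dk x A.
Proof. by apply: integral_ge0 => y _; rewrite lee_fin. Qed.

Let dk_sigma_additive x : semi_sigma_additive (dk x).
Proof. by apply: semi_sigma_additive_nng_induced => // y; rewrite lee_fin. Qed.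

HB.instance Definition _ x := isMeasure.Build _ _ _ (dk x)
  (dk0 x) (dk_ge0 x) (@dk_sigma_additive x).

Definition density_kernel : X -> {measure set Y -> \bar R} := dk.

Let measurable_density_kernel A : measurable A ->
  measurable_fun setT (density_kernel ^~ A).
Proof.
move=> mA; rewrite (_ : _ ^~ _ =
    fun x => \int[s x]_y ((h (x, y))%:E * (\1_A y)%:E)); last first.
  apply/funext => x; rewrite /density_kernel /= /dk /density_kernel_def.
  by rewrite integral_mkcond epatch_indic.
apply: (measurable_fun_integral_finite_kernel
  (fun w : X * Y => (h w)%:E * (\1_A w.2)%:E)) => [z|].
  by rewrite -EFinM lee_fin mulr_ge0.
apply: emeasurable_funM; first exact/measurable_EFinP.
by apply/measurable_EFinP; exact: measurableT_comp.
Qed.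

HB.instance Definition _ :=
  isKernel.Build _ _ _ _ _ density_kernel measurable_density_kernel.

Let density_kernelT x : density_kernel x setT = 1. Proof. exact: h1. Qed.

HB.instance Definition _ :=
  Kernel_isProbability.Build _ _ _ _ _ density_kernel density_kernelT.

Lemma density_kernel_exists : exists k : R.-pker X ~> Y, is_kernel_density k s h.
Proof. by exists density_kernel. Qed.

End density_kernel.

Section kernel_density_at.
Context d d' (X : measurableType d) (Y : measurableType d') (R : realType).
Variables (k s : R.-pker X ~> Y).

Lemma has_density_at p x : is_kernel_density k s p ->
  has_density (kernel_at k x) (kernel_at s x) (fun y => p (x, y)).
Proof.
move=> [mp p0 kE]; split => // [|A mA]; first exact: measurable_fun_pair2.
exact: kE.
Qed.

Lemma density_kernel_dominated p : is_kernel_density k s p -> kernel_dominated k s.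
Proof.
move=> kp; split; last by exists p.
by move=> x; exact: (density_dominates (has_density_at x kp)).
Qed.

Lemma kernel_densityP : kernel_dominated k s ->
  is_kernel_density k s (kernel_density k s).
Proof. by move=> [_ [p kp]]; rewrite /kernel_density; case: xgetP => // /(_ p). Qed.

Lemma kernel_kl_ge0 x : kernel_dominated k s -> 0 <= kl (kernel_at k x) (kernel_at s x).
Proof. by move=> [_ [p /(has_density_at x)/kl_ge0]]. Qed.

(** Through a jointly measurable density the divergence is the integral of a
    nonnegative function of the two arguments, hence measurable in the first. *)
Lemma measurable_kernel_kl : kernel_dominated k s ->
  measurable_fun setT (fun x => kl (kernel_at k x) (kernel_at s x)).
Proof.
move=> [_ [p kp]]; have [mp p0 _] := kp.
rewrite (_ : (fun _ => _) = fun x => \int[s x]_y (relent (p (x, y)) 1)%:E).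
  apply: (measurable_fun_integral_finite_kernel (fun w => (relent (p w) 1)%:E)).
    by move=> w; rewrite lee_fin relent_ge0.
  by apply/measurable_EFinP; exact: measurable_relent.
by apply/funext => x; rewrite (kl_relent (has_density_at x kp)).
Qed.

End kernel_density_at.

Lemma kernel_dominated_refl d d' (X : measurableType d) (Y : measurableType d')
  (R : realType) (s : R.-pker X ~> Y) : kernel_dominated s s.
Proof.
split; first by move=> x A.
exists (fun=> 1%R); split; [exact: measurable_cst|by []|move=> x A mA].
by rewrite (integral_cst (s x) mA 1) mul1e.
Qed.

Lemma ge0_integralZl_real d (Y : measurableType d) (R : realType)
    (mu : {measure set Y -> \bar R}) (f : Y -> R) (r : R) :
  measurable_fun setT f -> (forall y, 0 <= f y)%R -> (0 <= r)%R ->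
  \int[mu]_y (r * f y)%:E = r%:E * \int[mu]_y (f y)%:E.
Proof.
move=> mf f0 r0; rewrite -(ge0_integralZl_EFin _ measurableT)//.
- by move=> y _; rewrite lee_fin.
- exact/measurable_EFinP.
Qed.

(** * Gibbs laws and the entropic risk *)

Section weights.
Context {R : realType}.
Variable lam : R.
Local Open Scope ring_scope.

(** The positive and negative parts of [1 / lam].  An equation or inequality with
    a term in [1 / lam] is stated with the part [wpos] on one side and [wneg] on
    the other: for either sign of [lam] all its terms are then nonnegative. *)
Definition wpos : R := Num.max lam^-1 0.
Definition wneg : R := Num.max (- lam^-1) 0.

Lemma wpos_ge0 : (0 <= wpos). Proof. by rewrite le_max lexx orbT. Qed.
Lemma wneg_ge0 : (0 <= wneg). Proof. by rewrite le_max lexx orbT. Qed.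

Lemma wpos_gt0 : (0 < lam) -> wpos = (lam^-1).
Proof. by move=> l0; apply: max_l; rewrite invr_ge0 ltW. Qed.

Lemma wneg_gt0 : (0 < lam) -> wneg = 0.
Proof. by move=> l0; apply: max_r; rewrite oppr_le0 invr_ge0 ltW. Qed.

Lemma wpos_lt0 : (lam < 0) -> wpos = 0.
Proof. by move=> l0; apply: max_r; rewrite invr_le0 ltW. Qed.

Lemma wneg_lt0 : (lam < 0) -> wneg = (- lam^-1).
Proof. by move=> l0; apply: max_l; rewrite oppr_ge0 invr_le0 ltW. Qed.

End weights.

Section gibbs.
Context d (Y : measurableType d) (R : realType).
Implicit Types (sigma : {measure set Y -> \bar R}) (lam : R) (f : Y -> R).

Definition partition lam sigma f : \bar R := \int[sigma]_y (expR (- lam * f y))%:E.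

(** The entropic risk as a real number.  Where the partition function is infinite
    the value is 0, which keeps the risk of a nonnegative cost nonnegative. *)
Definition risk lam sigma f : R := (- lam^-1 * ln (fine (partition lam sigma f)))%R.

Definition gibbs_density lam sigma f y : R :=
  expR (- lam * (f y - risk lam sigma f)).

Section fixed_reference.
Variables (sigma : probability Y R) (lam : R) (f : Y -> R).
Hypotheses (lam0 : lam != 0%R) (mf : measurable_fun setT f).
Hypothesis f0 : forall y, (0 <= f y)%R.

Let mexp : measurable_fun setT (fun y => (expR (- lam * f y))%:E).
Proof.
by apply/measurable_EFinP; apply: measurableT_comp => //; exact: measurable_funM.
Qed.

Lemma partition_gt0 : 0 < partition lam sigma f.
Proof.
rewrite lt_neqAle integral_ge0 ?andbT; last first.
  by move=> y _; rewrite lee_fin expR_ge0.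
apply/negP => /eqP Z0.
have : \int[sigma]_y `|(expR (- lam * f y))%:E| = 0.
  rewrite [RHS]Z0; apply: eq_integral => y _.
  by rewrite gee0_abs// lee_fin expR_ge0.
move/(ae_eq_integral_abs sigma measurableT mexp) => [N [mN N0 sN]].
suff NT : N = setT.
  move: N0; rewrite NT => /(etrans (esym (@probability_setT _ _ _ sigma)))/eqP.
  by rewrite onee_eq0.
apply/seteqP; split => // y _; apply: sN => /= /(_ I) [] /eqP.
by rewrite expR_eq0.
Qed.

Lemma entropic_risk_partition : entropic_risk lam sigma (EFin \o f) \is a fin_num ->
  partition lam sigma f < +oo.
Proof.
rewrite /entropic_risk /partition => h; rewrite ltey; apply/eqP => Zy.
move: h; rewrite (_ : \int[_]_y _ = +oo) //=.
case: (ltgtP lam 0%R) lam0 => // l0 _.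
  by rewrite gt0_muley// lte_fin oppr_gt0 invr_lt0.
by rewrite lt0_muley// lte_fin oppr_lt0 invr_gt0.
Qed.

Lemma relent_integral_ge0 (mu : probability Y R) p h : has_density mu sigma p ->
  (forall y, 0 < h y)%R -> 0 <= \int[sigma]_y (relent (p y) (h y))%:E.
Proof.
by move=> [_ p0 _] h0; apply: integral_ge0 => y _; rewrite lee_fin relent_ge0.
Qed.

Lemma risk_ge0 : (0 <= risk lam sigma f)%R.
Proof.
(* An infinite partition function has [fine] equal to 0, whose logarithm is 0. *)
have [Zfin|] := ltP (partition lam sigma f) +oo; last first.
  by rewrite leye_eq => /eqP Zy; rewrite /risk Zy/= ln0 ?mulr0.
have ZE : partition lam sigma f = (fine (partition lam sigma f))%:E.
  by rewrite fineK// ge0_fin_numE// ltW// partition_gt0.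
have [l0|l0] := ltrP 0 lam; last first.
  rewrite /risk mulr_ge0 ?oppr_ge0 ?invr_le0// ln_ge0//.
  rewrite -lee_fin -ZE -(integral_cst1 sigma); apply: ge0_le_integral => //.
  by move=> y _; rewrite lee_fin -expR0 ler_expR mulr_ge0// oppr_ge0.
rewrite /risk mulNr -mulrN; apply: mulr_ge0; first by rewrite invr_ge0 ltW.
rewrite oppr_ge0 ln_le0//.
rewrite -lee_fin -ZE -(integral_cst1 sigma); apply: ge0_le_integral => //.
by move=> y _; rewrite lee_fin -expR0 ler_expR mulNr oppr_le0 mulr_ge0// ltW.
Qed.

Hypothesis Zfin : partition lam sigma f < +oo.

Let Z := fine (partition lam sigma f).

Let ZE : partition lam sigma f = Z%:E.
Proof. by rewrite fineK// ge0_fin_numE// ltW// partition_gt0. Qed.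

Let Z_gt0 : (0 < Z)%R.
Proof. by rewrite -lte_fin -ZE partition_gt0. Qed.

Lemma entropic_riskE : entropic_risk lam sigma (EFin \o f) = (risk lam sigma f)%:E.
Proof.
rewrite /entropic_risk (_ : \int[_]_y _ = Z%:E); last by rewrite -ZE.
by rewrite lne_EFin// -EFinM.
Qed.

Lemma measurable_gibbs_density : measurable_fun setT (gibbs_density lam sigma f).
Proof.
apply: measurableT_comp => //; apply: measurable_funM => //.
exact: measurable_funB.
Qed.

Lemma integral_gibbs_density : \int[sigma]_y (gibbs_density lam sigma f y)%:E = 1.
Proof.
rewrite (eq_integral (fun y => (Z^-1)%:E * (expR (- lam * f y))%:E)); last first.
  move=> y _; rewrite -EFinM; congr EFin; rewrite /gibbs_density mulrBr expRB /risk.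
  rewrite mulrA mulrNN divff// mul1r lnK ?posrE//.
  by rewrite mulrC.
rewrite ge0_integralZl_EFin//; last by rewrite invr_ge0 ltW.
by rewrite -/(partition lam sigma f) ZE -EFinM mulVf// gt_eqF.
Qed.

(** Gap in the variational inequality: the objective at [mu] exceeds the risk by a
    multiple of the divergence from [mu] to the Gibbs law.  The sign of [lam] only
    decides on which side of the equation the two terms in [1 / lam] stand. *)
Lemma gibbs_gap_pos (mu : probability Y R) p : has_density mu sigma p -> (0 < lam)%R ->
  \int[mu]_y (f y)%:E + (lam^-1)%:E * kl mu sigma =
  (risk lam sigma f)%:E + (lam^-1)%:E *
    \int[sigma]_y (relent (p y) (gibbs_density lam sigma f y))%:E.
Proof.
move=> hp l0; set F := risk lam sigma f; set h := gibbs_density lam sigma f.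
have F0 : (0 <= F)%R := risk_ge0.
have := @kl_split _ _ _ mu sigma p h (fun=> lam * F)%R (fun y => lam * f y)%R
  hp measurable_gibbs_density _ _ _ _ _ _ integral_gibbs_density.
have mlf : measurable_fun setT (fun y => lam * f y)%R by exact: measurable_funM.
move=> /(_ (measurable_cst _) mlf (fun=> expR_gt0 _)) split_eq.
have {split_eq} : kl mu sigma + \int[mu]_y (lam * f y)%:E =
    \int[mu]_y (lam * F)%:E + \int[sigma]_y (relent (p y) (h y))%:E.
  apply: split_eq => y; [by rewrite mulr_ge0// ltW..|].
  by rewrite /h /gibbs_density expRK mulrBr !mulNr opprK addrC.
rewrite (integral_cst mu measurableT (lam * F)%:E) [X in _ * X](@probability_setT _ _ _ mu) mule1.
rewrite (ge0_integralZl_real _ mf f0); last exact: ltW.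
move/(congr1 (fun z => (lam^-1)%:E * z)).
have rel0 : 0 <= \int[sigma]_y (relent (p y) (h y))%:E.
  apply: integral_ge0 => y _; rewrite lee_fin relent_ge0 ?expR_gt0//.
  by case: hp.
have intf0 : 0 <= \int[mu]_y (f y)%:E by apply: integral_ge0 => y _; rewrite lee_fin.
have lamK x : (lam^-1)%:E * (lam%:E * x) = x.
  by rewrite muleA -EFinM mulVf// mul1e.
have lF0 : 0 <= (lam * F)%:E by rewrite lee_fin mulr_ge0// ltW.
have lf0 : 0 <= lam%:E * \int[mu]_y (f y)%:E by rewrite mule_ge0// lee_fin ltW.
rewrite (ge0_muleDr _ (kl_ge0 hp) lf0) (ge0_muleDr _ lF0 rel0).
by rewrite EFinM !lamK addeC.
Qed.

Lemma gibbs_gap_neg (mu : probability Y R) p : has_density mu sigma p -> (lam < 0)%R ->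
  (risk lam sigma f)%:E + (- lam^-1)%:E * kl mu sigma =
  \int[mu]_y (f y)%:E + (- lam^-1)%:E *
    \int[sigma]_y (relent (p y) (gibbs_density lam sigma f y))%:E.
Proof.
move=> hp l0; set F := risk lam sigma f; set h := gibbs_density lam sigma f.
have F0 : (0 <= F)%R := risk_ge0.
have a0 : (0 < - lam)%R by rewrite oppr_gt0.
have := @kl_split _ _ _ mu sigma p h (fun y => - lam * f y)%R (fun=> - lam * F)%R
  hp measurable_gibbs_density _ _ _ _ _ _ integral_gibbs_density.
have mlf : measurable_fun setT (fun y => - lam * f y)%R by exact: measurable_funM.
move=> /(_ mlf (measurable_cst _) (fun=> expR_gt0 _)) split_eq.
have {split_eq} : kl mu sigma + \int[mu]_y (- lam * F)%:E =
    \int[mu]_y (- lam * f y)%:E + \int[sigma]_y (relent (p y) (h y))%:E.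
  apply: split_eq => y; [by rewrite mulr_ge0// ltW..|].
  by rewrite /h /gibbs_density expRK mulrBr.
rewrite (integral_cst mu measurableT (- lam * F)%:E) [X in _ * X](@probability_setT _ _ _ mu) mule1.
rewrite (ge0_integralZl_real _ mf f0); last exact: ltW.
move/(congr1 (fun z => (- lam^-1)%:E * z)).
have rel0 : 0 <= \int[sigma]_y (relent (p y) (h y))%:E.
  apply: integral_ge0 => y _; rewrite lee_fin relent_ge0 ?expR_gt0//.
  by case: hp.
have intf0 : 0 <= \int[mu]_y (f y)%:E by apply: integral_ge0 => y _; rewrite lee_fin.
have lamK x : (- lam^-1)%:E * ((- lam)%:E * x) = x.
  by rewrite muleA -EFinM mulrNN mulVf// mul1e.
have lF0 : 0 <= (- lam * F)%:E by rewrite lee_fin mulr_ge0// ltW.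
have lf0 : 0 <= (- lam)%:E * \int[mu]_y (f y)%:E by rewrite mule_ge0// lee_fin ltW.
rewrite (ge0_muleDr _ (kl_ge0 hp) lF0) (ge0_muleDr _ lf0 rel0).
by rewrite EFinM !lamK => <-; rewrite addeC.
Qed.

Lemma gibbs_lower (mu : probability Y R) : mu `<< sigma -> (0 < lam)%R ->
  (risk lam sigma f)%:E + (wneg lam)%:E * kl mu sigma <=
  \int[mu]_y (f y)%:E + (wpos lam)%:E * kl mu sigma.
Proof.
move=> /dominates_density[p hp] l0.
rewrite (wpos_gt0 l0) (wneg_gt0 l0) mul0e adde0 (gibbs_gap_pos hp l0).
rewrite leeDl// mule_ge0//; first by rewrite lee_fin invr_ge0 ltW.
by apply: (relent_integral_ge0 hp) => y; exact: expR_gt0.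
Qed.

Lemma gibbs_upper (mu : probability Y R) : mu `<< sigma -> (lam < 0)%R ->
  \int[mu]_y (f y)%:E + (wpos lam)%:E * kl mu sigma <=
  (risk lam sigma f)%:E + (wneg lam)%:E * kl mu sigma.
Proof.
move=> /dominates_density[p hp] l0.
rewrite (wpos_lt0 l0) (wneg_lt0 l0) mul0e adde0 (gibbs_gap_neg hp l0).
rewrite leeDl// mule_ge0//; first by rewrite lee_fin oppr_ge0 invr_le0 ltW.
by apply: (relent_integral_ge0 hp) => y; exact: expR_gt0.
Qed.

Lemma gibbs_attained (mu : probability Y R) :
  has_density mu sigma (gibbs_density lam sigma f) ->
  \int[mu]_y (f y)%:E + (wpos lam)%:E * kl mu sigma =
  (risk lam sigma f)%:E + (wneg lam)%:E * kl mu sigma.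
Proof.
move=> hg; have K0 := relent_integral_self hg hg.
case: (ltgtP lam 0%R) lam0 => // l0 _.
  rewrite (wpos_lt0 l0) (wneg_lt0 l0) mul0e adde0 (gibbs_gap_neg hg l0) K0.
  by rewrite mule0 adde0.
rewrite (wpos_gt0 l0) (wneg_gt0 l0) mul0e adde0 (gibbs_gap_pos hg l0) K0.
by rewrite mule0 adde0.
Qed.

Let kl_fin (mu : probability Y R) : mu `<< sigma -> kl mu sigma < +oo ->
  kl mu sigma \is a fin_num.
Proof.
by move=> /dominates_density[p hp] ?; rewrite ge0_fin_numE// (kl_ge0 hp).
Qed.

(** For [lam < 0] the risk bounds every moment up to a divergence, so a law of
    finite divergence has a finite moment. *)
Lemma gibbs_moment_fin (mu : probability Y R) : mu `<< sigma -> (lam < 0)%R ->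
  kl mu sigma < +oo -> \int[mu]_y (f y)%:E \is a fin_num.
Proof.
move=> ms l0 klfin; have := gibbs_upper ms l0.
rewrite (wpos_lt0 l0) mul0e adde0 => intf_le.
rewrite ge0_fin_numE; last by apply: integral_ge0 => y _; rewrite lee_fin.
apply: le_lt_trans intf_le _; rewrite -ge0_fin_numE.
  by rewrite fin_numD fin_numM// kl_fin.
rewrite adde_ge0 ?lee_fin ?risk_ge0// mule_ge0 ?lee_fin ?wneg_ge0//.
by have [p /kl_ge0] := dominates_density ms.
Qed.

(** Equality in the variational inequality cancels the finite risk, or moment, and
    leaves the divergence to the Gibbs law, which must vanish. *)
Lemma gibbs_unique (mu : probability Y R) : mu `<< sigma ->
  ((lam < 0)%R -> kl mu sigma < +oo) ->
  \int[mu]_y (f y)%:E + (wpos lam)%:E * kl mu sigma =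
  (risk lam sigma f)%:E + (wneg lam)%:E * kl mu sigma ->
  forall A, measurable A ->
    mu A = \int[sigma]_(y in A) (gibbs_density lam sigma f y)%:E.
Proof.
move=> /dominates_density[p hp] klfin eqJ.
apply: (relent_integral_eq0 hp measurable_gibbs_density) => [y|].
  exact: expR_gt0.
set K := integral _ _ _.
have wK (w : R) (x : \bar R) : (w != 0)%R -> x \is a fin_num ->
    x = x + w%:E * K -> K = 0.
  move=> w0 xfin /eqP; rewrite eq_sym -[eqbRHS]adde0 => /eqP /(congr1 (fun z => z - x)).
  rewrite -!addeA [w%:E * K - x]addeC !addeA subee// add0e => /eqP.
  by rewrite adde0 subee// mule_eq0 eqe (negbTE w0) => /eqP.
move: eqJ; case: (ltgtP lam 0%R) lam0 => // l0 _.
  rewrite (wpos_lt0 l0) (wneg_lt0 l0) mul0e adde0 (gibbs_gap_neg hp l0) -/K.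
  apply: wK; first by rewrite oppr_eq0 invr_eq0.
  by apply: (gibbs_moment_fin (density_dominates hp)) => //; exact: klfin.
rewrite (wpos_gt0 l0) (wneg_gt0 l0) mul0e adde0 (gibbs_gap_pos hp l0) -/K => /esym.
by apply: wK => //; rewrite invr_eq0.
Qed.

Definition gibbs_objective (mu : probability Y R) : \bar R :=
  \int[mu]_y (f y)%:E + (lam^-1)%:E * kl mu sigma.

Let wneg_kl_fin (mu : probability Y R) : mu `<< sigma ->
  ((lam < 0)%R -> kl mu sigma < +oo) -> (wneg lam)%:E * kl mu sigma \is a fin_num.
Proof.
move=> ms klfin; case: (ltgtP lam 0%R) lam0 => // l0 _.
  by rewrite fin_numM// kl_fin// klfin.
by rewrite (wneg_gt0 l0) mul0e.
Qed.

Lemma gibbs_objectiveE (mu : probability Y R) : mu `<< sigma ->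
  ((lam < 0)%R -> kl mu sigma < +oo) ->
  \int[mu]_y (f y)%:E + (wpos lam)%:E * kl mu sigma =
  gibbs_objective mu + (wneg lam)%:E * kl mu sigma.
Proof.
move=> ms klfin; rewrite /gibbs_objective; case: (ltgtP lam 0%R) lam0 => // l0 _.
  rewrite (wpos_lt0 l0) (wneg_lt0 l0) mul0e adde0 EFinN mulNe.
  by rewrite addeK// fin_numM// kl_fin// klfin.
by rewrite (wpos_gt0 l0) (wneg_gt0 l0) mul0e adde0.
Qed.

Lemma gibbs_objective_bound (mu : probability Y R) : mu `<< sigma ->
  ((lam < 0)%R -> kl mu sigma < +oo) ->
  if (0 < lam)%R then (risk lam sigma f)%:E <= gibbs_objective mu
  else gibbs_objective mu <= (risk lam sigma f)%:E.
Proof.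
move=> ms klfin; have wkl := wneg_kl_fin ms klfin.
case: ltP lam0 => [l0 _|l0 lN0]; rewrite -(leeD2rE _ _ wkl) -gibbs_objectiveE//.
  exact: gibbs_lower.
by apply: gibbs_upper => //; rewrite lt_neqAle lN0.
Qed.

Lemma gibbs_objective_eq (mu : probability Y R) : mu `<< sigma ->
  ((lam < 0)%R -> kl mu sigma < +oo) ->
  gibbs_objective mu = (risk lam sigma f)%:E <->
  forall A, measurable A ->
    mu A = \int[sigma]_(y in A) (gibbs_density lam sigma f y)%:E.
Proof.
move=> ms klfin; split=> [Jmu|muE].
  by apply: gibbs_unique => //; rewrite gibbs_objectiveE// Jmu.
have /gibbs_attained : has_density mu sigma (gibbs_density lam sigma f).
  by split => //; [exact: measurable_gibbs_density|move=> y; exact: expR_ge0].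
rewrite gibbs_objectiveE// => /(congr1 (fun z => z - (wneg lam)%:E * kl mu sigma)).
by rewrite !addeK// wneg_kl_fin.
Qed.

End fixed_reference.

Let measurable_boltzmann lam (f : Y -> R) : measurable_fun setT f ->
  measurable_fun setT (fun y => (expR (- lam * f y))%:E).
Proof.
move=> mf; apply/measurable_EFinP; apply: measurableT_comp => //.
exact: measurable_funM.
Qed.

Let boltzmann_le lam (a b : R) : (0 <= b <= a)%R ->
  (expR (- lam * b) <= expR (- lam * a) + 1)%R.
Proof.
move=> /andP[b0 ba]; have [l0|l0] := leP 0%R lam.
  apply: (@le_trans _ _ 1%R); last by rewrite lerDr expR_ge0.
  by rewrite -expR0 ler_expR mulNr oppr_le0 mulr_ge0.
apply: (@le_trans _ _ (expR (- lam * a))); last by rewrite lerDl.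
by rewrite ler_expR ler_pM2l ?oppr_gt0.
Qed.

Let integrable_boltzmannD1 (sigma : probability Y R) lam f :
  measurable_fun setT f -> partition lam sigma f < +oo ->
  sigma.-integrable setT (fun y => (expR (- lam * f y) + 1)%:E).
Proof.
move=> mf Zfin; apply/integrableP; split.
  apply/measurable_EFinP; apply: measurable_funD => //.
  by apply: measurableT_comp => //; exact: measurable_funM.
rewrite (eq_integral (fun y => (expR (- lam * f y))%:E + 1)); last first.
  by move=> y _; rewrite gee0_abs// lee_fin addr_ge0 ?expR_ge0.
rewrite ge0_integralD//; last exact: measurable_boltzmann.
by rewrite integral_cst1 lte_add_pinfty// ltry.
Qed.

Lemma partition_le_lty (sigma : probability Y R) lam f (g : Y -> R) :
  measurable_fun setT f -> measurable_fun setT g ->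
  (forall y, 0 <= g y <= f y)%R -> partition lam sigma f < +oo ->
  partition lam sigma g < +oo.
Proof.
move=> mf mg gf Zfin; have := integrable_boltzmannD1 mf Zfin.
move=> /integrableP[mf1]; apply: le_lt_trans; apply: ge0_le_integral => //.
- exact: measurable_boltzmann.
- exact: measurableT_comp.
- move=> y _; rewrite gee0_abs lee_fin ?addr_ge0 ?expR_ge0//.
  exact: boltzmann_le.
Qed.

Lemma risk_le (sigma : probability Y R) lam f (g : Y -> R) : lam != 0%R ->
  measurable_fun setT f -> measurable_fun setT g ->
  (forall y, 0 <= g y <= f y)%R -> partition lam sigma f < +oo ->
  (risk lam sigma g <= risk lam sigma f)%R.
Proof.
move=> lam0 mf mg gf Zfin; have Zgfin := partition_le_lty mf mg gf Zfin.
have l0 : (lam < 0)%R \/ (0 < lam)%R.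
  by case: (ltgtP lam 0%R) lam0 => //; [left|right].
have Zf0 := partition_gt0 sigma lam mf; have Zg0 := partition_gt0 sigma lam mg.
have ZfE : (fine (partition lam sigma f))%:E = partition lam sigma f.
  by apply: fineK; rewrite (ge0_fin_numE (ltW Zf0)).
have ZgE : (fine (partition lam sigma g))%:E = partition lam sigma g.
  by apply: fineK; rewrite (ge0_fin_numE (ltW Zg0)).
have lnZf : fine (partition lam sigma f) \is Num.pos.
  by rewrite posrE -lte_fin ZfE; exact: Zf0.
have lnZg : fine (partition lam sigma g) \is Num.pos.
  by rewrite posrE -lte_fin ZgE; exact: Zg0.
have leZ (h h' : Y -> R) : measurable_fun setT h -> measurable_fun setT h' ->
    (forall y, - lam * h y <= - lam * h' y)%R ->
    partition lam sigma h <= partition lam sigma h'.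
  move=> mh mh' hh'; apply: ge0_le_integral => //.
  - exact: measurable_boltzmann.
  - exact: measurable_boltzmann.
  - by move=> y _; rewrite lee_fin ler_expR.
case: l0 => l0; rewrite /risk.
  rewrite ler_pM2l; last by rewrite oppr_gt0 invr_lt0.
  rewrite (ler_ln lnZg lnZf) -lee_fin ZfE ZgE; apply: leZ => // y.
  by rewrite ler_pM2l ?oppr_gt0//; case/andP: (gf y).
rewrite ler_nM2l; last by rewrite oppr_lt0 invr_gt0.
rewrite (ler_ln lnZf lnZg) -lee_fin ZfE ZgE; apply: leZ => // y.
by rewrite ler_nM2l ?oppr_lt0//; case/andP: (gf y).
Qed.

Lemma partition_pos_lty (sigma : probability Y R) lam f : (0 < lam)%R ->
  measurable_fun setT f -> (forall y, 0 <= f y)%R -> partition lam sigma f < +oo.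
Proof.
move=> l0 mf f0; apply: (@le_lt_trans _ _ 1); last by rewrite ltry.
rewrite -(integral_cst1 sigma); apply: ge0_le_integral => //.
  exact: measurable_boltzmann.
by move=> y _; rewrite lee_fin -expR0 ler_expR mulNr oppr_le0 mulr_ge0// ltW.
Qed.

(** The risk is continuous under dominated pointwise convergence, by dominated
    convergence of the partition functions; [exp (- lam * f) + 1] dominates for
    either sign of [lam]. *)
Lemma risk_cvg (sigma : probability Y R) lam f (g : nat -> Y -> R) :
  measurable_fun setT f -> (forall n, measurable_fun setT (g n)) ->
  (forall n y, 0 <= g n y <= f y)%R ->
  (forall y, g ^~ y @ \oo --> f y) ->
  partition lam sigma f < +oo ->
  (fun n => risk lam sigma (g n)) @ \oo --> risk lam sigma f.
Proof.
move=> mf mg gf gcvg Zfin.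
have Zcvg : partition lam sigma (g n) @[n --> \oo] --> partition lam sigma f.
  have [|||||_ _ //] := @dominated_convergence _ _ _ sigma setT measurableT
    (fun n y => (expR (- lam * g n y))%:E) (fun y => (expR (- lam * f y))%:E)
    (fun y => (expR (- lam * f y) + 1)%:E).
  - by move=> n; exact: measurable_boltzmann.
  - exact: measurable_boltzmann.
  - apply: aeW => y _; apply/fine_cvgP; split; first exact: nearW.
    apply: continuous_cvg; first exact: continuous_expR.
    by apply: cvgM; [exact: cvg_cst|exact: gcvg].
  - exact: integrable_boltzmannD1.
  - apply: aeW => y n _; rewrite gee0_abs lee_fin ?expR_ge0//.
    exact: boltzmann_le.
have Zgt0 := partition_gt0 sigma lam mf.
have Zfin' : partition lam sigma f \is a fin_num by rewrite ge0_fin_numE// ltW.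
apply: cvgM; first exact: cvg_cst.
apply: continuous_cvg.
  by apply: continuous_ln; rewrite -lte_fin fineK.
by apply: fine_cvg; rewrite fineK.
Qed.

End gibbs.

Section gibbs_kernel.
Context d d' (X : measurableType d) (Y : measurableType d') (R : realType).
Variables (s : R.-pker X ~> Y) (lam : R) (f : X * Y -> R).
Hypotheses (lam0 : lam != 0%R) (mf : measurable_fun setT f).

Lemma measurable_risk :
  measurable_fun setT (fun x => risk lam (s x) (fun y => f (x, y))).
Proof.
rewrite /risk; apply: measurable_funM => //.
apply: measurableT_comp => //; apply: measurableT_comp => //.
apply: (measurable_fun_integral_finite_kernel
  (fun w => (expR (- lam * f w))%:E)) => [w|]; first by rewrite lee_fin expR_ge0.
apply/measurable_EFinP; apply: measurableT_comp => //.
exact: measurable_funM.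
Qed.

Hypothesis Zfin : forall x, partition lam (s x) (fun y => f (x, y)) < +oo.

Lemma gibbs_kernel_exists : exists k : R.-pker X ~> Y,
  is_kernel_density k s
    (fun w => gibbs_density lam (s w.1) (fun y => f (w.1, y)) w.2).
Proof.
apply: density_kernel_exists.
- apply: measurableT_comp => //; apply: measurable_funM => //.
  apply: measurable_funB.
    by under eq_fun => w do rewrite -surjective_pairing.
  by apply: (measurableT_comp measurable_risk (g := fst)).
- by move=> w; exact: expR_ge0.
- move=> x; apply: (integral_gibbs_density (sigma := kernel_at s x)) => //.
    exact: measurable_fun_pair2.
  exact: Zfin.
Qed.

End gibbs_kernel.

(** * Additive functionals of a trajectory *)

Section segment_expectation.
Context dX dU (X : measurableType dX) (U : measurableType dU) (R : realType).
Variables (pi : nat -> R.-pker X ~> U) (tau : nat -> R.-pker (X * U) ~> X).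

Lemma measurable_segment_state n k :
  measurable_fun setT (fun xi : segment X U n => segment_state xi k).
Proof.
have [kn|nk] := ltnP k n; last first.
  rewrite (_ : (fun _ => _) = snd)//; apply/funext => xi.
  by rewrite /segment_state nth_default// size_map size_tuple.
rewrite (_ : (fun _ => _) = fst \o (fun s => tnth s (Ordinal kn)) \o fst)//.
  apply: measurableT_comp => //; apply: measurableT_comp => //.
  exact: measurable_tnth.
apply/funext => xi; rewrite /segment_state /=.
have z0 : X * U by exact: (tnth xi.1 (Ordinal kn)).
by rewrite (nth_map z0) ?size_tuple// (tnth_nth z0).
Qed.

Definition step t (x : X) (F : (X * U) * X -> \bar R) : \bar R :=
  \int[pi t x]_u \int[tau t (x, u)]_y F ((x, u), y).

Section step_theory.
Variables (t : nat) (x : X).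
Implicit Types F G : (X * U) * X -> \bar R.

Let measurable_inner F : (forall w, 0 <= F w) -> measurable_fun setT F ->
  measurable_fun setT (fun u => \int[tau t (x, u)]_y F ((x, u), y)).
Proof.
move=> F0 mF; apply: (measurable_fun_pair2 (f := fun z => \int[tau t z]_y F (z, y))).
exact: measurable_fun_integral_finite_kernel.
Qed.

Lemma eq_step F G : (forall w, F w = G w) -> step t x F = step t x G.
Proof. by move=> FG; do 2 apply: eq_integral => ? _. Qed.

Lemma stepD F G : (forall w, 0 <= F w) -> measurable_fun setT F ->
  (forall w, 0 <= G w) -> measurable_fun setT G ->
  step t x (fun w => F w + G w) = step t x F + step t x G.
Proof.
move=> F0 mF G0 mG; rewrite /step -ge0_integralD//; last 4 first.
- by move=> u _; exact: integral_ge0.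
- exact: measurable_inner.
- by move=> u _; exact: integral_ge0.
- exact: measurable_inner.
apply: eq_integral => u _; rewrite ge0_integralD//; exact: measurable_fun_pair2.
Qed.

Lemma le_step F G : (forall w, 0 <= F w) -> measurable_fun setT F ->
  measurable_fun setT G -> (forall w, F w <= G w) -> step t x F <= step t x G.
Proof.
move=> F0 mF mG FG; have G0 w : 0 <= G w by exact: le_trans (FG w).
apply: ge0_le_integral => //.
- by move=> u _; exact: integral_ge0.
- exact: measurable_inner.
- exact: measurable_inner.
- by move=> u _; apply: ge0_le_integral => //; exact: measurable_fun_pair2.
Qed.

End step_theory.

Lemma step_cst t x (a : \bar R) : step t x (fun=> a) = a.
Proof.
transitivity (\int[pi t x]_u (cst a u)).
  apply: eq_integral => u _.
  by rewrite (integral_cst (tau t (x, u)) measurableT a) prob_kernel mule1.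
by rewrite (integral_cst (pi t x) measurableT a) prob_kernel mule1.
Qed.

Lemma integral_segment_cons n t x (F : segment X U n.+1 -> \bar R) :
  (forall xi, 0 <= F xi) -> measurable_fun setT F ->
  \int[segment_law pi tau n.+1 t x]_xi F xi =
  step t x (fun w => \int[segment_law pi tau n t.+1 w.2]_xi F (segment_cons w.1 xi)).
Proof.
move=> F0 mF; rewrite /= integral_kcomp//; apply: eq_integral => u _.
rewrite integral_kcomp//; apply: eq_integral => y _ /=.
rewrite ge0_integral_pushforward//.
exact: measurable_segment_cons2.
Qed.

(** The first state of a segment is recorded in its first pair, or alone when the
    segment has length 0; in either case it is almost surely the initial state. *)
Lemma integral_segment_state0 n t x (F : X * segment X U n -> \bar R) :
  (forall w, 0 <= F w) -> measurable_fun setT F ->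
  \int[segment_law pi tau n t x]_xi F (segment_state xi 0, xi) =
  \int[segment_law pi tau n t x]_xi F (x, xi).
Proof.
move=> F0 mF.
have mst m : measurable_fun setT (fun xi : segment X U m => (segment_state xi 0, xi)).
  by apply: measurable_fun_pair => //; exact: measurable_segment_state.
case: n F F0 mF => [|n] F F0 mF.
  have mF0 := measurableT_comp mF (mst 0%N); have mFx := measurable_fun_pair2 x mF.
  by rewrite /= (integral_dirac _ _ mF0)// (integral_dirac _ _ mFx).
rewrite (@integral_segment_cons n t x (fun xi => F (segment_state xi 0, xi)))//.
  by rewrite integral_segment_cons//; exact: measurable_fun_pair2.
by apply: (measurableT_comp mF); exact: mst.
Qed.

(** Additive functionals of a trajectory segment starting at time [t]: every
    quantity optimised below, costs, divergences and log-likelihood ratios alike,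
    is one of them. *)
Definition additive (gT : X -> \bar R) (g : nat -> (X * U) * X -> \bar R) n t
    (xi : segment X U n) : \bar R :=
  gT xi.2 + \sum_(i < n) g (t + i)%N (tnth xi.1 i, segment_state xi i.+1).

Definition expectation gT g n t x : \bar R :=
  \int[segment_law pi tau n t x]_xi additive gT g t xi.

Section additive_theory.
Variables (gT : X -> \bar R) (g : nat -> (X * U) * X -> \bar R).
Hypotheses (gT0 : forall x, 0 <= gT x) (mgT : measurable_fun setT gT).
Hypotheses (g0 : forall s w, 0 <= g s w) (mg : forall s, measurable_fun setT (g s)).

Lemma additive_ge0 n t xi : 0 <= @additive gT g n t xi.
Proof. by rewrite adde_ge0// sume_ge0. Qed.

Lemma measurable_additive n t : measurable_fun setT (@additive gT g n t).
Proof.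
apply: emeasurable_funD; first exact: measurableT_comp.
apply: emeasurable_sum => i; apply: (measurableT_comp (mg (t + i))).
apply: measurable_fun_pair; last exact: measurable_segment_state.
exact: (measurableT_comp (measurable_tnth i) measurable_fst).
Qed.

Lemma additive_cons n t z (xi : segment X U n) :
  additive gT g t (segment_cons z xi) =
  g t (z, segment_state xi 0) + additive gT g t.+1 xi.
Proof.
rewrite /additive big_ord_recl addn0 /= tnth0 addeCA; congr (_ + (_ + _)).
by apply: eq_bigr => i _; rewrite addnS addSn tnthS.
Qed.

Lemma measurable_expectation n t : measurable_fun setT (expectation gT g n t).
Proof.
apply: measurable_fun_integral_kernel.
- by move=> A mA; exact: measurable_kernel.
- by move=> xi; exact: additive_ge0.
- exact: measurable_additive.
Qed.

Lemma expectation_ge0 n t x : 0 <= expectation gT g n t x.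
Proof. by apply: integral_ge0 => xi _; exact: additive_ge0. Qed.

Lemma expectation0 t x : expectation gT g 0 t x = gT x.
Proof.
rewrite /expectation /= integral_dirac//; last exact: measurable_additive.
by rewrite diracT mul1e /additive big_ord0 adde0.
Qed.

Lemma expectationS n t x : expectation gT g n.+1 t x =
  step t x (fun w => g t w + expectation gT g n t.+1 w.2).
Proof.
rewrite /expectation integral_segment_cons; last 2 first.
- by move=> xi; exact: additive_ge0.
- exact: measurable_additive.
apply: eq_step => -[z y] /=; under eq_integral do rewrite additive_cons.
have mgz : measurable_fun setT (fun y' => g t (z, y')) by exact: measurable_fun_pair2.
have cstE : \int[segment_law pi tau n t.+1 y]_xi g t (z, y) = g t (z, y).
  rewrite (integral_cst (segment_law pi tau n t.+1 y) measurableT (g t (z, y))).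
  by rewrite prob_kernel mule1.
rewrite (@integral_segment_state0 n t.+1 y (fun v => g t (z, v.1) + additive gT g t.+1 v.2)).
- rewrite ge0_integralD//.
  + exact: (congr1 (fun a => a + _) cstE).
  + exact: (measurable_cst (g t (z, y))).
  + by move=> xi _; exact: additive_ge0.
  + exact: measurable_additive.
- by move=> w; rewrite adde_ge0// additive_ge0.
- apply: emeasurable_funD; first exact: (measurableT_comp mgz measurable_fst).
  exact: (measurableT_comp (@measurable_additive n t.+1) measurable_snd).
Qed.

End additive_theory.

Section comparison.
Variables (gT hT : X -> \bar R) (g h : nat -> (X * U) * X -> \bar R).
Hypotheses (gT0 : forall x, 0 <= gT x) (mgT : measurable_fun setT gT).
Hypotheses (g0 : forall s w, 0 <= g s w) (mg : forall s, measurable_fun setT (g s)).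
Hypotheses (hT0 : forall x, 0 <= hT x) (mhT : measurable_fun setT hT).
Hypotheses (h0 : forall s w, 0 <= h s w) (mh : forall s, measurable_fun setT (h s)).

Lemma expectationD n t x :
  expectation (fun x => gT x + hT x) (fun s w => g s w + h s w) n t x =
  expectation gT g n t x + expectation hT h n t x.
Proof.
rewrite /expectation -ge0_integralD//.
- by apply: eq_integral => xi _; rewrite /additive big_split/= addeACA.
- by move=> xi _; exact: additive_ge0.
- exact: measurable_additive.
- by move=> xi _; exact: additive_ge0.
- exact: measurable_additive.
Qed.

Lemma expectationZ (a : R) n t x : (0 <= a)%R ->
  expectation (fun x => a%:E * gT x) (fun s w => a%:E * g s w) n t x =
  a%:E * expectation gT g n t x.
Proof.
move=> a0; rewrite /expectation -ge0_integralZl_EFin//.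
- apply: eq_integral => xi _; rewrite /additive ge0_muleDr//; last exact: sume_ge0.
  by rewrite ge0_sume_distrr.
- by move=> xi _; exact: additive_ge0.
- exact: measurable_additive.
Qed.

Lemma le_expectation n t x : (forall x, gT x <= hT x) ->
  (forall s w, g s w <= h s w) -> expectation gT g n t x <= expectation hT h n t x.
Proof.
move=> gThT gh; apply: ge0_le_integral => //.
- by move=> xi _; exact: additive_ge0.
- exact: measurable_additive.
- exact: measurable_additive.
- by move=> xi _; rewrite /additive leeD// lee_sum.
Qed.

Variables (v : nat -> X -> \bar R).
Hypotheses (v0 : forall s x, 0 <= v s x) (mv : forall s, measurable_fun setT (v s)).

Let mtail (k : nat -> (X * U) * X -> \bar R) (f : X -> \bar R) s :
  measurable_fun setT (k s) -> measurable_fun setT f ->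
  measurable_fun setT (fun w => k s w + f w.2).
Proof. by move=> mk mf; apply: emeasurable_funD => //; exact: measurableT_comp. Qed.

Variables t0 T : nat.

(** Verification: [v] bounds the difference of the two expectations as soon as it
    satisfies the one-step (Bellman) inequality.  All terms being
    nonnegative, infinite expectations are covered. *)
Lemma verification_le :
  (forall x, gT x <= v T x + hT x) ->
  (forall s x, (t0 <= s < T)%N ->
    step s x (fun w => g s w + v s.+1 w.2) <= v s x + step s x (h s)) ->
  forall n t x, (t0 <= t)%N -> (t + n)%N = T ->
    expectation gT g n t x <= v t x + expectation hT h n t x.
Proof.
move=> gv bellman; elim=> [t x t0t|n IH t x t0t tn].
  by rewrite addn0 => ->; rewrite !expectation0.
have tT : (t < T)%N by rewrite -tn addnS ltnS leq_addr.
have mE := measurable_expectation; have E0 := expectation_ge0.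
rewrite !expectationS//.
have mgv := mtail (mg t) (mv t.+1).
have mhE := mtail (mh t) (mE _ _ hT0 mhT h0 mh n t.+1).
apply: (@le_trans _ _ (step t x (fun w => (g t w + v t.+1 w.2) +
                                  expectation hT h n t.+1 w.2))).
  apply: le_step.
  - by move=> w; rewrite adde_ge0// E0.
  - by apply: mtail => //; exact: mE.
  - by apply: emeasurable_funD => //; apply: measurableT_comp => //; exact: mE.
  - move=> w; rewrite -addeA leeD2l// IH// ?(leq_trans t0t)//.
    by rewrite addSn -addnS.
have mEh : measurable_fun setT (fun w : (X * U) * X => expectation hT h n t.+1 w.2).
  by apply: measurableT_comp => //; exact: mE.
have Eh0 (w : (X * U) * X) : 0 <= expectation hT h n t.+1 w.2 by exact: E0.
have gv0 w : 0 <= g t w + v t.+1 w.2 by rewrite adde_ge0.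
have eL := stepD t x gv0 mgv Eh0 mEh.
have eR := stepD t x (h0 t) (mh t) Eh0 mEh.
rewrite eL eR; apply: (le_trans (leeD2r _ (bellman _ _ _))); first by rewrite t0t.
by rewrite -addeA.
Qed.

Lemma verification_ge :
  (forall x, v T x + hT x <= gT x) ->
  (forall s x, (t0 <= s < T)%N ->
    v s x + step s x (h s) <= step s x (fun w => g s w + v s.+1 w.2)) ->
  forall n t x, (t0 <= t)%N -> (t + n)%N = T ->
    v t x + expectation hT h n t x <= expectation gT g n t x.
Proof.
move=> gv bellman; elim=> [t x t0t|n IH t x t0t tn].
  by rewrite addn0 => ->; rewrite !expectation0.
have tT : (t < T)%N by rewrite -tn addnS ltnS leq_addr.
have mE := measurable_expectation; have E0 := expectation_ge0.
rewrite !expectationS//.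
have mgv := mtail (mg t) (mv t.+1).
have mhE := mtail (mh t) (mE _ _ hT0 mhT h0 mh n t.+1).
apply: (@le_trans _ _ (step t x (fun w => (g t w + v t.+1 w.2) +
                                  expectation hT h n t.+1 w.2))); last first.
  apply: le_step.
  - by move=> w; apply: adde_ge0; [exact: adde_ge0|exact: E0].
  - by apply: emeasurable_funD => //; apply: measurableT_comp => //; exact: mE.
  - by apply: mtail => //; exact: mE.
  - move=> w; rewrite -addeA leeD2l// IH// ?(leq_trans t0t)//.
    by rewrite addSn -addnS.
have mEh : measurable_fun setT (fun w : (X * U) * X => expectation hT h n t.+1 w.2).
  by apply: measurableT_comp => //; exact: mE.
have Eh0 (w : (X * U) * X) : 0 <= expectation hT h n t.+1 w.2 by exact: E0.
have gv0 w : 0 <= g t w + v t.+1 w.2 by rewrite adde_ge0.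
have eL := stepD t x gv0 mgv Eh0 mEh.
have eR := stepD t x (h0 t) (mh t) Eh0 mEh.
rewrite eL eR; apply: (le_trans _ (leeD2r _ (bellman _ _ _))).
  by rewrite -[leRHS]addeA.
by rewrite t0t.
Qed.

End comparison.

Lemma expectation_le_cst g (K : R) t0 T :
  (forall s w, 0 <= g s w) -> (forall s, measurable_fun setT (g s)) -> (0 <= K)%R ->
  (forall s x, (t0 <= s < T)%N -> step s x (g s) <= K%:E) ->
  forall t x, (t0 <= t <= T)%N ->
    expectation (cst 0) g (T - t) t x <= ((T - t)%:R * K)%:E.
Proof.
move=> g0 mg K0 gK t x /andP[t0t tT].
have z0 (A : Type) : forall a : A, 0 <= (cst 0 a : \bar R) by [].
have mz : measurable_fun setT (cst 0 : X -> \bar R) by exact: measurable_cst.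
have mzw (s : nat) : measurable_fun setT (cst 0 : (X * U) * X -> \bar R).
  exact: measurable_cst.
pose v s (_ : X) : \bar R := ((T - s)%:R * K)%:E.
have v0 s y : 0 <= v s y by rewrite lee_fin mulr_ge0.
have mv s : measurable_fun setT (v s) by exact: measurable_cst.
have zero : expectation (cst 0) (fun=> cst 0) (T - t) t x = 0.
  by apply: integral0_eq => xi _; rewrite /additive big1// adde0.
rewrite -[leRHS]adde0 -[X in _ <= _ + X]zero.
have bound := verification_le (z0 _) mz g0 mg (z0 _) mz (fun=> z0 _) mzw v0 mv.
apply: (bound t0 T _ _ (T - t)%N t x t0t (subnKC tT)).
  by move=> y; rewrite /v subnn mul0r adde0.
move=> s y t0sT; have /andP[_ sT] := t0sT.
rewrite (@stepD s y (g s) (fun w => v s.+1 w.2) (g0 s) (mg s)); last 2 first.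
- by move=> w; exact: v0.
- exact: measurable_cst.
rewrite (step_cst s y (v s.+1 y)) (step_cst s y 0) adde0.
apply: le_trans (leeD2r _ (gK _ _ t0sT)) _.
by rewrite /v -EFinD lee_fin -(subnSK sT) -natr1 mulrDl mul1r addrC.
Qed.

(** Only the one-step conditional expectations of an additive functional matter. *)
Lemma eq_expectation gT g h n t x :
  (forall x, 0 <= gT x) -> measurable_fun setT gT ->
  (forall s w, 0 <= g s w) -> (forall s, measurable_fun setT (g s)) ->
  (forall s w, 0 <= h s w) -> (forall s, measurable_fun setT (h s)) ->
  (forall s x, step s x (g s) = step s x (h s)) ->
  expectation gT g n t x = expectation gT h n t x.
Proof.
move=> gT0 mgT g0 mg h0 mh gh; elim: n t x => [|n IH] t x.
  by rewrite !expectation0.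
have E0 (w : (X * U) * X) : 0 <= expectation gT h n t.+1 w.2 by exact: expectation_ge0.
have mE : measurable_fun setT
    (fun w : (X * U) * X => expectation gT h n t.+1 w.2).
  by apply: measurableT_comp => //; exact: measurable_expectation.
rewrite (expectationS gT0 mgT g0 mg) (expectationS gT0 mgT h0 mh).
rewrite (stepD t x (h0 t) (mh t) E0 mE) -gh -(stepD t x (g0 t) (mg t) E0 mE).
by apply: eq_step => w; rewrite IH.
Qed.

End segment_expectation.

(** * Extremisers of the one-step problem *)

Lemma cvg_le_ereal (R : realType) (u : nat -> R) (l : R) (M : \bar R) :
  u @ \oo --> l -> (forall n, (u n)%:E <= M) -> l%:E <= M.
Proof.
move=> ul; case: M => [r| |] uM; [|by rewrite leey|by have := uM 0%N].
rewrite lee_fin -(cvg_lim _ ul)//; apply: limr_le; first by apply/cvg_ex; exists l.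
by apply: nearW => n; rewrite -lee_fin.
Qed.

Section gibbs_problem.
Context d (Y : measurableType d) (R : realType).
Variables (sigma : probability Y R) (lam : R) (f : Y -> R).
Hypotheses (lam0 : lam != 0%R) (mf : measurable_fun setT f).
Hypothesis f0 : forall y, (0 <= f y)%R.
Hypothesis Zfin : partition lam sigma f < +oo.
Local Notation gibbs := (gibbs_density lam sigma f).

(** For [lam < 0] the Gibbs law has [E[f] = F + kl / (- lam)] with a nonnegative
    risk [F], so its divergence is controlled by its moment. *)
Lemma gibbs_kl_le (mu : probability Y R) : has_density mu sigma gibbs ->
  (lam < 0)%R -> kl mu sigma <= (- lam)%:E * \int[mu]_y (f y)%:E.
Proof.
move=> hg l0; have := gibbs_attained lam0 mf f0 Zfin hg.
rewrite (wpos_lt0 l0) (wneg_lt0 l0) mul0e adde0 => ->.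
have lamK x : (- lam)%:E * ((- lam^-1)%:E * x) = x :> \bar R.
  by rewrite muleA -EFinM mulrNN divff// mul1e.
have kl0 := kl_ge0 hg.
rewrite ge0_muleDr ?lee_fin ?risk_ge0//; last first.
  by rewrite mule_ge0// lee_fin oppr_ge0 invr_le0 ltW.
rewrite lamK leeDr// mule_ge0// lee_fin ?risk_ge0//.
by rewrite oppr_ge0 ltW.
Qed.

Lemma gibbs_kl_lty (mu : probability Y R) : has_density mu sigma gibbs ->
  ((lam < 0)%R -> \int[mu]_y (f y)%:E < +oo) -> kl mu sigma < +oo.
Proof.
move=> hg intf; case: (ltgtP lam 0%R) lam0 => // l0 _.
  apply: le_lt_trans (gibbs_kl_le hg l0) _.
  by rewrite lte_mul_pinfty ?intf// lee_fin oppr_ge0 ltW.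
have := gibbs_attained lam0 mf f0 Zfin hg.
rewrite (wpos_gt0 l0) (wneg_gt0 l0) mul0e adde0 => eqF; rewrite ltey.
apply/eqP => kly; move: eqF; rewrite kly gt0_muley ?lte_fin ?invr_gt0//.
rewrite addey//; apply/eqP => intfNy.
have : 0 <= \int[mu]_y (f y)%:E by apply: integral_ge0 => y _; rewrite lee_fin.
by rewrite intfNy.
Qed.

(** The Gibbs law is the only extremiser: an extremiser reaches the bound since
    the Gibbs law does, and only the Gibbs law reaches it. *)
Lemma gibbs_argoptP (S : set (probability Y R)) (nu : probability Y R) :
  has_density nu sigma gibbs ->
  (forall mu, S mu -> mu `<< sigma /\ ((lam < 0)%R -> kl mu sigma < +oo)) ->
  (forall mu : probability Y R, has_density mu sigma gibbs -> S mu) ->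
  forall mu, is_argopt lam S (gibbs_objective sigma lam f) mu <->
    forall A, measurable A -> mu A = \int[sigma]_(y in A) (gibbs y)%:E.
Proof.
move=> hnu Sdom Sgibbs.
have hE (mu : probability Y R) : (forall A, measurable A ->
    mu A = \int[sigma]_(y in A) (gibbs y)%:E) -> has_density mu sigma gibbs.
  by move=> ?; split => //; [exact: measurable_gibbs_density|move=> y; exact: expR_ge0].
have JE (mu : probability Y R) : has_density mu sigma gibbs ->
    gibbs_objective sigma lam f mu = (risk lam sigma f)%:E.
  move=> hmu; have [ms klmu] := Sdom _ (Sgibbs _ hmu).
  by apply/(gibbs_objective_eq lam0 mf f0 Zfin ms klmu); case: hmu.
move=> mu; split => [[Smu /(_ _ (Sgibbs _ hnu))]|/hE hmu].
  have [ms klmu] := Sdom _ Smu.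
  have := gibbs_objective_bound lam0 mf f0 Zfin ms klmu.
  rewrite (JE _ hnu) => bound opt_mu.
  apply/(gibbs_objective_eq lam0 mf f0 Zfin ms klmu); apply/eqP; rewrite eq_le.
  by move: bound opt_mu; case: ifPn => _ -> ->.
split=> [|mu' Smu']; first exact: Sgibbs.
have [ms klmu] := Sdom _ Smu'; rewrite JE//.
exact: (gibbs_objective_bound lam0 mf f0 Zfin ms klmu).
Qed.

Lemma gibbs_inf (nu : probability Y R) : has_density nu sigma gibbs -> (0 < lam)%R ->
  ereal_inf [set gibbs_objective sigma lam f mu | mu in
    [set mu : probability Y R | mu `<< sigma]] = (risk lam sigma f)%:E.
Proof.
move=> hnu l0; have klfin (mu : probability Y R) : (lam < 0)%R -> kl mu sigma < +oo.
  by rewrite ltNge ltW.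
have ns := density_dominates hnu.
apply/eqP; rewrite eq_le; apply/andP; split.
  apply: ereal_inf_lbound; exists nu => //.
  by apply/(gibbs_objective_eq lam0 mf f0 Zfin ns (@klfin nu)); case: hnu.
apply: le_ereal_inf_tmp => _ [mu ms <-].
by have := gibbs_objective_bound lam0 mf f0 Zfin ms (@klfin mu); rewrite l0.
Qed.

End gibbs_problem.

Section gibbs_opt.
Context d (Y : measurableType d) (R : realType).
Variables (sigma : probability Y R) (lam : R) (f : Y -> R).
Hypotheses (lam0 : lam != 0%R) (mf : measurable_fun setT f).
Hypothesis f0 : forall y, (0 <= f y)%R.
Hypothesis Zfin : partition lam sigma f < +oo.

Let trunc n y := Num.min (f y) n%:R.

Let trunc_itv n y : (0 <= trunc n y <= f y)%R.
Proof. by rewrite le_min f0 ler0n ge_min lexx. Qed.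

Let trunc0 n y : (0 <= trunc n y)%R. Proof. by case/andP: (trunc_itv n y). Qed.

Let measurable_trunc n : measurable_fun setT (trunc n).
Proof. exact: measurable_minr. Qed.

Let trunc_fin n : partition lam sigma (trunc n) < +oo.
Proof. exact: partition_le_lty Zfin. Qed.

Let trunc_cvg y : trunc ^~ y @ \oo --> f y.
Proof.
apply: cvg_near_cst; near=> n; apply/eqP; rewrite /trunc min_l//.
near: n; exact: nbhs_infty_ger.
Unshelve. all: by end_near. Qed.

(** Among the laws of finite divergence the optimal value is still the risk,
    even when, for [lam < 0], the Gibbs law has infinite divergence: the Gibbs
    laws of the truncations of [f] have finite divergence and their values tend
    to the risk. *)
Lemma gibbs_opt : (forall n, exists mu : probability Y R,
    has_density mu sigma (gibbs_density lam sigma (trunc n))) ->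
  (exists mu : probability Y R, has_density mu sigma (gibbs_density lam sigma f)) ->
  opt lam [set gibbs_objective sigma lam f mu | mu in [set mu : probability Y R |
    mu `<< sigma /\ kl mu sigma < +oo]] = (risk lam sigma f)%:E.
Proof.
move=> trunc_law [nu hnu]; rewrite /opt; case: ifPn => [l0|]; last first.
  rewrite -leNgt le_eqVlt (negbTE lam0)/= => l0.
  apply/eqP; rewrite eq_le; apply/andP; split.
    apply: ge_ereal_sup => _ [mu [ms klmu] <-].
    have := gibbs_objective_bound lam0 mf f0 Zfin ms (fun=> klmu).
    by rewrite ltNge (ltW l0).
  apply: (cvg_le_ereal (risk_cvg mf measurable_trunc trunc_itv trunc_cvg Zfin)) => n.
  have [mu hmu] := trunc_law n; have ms := density_dominates hmu.
  have klmu : kl mu sigma < +oo.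
    apply: (gibbs_kl_lty lam0 (measurable_trunc n) (trunc0 n) (trunc_fin n) hmu) => _.
    apply: (@le_lt_trans _ _ (\int[mu]_y (cst n%:R%:E y))); last first.
      by rewrite integral_cst// [X in _ * X](@probability_setT _ _ _ mu) mule1 ltry.
    apply: ge0_le_integral => //.
    - by move=> y _; rewrite lee_fin.
    - exact/measurable_EFinP.
    - by move=> y _; rewrite lee_fin ge_min lexx orbT.
  have /(gibbs_objective_eq lam0 (measurable_trunc n) (trunc0 n) (trunc_fin n) ms
    (fun=> klmu)) <- := let: And3 _ _ h := hmu in h.
  apply: ereal_sup_ge; exists (gibbs_objective sigma lam f mu); first by exists mu.
  rewrite /gibbs_objective leeD2r//; apply: ge0_le_integral => //.
  - by move=> y _; rewrite lee_fin.
  - exact/measurable_EFinP.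
  - exact/measurable_EFinP.
  - by move=> y _; rewrite lee_fin; case/andP: (trunc_itv n y).
rewrite -(gibbs_inf lam0 mf f0 Zfin hnu l0).
apply/eqP; rewrite eq_le; apply/andP; split.
  have ns := density_dominates hnu.
  have nl : (lam < 0)%R -> kl nu sigma < +oo by rewrite ltNge ltW.
  rewrite (gibbs_inf lam0 mf f0 Zfin hnu l0).
  have /(gibbs_objective_eq lam0 mf f0 Zfin ns nl) <- := let: And3 _ _ h := hnu in h.
  apply: ereal_inf_lbound; exists nu => //; split => //.
  apply: (gibbs_kl_lty lam0 mf f0 Zfin hnu).
  by rewrite ltNge ltW.
apply: le_ereal_inf => _ [mu [ms _] <-]; by exists mu.
Qed.

End gibbs_opt.

(** * The backward recursion *)

Section bellman.
Context dX dU (X : measurableType dX) (U : measurableType dU) (R : realType).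
Variables (T : nat) (rho : nat -> R.-pker X ~> U) (iota : nat -> R.-pker (X * U) ~> X).
Variables (c : nat -> X * U -> R) (cT : X -> R) (lP lS : R).
Hypotheses (lP_gt0 : (0 < lP)%R) (lS_neq0 : (lS != 0)%R).
Hypotheses (mc : forall t, (t < T)%N -> measurable_fun setT (c t))
  (c_ge0 : forall t z, (t < T)%N -> (0 <= c t z)%R)
  (mcT : measurable_fun setT cT) (cT_ge0 : forall x, (0 <= cT x)%R).

Let lP_neq0 : lP != 0%R. Proof. by rewrite gt_eqF. Qed.

(** The cost-to-go, with [r] applied to the continuation cost of each step: the
    identity for the problem itself, a truncation [Num.min n] for the bounded
    approximations of it. *)
Fixpoint cost_to_go_rec (r : R -> R) (n t : nat) (x : X) : R :=
  if n is n'.+1 then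
    risk lP (rho t x) (fun u => risk lS (iota t (x, u))
      (fun y => r (c t (x, u) + cost_to_go_rec r n' t.+1 y)%R))
  else cT x.

Definition cost_to_go r t := cost_to_go_rec r (T - t) t.

Definition continuation r t (w : (X * U) * X) : R :=
  r (c t w.1 + cost_to_go r t.+1 w.2)%R.

Definition action_value r t (z : X * U) : R :=
  risk lS (iota t z) (fun y => continuation r t (z, y)).

Lemma cost_to_goT r : cost_to_go r T = cT.
Proof. by rewrite /cost_to_go subnn. Qed.

Lemma cost_to_goE r t x : (t < T)%N ->
  cost_to_go r t x = risk lP (rho t x) (fun u => action_value r t (x, u)).
Proof. by move=> tT; rewrite /cost_to_go -subnSK. Qed.

Lemma horizon_ind (t0 : nat) (P : nat -> Prop) : P T ->
  (forall t, (t0 <= t < T)%N -> P t.+1 -> P t) ->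
  forall t, (t0 <= t <= T)%N -> P t.
Proof.
move=> PT PS t /andP[t0t tT]; rewrite -(subKn tT); move: (leq_subr t T).
have : (t0 <= T - (T - t))%N by rewrite subKn.
elim: (T - t)%N => [|n IH] t0n nT; first by rewrite subn0.
have nE : (T - n.+1).+1 = (T - n)%N by rewrite subnSK.
apply: PS; first by rewrite t0n nE leq_subr.
by rewrite nE; apply: IH; rewrite ?(ltnW nT)// -nE ltnW.
Qed.

Section contraction.
Variable r : R -> R.
Hypotheses (mr : measurable_fun setT r) (r_itv : forall a, (0 <= a -> 0 <= r a <= a)%R).

Lemma cost_to_go_past t : (T <= t)%N -> cost_to_go r t = cT.
Proof. by move=> Tt; rewrite /cost_to_go (eqP Tt). Qed.

Let wellbehaved t := measurable_fun setT (cost_to_go r t) /\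
  forall x, (0 <= cost_to_go r t x)%R.

Let measurable_continuation_rec t : (t < T)%N -> wellbehaved t.+1 ->
  measurable_fun setT (continuation r t).
Proof.
move=> tT [mw _]; apply: measurableT_comp => //; apply: measurable_funD.
  by apply: measurableT_comp => //; exact: mc.
exact: measurableT_comp.
Qed.

Let continuation_ge0_rec t w : (t < T)%N -> wellbehaved t.+1 ->
  (0 <= continuation r t w)%R.
Proof.
move=> tT [_ w0].
by have /andP[] := @r_itv (c t w.1 + cost_to_go r t.+1 w.2)%R (addr_ge0 (c_ge0 _ tT) (w0 _)).
Qed.

Let action_value_rec t : (t < T)%N -> wellbehaved t.+1 ->
  measurable_fun setT (action_value r t) /\ forall z, (0 <= action_value r t z)%R.
Proof.
move=> tT wt; have mcont := measurable_continuation_rec tT wt.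
split; first exact: measurable_risk.
move=> z; apply: (risk_ge0 (kernel_at (iota t) z)).
  exact: measurable_fun_pair2.
by move=> y; exact: continuation_ge0_rec.
Qed.

Let cost_to_go_wellbehaved t : wellbehaved t.
Proof.
have [Tt|/ltnW tT] := leqP T t; first by rewrite /wellbehaved cost_to_go_past.
apply: (@horizon_ind 0 wellbehaved) => //; first by rewrite /wellbehaved cost_to_goT.
move=> {tT}t /= tT wt; have [mq q0] := action_value_rec tT wt.
have wE : cost_to_go r t = fun x => risk lP (rho t x) (fun u => action_value r t (x, u)).
  by apply/funext => x; exact: cost_to_goE.
rewrite /wellbehaved wE; split; first exact: (measurable_risk _ _ mq).
move=> x; apply: (risk_ge0 (kernel_at (rho t) x)) => //.
exact: measurable_fun_pair2.
Qed.

Lemma measurable_cost_to_go t : measurable_fun setT (cost_to_go r t).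
Proof. by case: (cost_to_go_wellbehaved t). Qed.

Lemma cost_to_go_ge0 t x : (0 <= cost_to_go r t x)%R.
Proof. by case: (cost_to_go_wellbehaved t). Qed.

Lemma measurable_continuation t : (t < T)%N -> measurable_fun setT (continuation r t).
Proof. by move=> tT; exact: measurable_continuation_rec. Qed.

Lemma continuation_itv t w : (t < T)%N ->
  (0 <= continuation r t w <= c t w.1 + cost_to_go r t.+1 w.2)%R.
Proof.
by move=> tT; apply: r_itv; rewrite addr_ge0 ?c_ge0 ?cost_to_go_ge0.
Qed.

Lemma continuation_ge0 t w : (t < T)%N -> (0 <= continuation r t w)%R.
Proof. by move=> tT; case/andP: (continuation_itv w tT). Qed.

Lemma measurable_action_value t : (t < T)%N -> measurable_fun setT (action_value r t).
Proof. by move=> tT; case: (action_value_rec tT (cost_to_go_wellbehaved t.+1)). Qed.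

Lemma action_value_ge0 t z : (t < T)%N -> (0 <= action_value r t z)%R.
Proof. by move=> tT; case: (action_value_rec tT (cost_to_go_wellbehaved t.+1)). Qed.

Definition finite_from t0 := forall t z, (t0 <= t < T)%N ->
  partition lS (iota t z) (fun y => continuation r t (z, y)) < +oo.

Definition is_gibbs_policy (pi : nat -> R.-pker X ~> U) t := is_kernel_density (pi t) (rho t)
  (fun w => gibbs_density lP (rho t w.1) (fun u => action_value r t (w.1, u)) w.2).

Definition is_gibbs_transition (tau : nat -> R.-pker (X * U) ~> X) t :=
  is_kernel_density (tau t) (iota t)
    (fun w => gibbs_density lS (iota t w.1) (fun y => continuation r t (w.1, y)) w.2).

Lemma gibbs_policies_exist : exists pi : nat -> R.-pker X ~> U,
  forall t, (t < T)%N -> is_gibbs_policy pi t.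
Proof.
have /choice[pi piE] : forall t, exists k : R.-pker X ~> U, (t < T)%N ->
    is_gibbs_policy (fun=> k) t.
  move=> t; have [tT|_] := ltnP t T; last by exists (rho t).
  have [k kE] := gibbs_kernel_exists lP_neq0 (measurable_action_value tT)
    (fun x => partition_pos_lty (kernel_at (rho t) x) lP_gt0
      (measurable_fun_pair2 x (measurable_action_value tT))
      (fun u => action_value_ge0 (x, u) tT)).
  by exists k.
by exists pi.
Qed.

Lemma gibbs_transitions_exist t0 : finite_from t0 ->
  exists tau : nat -> R.-pker (X * U) ~> X, transitions T iota tau /\
    forall t, (t0 <= t < T)%N -> is_gibbs_transition tau t.
Proof.
move=> fin.
have /choice[tau tauE] : forall t, exists k : R.-pker (X * U) ~> X,
    kernel_dominated k (iota t) /\ ((t0 <= t < T)%N -> is_gibbs_transition (fun=> k) t).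
  move=> t; have [tT|_] := boolP (t0 <= t < T)%N; last first.
    by exists (iota t); split => //; exact: kernel_dominated_refl.
  have /andP[_ tT'] := tT.
  have [k kE] := gibbs_kernel_exists lS_neq0 (measurable_continuation tT')
    (fun z => fin t z tT).
  by exists k; split => //; exact: density_kernel_dominated kE.
exists tau; split => t; last by have [_] := tauE t.
by have [] := tauE t.
Qed.

End contraction.
End bellman.

(** * Truncated costs *)

Section truncation.
Context dX dU (X : measurableType dX) (U : measurableType dU) (R : realType).
Variables (T : nat) (rho : nat -> R.-pker X ~> U) (iota : nat -> R.-pker (X * U) ~> X).
Variables (c : nat -> X * U -> R) (cT : X -> R) (lP lS : R).
Hypotheses (lP_gt0 : (0 < lP)%R) (lS_neq0 : (lS != 0)%R).
Hypotheses (mc : forall t, (t < T)%N -> measurable_fun setT (c t))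
  (c_ge0 : forall t z, (t < T)%N -> (0 <= c t z)%R)
  (mcT : measurable_fun setT cT) (cT_ge0 : forall x, (0 <= cT x)%R).

Local Notation continuation := (continuation T rho iota c cT lP lS).
Local Notation action_value := (action_value T rho iota c cT lP lS).
Local Notation cost_to_go := (cost_to_go T rho iota c cT lP lS).
Local Notation finite_from := (finite_from T rho iota c cT lP lS).

Definition truncate n (a : R) : R := Num.min a n%:R.

Lemma truncate_itv n a : (0 <= a -> 0 <= truncate n a <= a)%R.
Proof. by move=> a0; rewrite le_min a0 ler0n ge_min lexx. Qed.

Lemma measurable_truncate n : measurable_fun setT (truncate n).
Proof. exact: measurable_minr. Qed.

Lemma id_itv (a : R) : (0 <= a -> 0 <= idfun a <= a)%R.
Proof. by move=> a0; rewrite a0 lexx. Qed.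

Lemma measurable_idfun : measurable_fun setT (idfun : R -> R).
Proof. exact: measurable_id. Qed.

Let lP_neq0 : lP != 0%R. Proof. by rewrite gt_eqF. Qed.

Variable t0 : nat.
Hypothesis fin : finite_from idfun t0.

(** Truncation lowers the cost, hence the risk, and each risk passes to the limit
    by dominated convergence; both facts propagate backwards in time. *)
Let dominated t := (forall n x, cost_to_go (truncate n) t x <= cost_to_go idfun t x)%R /\
  forall x, cost_to_go (truncate n) t x @[n --> \oo] --> cost_to_go idfun t x.

Let mcont r := @measurable_continuation _ _ X U R T rho iota c cT lP lS
  mc c_ge0 mcT cT_ge0 r.
Let cont0 r := @continuation_ge0 _ _ X U R T rho iota c cT lP lS
  mc c_ge0 mcT cT_ge0 r.

Let continuation_dominated t : (t < T)%N -> dominated t.+1 ->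
  (forall n w, 0 <= continuation (truncate n) t w <= continuation idfun t w)%R /\
  forall w, continuation (truncate n) t w @[n --> \oo] --> continuation idfun t w.
Proof.
move=> tT [wle wcvg]; split=> [n w|w].
  rewrite (cont0 (measurable_truncate n) (truncate_itv n))//=.
  by rewrite /continuation /truncate ge_min lerD2l wle.
have untruncated : (c t w.1 + cost_to_go (truncate n) t.+1 w.2)%R @[n --> \oo] -->
    continuation idfun t w by apply: cvgD; [exact: cvg_cst|exact: wcvg].
apply: cvg_trans untruncated; apply: near_eq_cvg; near=> n.
rewrite /continuation /truncate; apply/esym/min_l.
apply: (@le_trans _ _ (c t w.1 + cost_to_go idfun t.+1 w.2)%R).
  by rewrite lerD2l wle.
near: n; exact: nbhs_infty_ger.
Unshelve. all: by end_near. Qed.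

Let action_value_dominated t : (t0 <= t < T)%N -> dominated t.+1 ->
  (forall n z, 0 <= action_value (truncate n) t z <= action_value idfun t z)%R /\
  forall z, action_value (truncate n) t z @[n --> \oo] --> action_value idfun t z.
Proof.
move=> t0T dom; have /andP[_ tT] := t0T.
have [cle ccvg] := continuation_dominated tT dom.
have mn n z := measurable_fun_pair2 z (mcont (measurable_truncate n) (truncate_itv n) tT).
have mi z := measurable_fun_pair2 z (mcont measurable_idfun id_itv tT).
split=> [n z|z].
  apply/andP; split.
    apply: (risk_ge0 (kernel_at (iota t) z)) => // y.
    by case/andP: (cle n (z, y)).
  exact: (@risk_le _ _ _ (kernel_at (iota t) z) lS _ _ lS_neq0 (mi z) (mn n z)
    (fun y => cle n (z, y)) (fin z t0T)).
exact: (@risk_cvg _ _ _ (kernel_at (iota t) z) lS _ _ (mi z) (fun n => mn n z)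
  (fun n y => cle n (z, y)) (fun y => ccvg (z, y)) (fin z t0T)).
Qed.

Lemma cost_to_go_truncate t : (t0 <= t <= T)%N -> dominated t.
Proof.
move: t; apply: horizon_ind => [|t t0T dom].
  by split=> [n x|x]; rewrite ?cost_to_goT//; under eq_fun do rewrite cost_to_goT; exact: cvg_cst.
have /andP[_ tT] := t0T; have [qle qcvg] := action_value_dominated t0T dom.
have mq r mr ritv x := measurable_fun_pair2 x (@measurable_action_value _ _ X U R T rho iota
  c cT lP lS mc c_ge0 mcT cT_ge0 r mr ritv t tT).
have mn n := mq _ (measurable_truncate n) (truncate_itv n).
have mi := mq _ measurable_idfun id_itv.
have q0 x u : (0 <= action_value idfun t (x, u))%R.
  by case/andP: (qle 0%N (x, u)) => /le_trans; apply.
have Zfin x := partition_pos_lty (kernel_at (rho t) x) lP_gt0 (mi x) (q0 x).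
have wE r x : cost_to_go r t x = risk lP (rho t x) (fun u => action_value r t (x, u)).
  exact: cost_to_goE.
split=> [n x|x].
  rewrite (wE (truncate n)) (wE idfun).
  exact: (@risk_le _ _ _ (kernel_at (rho t) x) lP _ _ lP_neq0 (mi x) (mn n x)
    (fun u => qle n (x, u)) (Zfin x)).
under eq_fun do rewrite wE; rewrite wE.
exact: (@risk_cvg _ _ _ (kernel_at (rho t) x) lP _ _ (mi x) (fun n => mn n x)
  (fun n u => qle n (x, u)) (fun u => qcvg (x, u)) (Zfin x)).
Qed.

Lemma finite_from_truncate n : finite_from (truncate n) t0.
Proof.
move=> t z t0T; have /andP[t0t tT] := t0T.
have mr r mr ritv := measurable_fun_pair2 z (mcont (r := r) mr ritv tT).
have [cle _] := continuation_dominated tT (cost_to_go_truncate (introT andP (conj (leqW t0t) tT))).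
exact: (@partition_le_lty _ _ _ (kernel_at (iota t) z) lS _ _
  (mr _ measurable_idfun id_itv) (mr _ (measurable_truncate n) (truncate_itv n))
  (fun y => cle n (z, y)) (fin z t0T)).
Qed.

End truncation.

(** * The running terms of the objective *)

Section one_step.
Context dX dU (X : measurableType dX) (U : measurableType dU) (R : realType).
Variables (T : nat) (rho : nat -> R.-pker X ~> U) (iota : nat -> R.-pker (X * U) ~> X).
Variables (c : nat -> X * U -> R) (cT : X -> R) (lP lS : R).
Hypotheses (lP_gt0 : (0 < lP)%R) (lS_neq0 : (lS != 0)%R).
Hypotheses (mc : forall t, (t < T)%N -> measurable_fun setT (c t))
  (c_ge0 : forall t z, (t < T)%N -> (0 <= c t z)%R)
  (mcT : measurable_fun setT cT) (cT_ge0 : forall x, (0 <= cT x)%R).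
Variables (pi : nat -> R.-pker X ~> U) (tau : nat -> R.-pker (X * U) ~> X).
Hypotheses (pi_dom : policies T rho pi) (tau_dom : transitions T iota tau).

Local Notation policy_kl := (policy_kl rho pi).
Local Notation transition_kl := (transition_kl iota tau).

(** The objective is the expectation of [running_plus] and of the terminal cost,
    minus that of [running_minus].  Both are set to 0 from the horizon on, so that
    they are nonnegative and measurable at every time. *)
Definition running_plus t (w : (X * U) * X) : \bar R :=
  if (t < T)%N then (c t w.1)%:E + (lP^-1)%:E * policy_kl t w.1.1
                    + (wpos lS)%:E * transition_kl t w.1 else 0.

Definition running_kl t (w : (X * U) * X) : \bar R :=
  if (t < T)%N then transition_kl t w.1 else 0.

Definition running_minus t (w : (X * U) * X) : \bar R :=
  (wneg lS)%:E * running_kl t w.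

Lemma policy_kl_ge0 t x : (t < T)%N -> 0 <= policy_kl t x.
Proof. by move=> tT; apply: kernel_kl_ge0; exact: pi_dom. Qed.

Lemma transition_kl_ge0 t z : (t < T)%N -> 0 <= transition_kl t z.
Proof. by move=> tT; apply: kernel_kl_ge0; exact: tau_dom. Qed.

Lemma measurable_policy_kl t : (t < T)%N -> measurable_fun setT (policy_kl t).
Proof. by move=> tT; apply: measurable_kernel_kl; exact: pi_dom. Qed.

Lemma measurable_transition_kl t : (t < T)%N -> measurable_fun setT (transition_kl t).
Proof. by move=> tT; apply: measurable_kernel_kl; exact: tau_dom. Qed.

Let lPV_ge0 : (0 <= lP^-1)%R. Proof. by rewrite invr_ge0 ltW. Qed.

Lemma running_plus_ge0 t w : 0 <= running_plus t w.
Proof.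
rewrite /running_plus; case: ifPn => // tT; rewrite !adde_ge0//.
- by rewrite lee_fin c_ge0.
- by rewrite mule_ge0 ?lee_fin// policy_kl_ge0.
- by rewrite mule_ge0 ?lee_fin ?wpos_ge0// transition_kl_ge0.
Qed.

Lemma running_kl_ge0 t w : 0 <= running_kl t w.
Proof. by rewrite /running_kl; case: ifPn => // tT; rewrite transition_kl_ge0. Qed.

Lemma running_minus_ge0 t w : 0 <= running_minus t w.
Proof. by rewrite mule_ge0 ?lee_fin ?wneg_ge0// running_kl_ge0. Qed.

Lemma measurable_running_plus t : measurable_fun setT (running_plus t).
Proof.
have [tT|tT] := boolP (t < T)%N; last first.
  by rewrite (_ : running_plus t = cst 0)//; apply/funext => w; rewrite /running_plus ifN.
rewrite (_ : running_plus t = fun w => (c t w.1)%:E + (lP^-1)%:E * policy_kl t w.1.1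
    + (wpos lS)%:E * transition_kl t w.1); last first.
  by apply/funext => w; rewrite /running_plus tT.
apply: emeasurable_funD.
  apply: emeasurable_funD.
    apply/measurable_EFinP; apply: (measurableT_comp (mc tT)) => //.
  apply: measurable_funeM; apply: (measurableT_comp (measurable_policy_kl tT)).
  exact: measurableT_comp.
by apply: measurable_funeM; exact: (measurableT_comp (measurable_transition_kl tT)).
Qed.

Lemma measurable_running_kl t : measurable_fun setT (running_kl t).
Proof.
have [tT|tT] := boolP (t < T)%N; last first.
  by rewrite (_ : running_kl t = cst 0)//; apply/funext => w; rewrite /running_kl ifN.
rewrite (_ : running_kl t = fun w => transition_kl t w.1).
  exact: (measurableT_comp (measurable_transition_kl tT)).
by apply/funext => w; rewrite /running_kl tT.
Qed.

Lemma measurable_running_minus t : measurable_fun setT (running_minus t).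
Proof. by apply: measurable_funeM; exact: measurable_running_kl. Qed.

Section given_step.
Variables (t : nat) (x : X).
Hypothesis tT : (t < T)%N.

Let integral_cst_ker z (a : \bar R) : \int[tau t z]_y a = a.
Proof. by rewrite (integral_cst (tau t z) measurableT a) prob_kernel mule1. Qed.

Lemma step_running_minus : step pi tau t x (running_minus t) =
  \int[pi t x]_u ((wneg lS)%:E * transition_kl t (x, u)).
Proof.
apply: eq_integral => u _; rewrite /running_minus /running_kl tT /=.
exact: integral_cst_ker.
Qed.

Definition transition_cost (v : X -> R) u : \bar R :=
  \int[tau t (x, u)]_y (c t (x, u) + v y)%:E + (wpos lS)%:E * transition_kl t (x, u).

Let inner_ge0 (v : X -> R) u : (forall y, 0 <= v y)%R -> 0 <= transition_cost v u.
Proof.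
move=> v0; rewrite adde_ge0//.
  by apply: integral_ge0 => y _; rewrite lee_fin addr_ge0// c_ge0.
by rewrite mule_ge0 ?lee_fin ?wpos_ge0// transition_kl_ge0.
Qed.

Let mcv (v : X -> R) : measurable_fun setT v ->
  measurable_fun setT (fun w : (X * U) * X => (c t w.1 + v w.2)%:E).
Proof.
move=> mv; apply/measurable_EFinP; apply: measurable_funD.
  exact: (measurableT_comp (mc tT)).
exact: measurableT_comp.
Qed.

Let measurable_inner (v : X -> R) : (forall y, 0 <= v y)%R -> measurable_fun setT v ->
  measurable_fun setT (transition_cost v).
Proof.
move=> v0 mv; apply: emeasurable_funD.
  apply: (measurable_fun_pair2 (f := fun z => \int[tau t z]_y (c t z + v y)%:E)).
  apply: (measurable_fun_integral_finite_kernel (fun w => (c t w.1 + v w.2)%:E)).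
    by move=> w; rewrite lee_fin addr_ge0// c_ge0.
  exact: mcv.
apply: measurable_funeM; apply: measurable_fun_pair2.
exact: measurable_transition_kl.
Qed.

(** The divergence of the policy depends on the state alone, so it leaves the
    expectation over the action. *)
Lemma step_running_plus (v : X -> R) :
  (forall y, 0 <= v y)%R -> measurable_fun setT v ->
  step pi tau t x (fun w => running_plus t w + (v w.2)%:E) =
  \int[pi t x]_u transition_cost v u + (lP^-1)%:E * policy_kl t x.
Proof.
move=> v0 mv; have kp0 := policy_kl_ge0 x tT.
have lkp0 : 0 <= (lP^-1)%:E * policy_kl t x by rewrite mule_ge0.
transitivity (\int[pi t x]_u (transition_cost v u + (lP^-1)%:E * policy_kl t x)).
  apply: eq_integral => u _; rewrite /transition_cost -addeA.
  have kt0 : 0 <= (wpos lS)%:E * transition_kl t (x, u).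
    by rewrite mule_ge0 ?lee_fin ?wpos_ge0// transition_kl_ge0.
  have -> : (wpos lS)%:E * transition_kl t (x, u) + (lP^-1)%:E * policy_kl t x =
      \int[tau t (x, u)]_y ((lP^-1)%:E * policy_kl t x + (wpos lS)%:E * transition_kl t (x, u)).
    by rewrite integral_cst_ker addeC.
  rewrite -ge0_integralD//.
  - apply: eq_integral => y _; rewrite /running_plus tT /= EFinD -!addeA.
    by congr (_ + _); rewrite addeA addeC.
  - by move=> y _; rewrite lee_fin addr_ge0// c_ge0.
  - exact: (measurable_fun_pair2 (x, u) (mcv mv)).
  - by move=> y _; rewrite adde_ge0.
rewrite ge0_integralD//.
- by rewrite (integral_cst (pi t x) measurableT) prob_kernel mule1.
- by move=> u _; exact: inner_ge0.
- exact: measurable_inner.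
Qed.

End given_step.

End one_step.

(** * Verification by dynamic programming *)

Section verification.
Context dX dU (X : measurableType dX) (U : measurableType dU) (R : realType).
Variables (T : nat) (rho : nat -> R.-pker X ~> U) (iota : nat -> R.-pker (X * U) ~> X).
Variables (c : nat -> X * U -> R) (cT : X -> R) (lP lS : R).
Hypotheses (lP_gt0 : (0 < lP)%R) (lS_neq0 : (lS != 0)%R).
Hypotheses (mc : forall t, (t < T)%N -> measurable_fun setT (c t))
  (c_ge0 : forall t z, (t < T)%N -> (0 <= c t z)%R)
  (mcT : measurable_fun setT cT) (cT_ge0 : forall x, (0 <= cT x)%R).
Variables (pi : nat -> R.-pker X ~> U) (tau : nat -> R.-pker (X * U) ~> X).
Hypotheses (pi_dom : policies T rho pi) (tau_dom : transitions T iota tau).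

Local Notation continuation := (continuation T rho iota c cT lP lS).
Local Notation action_value := (action_value T rho iota c cT lP lS).
Local Notation cost_to_go := (cost_to_go T rho iota c cT lP lS).
Local Notation is_gibbs_policy := (is_gibbs_policy T rho iota c cT lP lS).
Local Notation is_gibbs_transition := (is_gibbs_transition T rho iota c cT lP lS).
Local Notation policy_kl := (policy_kl rho pi).
Local Notation transition_kl := (transition_kl iota tau).
Local Notation running_plus := (running_plus T rho iota c lP lS pi tau).
Local Notation running_minus := (running_minus T iota lS tau).

Let lP_neq0 : lP != 0%R. Proof. by rewrite gt_eqF. Qed.

Section one_step_inequality.
Variable r : R -> R.
Hypotheses (mr : measurable_fun setT r) (r_itv : forall a, (0 <= a -> 0 <= r a <= a)%R).

Let w0 := @cost_to_go_ge0 _ _ X U R T rho iota c cT lP lS mc c_ge0 mcT cT_ge0 r mr r_itv.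
Let mw := @measurable_cost_to_go _ _ X U R T rho iota c cT lP lS mc c_ge0 mcT cT_ge0 r mr r_itv.
Let q0 := @action_value_ge0 _ _ X U R T rho iota c cT lP lS mc c_ge0 mcT cT_ge0 r mr r_itv.
Let mq := @measurable_action_value _ _ X U R T rho iota c cT lP lS mc c_ge0 mcT cT_ge0 r mr r_itv.
Let cont0 := @continuation_ge0 _ _ X U R T rho iota c cT lP lS mc c_ge0 mcT cT_ge0 r mr r_itv.
Let mcont := @measurable_continuation _ _ X U R T rho iota c cT lP lS mc c_ge0 mcT cT_ge0 r mr r_itv.
Let cont_itv := @continuation_itv _ _ X U R T rho iota c cT lP lS mc c_ge0 mcT cT_ge0 r mr r_itv.

(** The two sides of the one-step variational inequality for the transition
    kernel: what [tau] pays, and the risk, with the divergence on the side where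
    its weight is positive. *)
Definition kernel_payoff t z : \bar R :=
  \int[tau t z]_y (continuation r t (z, y))%:E + (wpos lS)%:E * transition_kl t z.

Definition risk_payoff t z : \bar R :=
  (action_value r t z)%:E + (wneg lS)%:E * transition_kl t z.

Lemma kernel_payoff_gibbs t z : (t < T)%N ->
  partition lS (iota t z) (fun y => continuation r t (z, y)) < +oo ->
  is_gibbs_transition r tau t -> kernel_payoff t z = risk_payoff t z.
Proof.
move=> tT fin gib; exact: (@gibbs_attained _ _ _ (kernel_at (iota t) z) lS
  (fun y => continuation r t (z, y)) lS_neq0 (measurable_fun_pair2 z (mcont tT))
  (fun y => cont0 (z, y) tT) fin (kernel_at (tau t) z) (has_density_at z gib)).
Qed.

Lemma kernel_payoff_ge t z : (t < T)%N -> (0 < lS)%R ->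
  partition lS (iota t z) (fun y => continuation r t (z, y)) < +oo ->
  risk_payoff t z <= kernel_payoff t z.
Proof.
move=> tT l0 fin; have [dom _] := tau_dom tT.
exact: (@gibbs_lower _ _ _ (kernel_at (iota t) z) lS
  (fun y => continuation r t (z, y)) lS_neq0 (measurable_fun_pair2 z (mcont tT))
  (fun y => cont0 (z, y) tT) fin (kernel_at (tau t) z) (dom z)).
Qed.

Lemma kernel_payoff_le t z : (t < T)%N -> (lS < 0)%R ->
  partition lS (iota t z) (fun y => continuation r t (z, y)) < +oo ->
  kernel_payoff t z <= risk_payoff t z.
Proof.
move=> tT l0 fin; have [dom _] := tau_dom tT.
exact: (@gibbs_upper _ _ _ (kernel_at (iota t) z) lS
  (fun y => continuation r t (z, y)) lS_neq0 (measurable_fun_pair2 z (mcont tT))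
  (fun y => cont0 (z, y) tT) fin (kernel_at (tau t) z) (dom z)).
Qed.

Let risk_payoff_split t x : (t < T)%N ->
  \int[pi t x]_u risk_payoff t (x, u) = \int[pi t x]_u (action_value r t (x, u))%:E
    + step pi tau t x (running_minus t).
Proof.
move=> tT; rewrite (step_running_minus iota lS pi tau x tT) ge0_integralD//.
- by move=> u _; rewrite lee_fin; exact: q0.
- by apply/measurable_EFinP; exact: (measurable_fun_pair2 x (mq tT)).
- by move=> u _; rewrite mule_ge0 ?lee_fin ?wneg_ge0// (transition_kl_ge0 tau_dom).
- apply: measurable_funeM; apply: (measurable_fun_pair2 x).
  exact: (measurable_transition_kl tau_dom).
Qed.

Let policy_split t x : (t < T)%N ->
  (cost_to_go r t x)%:E <=
  \int[pi t x]_u (action_value r t (x, u))%:E + (lP^-1)%:E * policy_kl t x.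
Proof.
move=> tT; have [dom _] := pi_dom tT; rewrite cost_to_goE//.
have := @gibbs_lower _ _ _ (kernel_at (rho t) x) lP
  (fun u => action_value r t (x, u)) lP_neq0 (measurable_fun_pair2 x (mq tT))
  (fun u => q0 (x, u) tT) (partition_pos_lty (kernel_at (rho t) x) lP_gt0
    (measurable_fun_pair2 x (mq tT)) (fun u => q0 (x, u) tT))
  (kernel_at (pi t) x) (dom x) lP_gt0.
by rewrite (wpos_gt0 lP_gt0) (wneg_gt0 lP_gt0) mul0e adde0.
Qed.

Let risk_payoff_ge0 t z : (t < T)%N -> 0 <= risk_payoff t z.
Proof.
move=> tT; rewrite adde_ge0 ?lee_fin ?q0//.
by rewrite mule_ge0 ?lee_fin ?wneg_ge0// (transition_kl_ge0 tau_dom).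
Qed.

Let measurable_risk_payoff t : (t < T)%N -> measurable_fun setT (risk_payoff t).
Proof.
move=> tT; apply: emeasurable_funD; first by apply/measurable_EFinP; exact: mq.
by apply: measurable_funeM; exact: (measurable_transition_kl tau_dom).
Qed.

Let measurable_cost t (f : (X * U) * X -> R) : (t < T)%N -> measurable_fun setT f ->
  (forall w, 0 <= f w)%R -> measurable_fun setT
  (fun z => \int[tau t z]_y (f (z, y))%:E + (wpos lS)%:E * transition_kl t z).
Proof.
move=> tT mf f0; apply: emeasurable_funD.
  apply: (measurable_fun_integral_finite_kernel (EFin \o f)).
    by move=> w; rewrite lee_fin.
  exact/measurable_EFinP.
by apply: measurable_funeM; exact: (measurable_transition_kl tau_dom).
Qed.

Let measurable_total t : (t < T)%N ->
  measurable_fun setT (fun w : (X * U) * X => (c t w.1 + cost_to_go r t.+1 w.2)%R).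
Proof.
move=> tT; apply: measurable_funD; first exact: (measurableT_comp (mc tT)).
exact: (measurableT_comp (mw t.+1)).
Qed.

Let total_ge0 t (w : (X * U) * X) : (t < T)%N ->
  (0 <= c t w.1 + cost_to_go r t.+1 w.2)%R.
Proof. by move=> tT; rewrite addr_ge0 ?c_ge0. Qed.

(** One step back: the risk bounds the expectation over the next state for the
    transition, then over the action for the policy.  With [r] a truncation the
    running cost exceeds the truncated one, which goes in the right direction. *)
Lemma bellman_ge t x : (t < T)%N ->
  (forall z, risk_payoff t z <= kernel_payoff t z) ->
  (cost_to_go r t x)%:E + step pi tau t x (running_minus t) <=
  step pi tau t x (fun w => running_plus t w + (cost_to_go r t.+1 w.2)%:E).
Proof.
move=> tT payoff.
rewrite (step_running_plus lS lP_gt0 mc c_ge0 pi_dom tau_dom x tT (w0 t.+1) (mw t.+1)).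
apply: (le_trans (leeD2r _ (policy_split x tT))).
rewrite addeAC -risk_payoff_split//; apply: leeD2r.
apply: ge0_le_integral => //.
- by move=> u _; exact: risk_payoff_ge0.
- exact: (measurable_fun_pair2 x (measurable_risk_payoff tT)).
- exact: (measurable_fun_pair2 x (measurable_cost tT (measurable_total tT)
    (fun w => total_ge0 w tT))).
move=> u _; apply: (le_trans (payoff _)); apply: leeD2r.
apply: ge0_le_integral => //.
- by move=> y _; rewrite lee_fin; exact: cont0.
- by apply/measurable_EFinP; exact: (measurable_fun_pair2 (x, u) (mcont tT)).
- by apply/measurable_EFinP; exact: (measurable_fun_pair2 (x, u) (measurable_total tT)).
- by move=> y _; rewrite lee_fin; case/andP: (cont_itv ((x, u), y) tT).
Qed.

(** For the reverse inequality the policy has to be the Gibbs one, and the cost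
    must not be truncated. *)
Lemma bellman_le t x : (t < T)%N -> (forall a, r a = a) -> is_gibbs_policy r pi t ->
  (forall z, kernel_payoff t z <= risk_payoff t z) ->
  step pi tau t x (fun w => running_plus t w + (cost_to_go r t.+1 w.2)%:E) <=
  (cost_to_go r t x)%:E + step pi tau t x (running_minus t).
Proof.
move=> tT rid gib payoff.
rewrite (step_running_plus lS lP_gt0 mc c_ge0 pi_dom tau_dom x tT (w0 t.+1) (mw t.+1)).
have := @gibbs_attained _ _ _ (kernel_at (rho t) x) lP
  (fun u => action_value r t (x, u)) lP_neq0 (measurable_fun_pair2 x (mq tT))
  (fun u => q0 (x, u) tT) (partition_pos_lty (kernel_at (rho t) x) lP_gt0
    (measurable_fun_pair2 x (mq tT)) (fun u => q0 (x, u) tT))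
  (kernel_at (pi t) x) (has_density_at x gib).
rewrite (wpos_gt0 lP_gt0) (wneg_gt0 lP_gt0) mul0e adde0 => gibbsE.
have wE : \int[pi t x]_u (action_value r t (x, u))%:E + (lP^-1)%:E * policy_kl t x =
    (cost_to_go r t x)%:E by rewrite cost_to_goE.
rewrite -wE [leRHS]addeAC -risk_payoff_split//; apply: leeD2r.
apply: ge0_le_integral => //.
- move=> u _; rewrite adde_ge0//.
    by apply: integral_ge0 => y _; rewrite lee_fin addr_ge0// c_ge0.
  by rewrite mule_ge0 ?lee_fin ?wpos_ge0// (transition_kl_ge0 tau_dom).
- exact: (measurable_fun_pair2 x (measurable_cost tT (measurable_total tT)
    (fun w => total_ge0 w tT))).
- exact: (measurable_fun_pair2 x (measurable_risk_payoff tT)).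
move=> u _; apply: (le_trans _ (payoff _)); apply: leeD2r.
rewrite le_eqVlt; apply/orP; left; apply/eqP; apply: eq_integral => y _.
by rewrite /continuation rid.
Qed.

Definition expected_plus t x :=
  expectation pi tau (EFin \o cT) running_plus (T - t) t x.

Definition expected_minus t x :=
  expectation pi tau (cst 0) running_minus (T - t) t x.

Definition expected_kl t x :=
  expectation pi tau (cst 0) (running_kl T iota tau) (T - t) t x.

Let gT0 x : 0 <= (EFin \o cT) x. Proof. by rewrite lee_fin. Qed.
Let mgT : measurable_fun setT (EFin \o cT). Proof. exact/measurable_EFinP. Qed.
Let plus0 := running_plus_ge0 lS lP_gt0 c_ge0 pi_dom tau_dom.
Let mplus := measurable_running_plus lP lS mc pi_dom tau_dom.
Let minus0 := running_minus_ge0 lS tau_dom.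
Let mminus := measurable_running_minus lS tau_dom.
Let v0 s x : 0 <= (cost_to_go r s x)%:E. Proof. by rewrite lee_fin. Qed.
Let mv s : measurable_fun setT (fun x => (cost_to_go r s x)%:E).
Proof. exact/measurable_EFinP. Qed.

Lemma cost_to_go_ge t0 : (forall s z, (t0 <= s < T)%N ->
    risk_payoff s z <= kernel_payoff s z) ->
  forall t x, (t0 <= t <= T)%N ->
    (cost_to_go r t x)%:E + expected_minus t x <= expected_plus t x.
Proof.
move=> payoff t x /andP[t0t tT].
apply: (verification_ge gT0 mgT plus0 mplus (fun=> lexx 0) (measurable_cst 0)
  minus0 mminus v0 mv (T := T) (t0 := t0)) => //.
- by move=> y; rewrite adde0 cost_to_goT.
- by move=> s y /andP[t0s sT]; apply: bellman_ge => // z; apply: payoff; rewrite t0s.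
- by rewrite subnKC.
Qed.

Lemma cost_to_go_le t0 : (forall a, r a = a) ->
  (forall s, (t0 <= s < T)%N -> is_gibbs_policy r pi s) ->
  (forall s z, (t0 <= s < T)%N -> kernel_payoff s z <= risk_payoff s z) ->
  forall t x, (t0 <= t <= T)%N ->
    expected_plus t x <= (cost_to_go r t x)%:E + expected_minus t x.
Proof.
move=> rid gib payoff t x /andP[t0t tT].
apply: (verification_le gT0 mgT plus0 mplus (fun=> lexx 0) (measurable_cst 0)
  minus0 mminus v0 mv (T := T) (t0 := t0)) => //.
- by move=> y; rewrite adde0 cost_to_goT.
- move=> s y t0s; have /andP[_ sT] := t0s; apply: bellman_le => //; first exact: gib.
  by move=> z; exact: payoff.
- by rewrite subnKC.
Qed.

End one_step_inequality.
End verification.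

(** * Optimal value from a random initial state *)

(** Fatou's lemma: an upper bound passes to the pointwise limit. *)
Lemma integral_cvg_le d (Y : measurableType d) (R : realType)
    (m : {measure set Y -> \bar R}) (f : nat -> Y -> R) (l : Y -> R) (M : \bar R) :
  (forall n, measurable_fun setT (f n)) -> (forall n y, 0 <= f n y)%R ->
  (forall y, f ^~ y @ \oo --> l y) -> (forall n, \int[m]_y (f n y)%:E <= M) ->
  \int[m]_y (l y)%:E <= M.
Proof.
move=> mf f0 fl fM.
rewrite (eq_integral (fun y => limn_einf (fun n => (f n y)%:E))); last first.
  move=> y _; have cv : (f n y)%:E @[n --> \oo] --> (l y)%:E.
    by apply/fine_cvgP; split; [exact: nearW|exact: fl].
  exact/esym/(cvg_limn_einf_sup cv).1.
apply: le_trans (fatou m measurableT (f := fun n y => (f n y)%:E) _ _) _.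
- by move=> n; exact/measurable_EFinP.
- by move=> n y _; rewrite lee_fin.
rewrite limn_einf_lim; apply: lime_le; first exact: is_cvg_einfs.
apply: nearW => n; apply: le_trans (fM n); apply: ereal_inf_lbound.
by exists n => /=.
Qed.

Section optimality.
Context dX dU (X : measurableType dX) (U : measurableType dU) (R : realType).
Variables (T : nat) (rho : nat -> R.-pker X ~> U) (iota : nat -> R.-pker (X * U) ~> X).
Variables (c : nat -> X * U -> R) (cT : X -> R) (lP lS : R).
Hypotheses (lP_gt0 : (0 < lP)%R) (lS_neq0 : (lS != 0)%R).
Hypotheses (mc : forall t, (t < T)%N -> measurable_fun setT (c t))
  (c_ge0 : forall t z, (t < T)%N -> (0 <= c t z)%R)
  (mcT : measurable_fun setT cT) (cT_ge0 : forall x, (0 <= cT x)%R).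

Local Notation cost_to_go := (cost_to_go T rho iota c cT lP lS).
Local Notation finite_from := (finite_from T rho iota c cT lP lS).
Local Notation is_gibbs_policy := (is_gibbs_policy T rho iota c cT lP lS).
Local Notation is_gibbs_transition := (is_gibbs_transition T rho iota c cT lP lS).
Local Notation expected_plus := (expected_plus T rho iota c cT lP lS).
Local Notation expected_minus := (expected_minus T iota lS).
Local Notation expected_kl := (expected_kl T iota).

(** The problem from time [t] on with a random initial state of law [m]; a point
    mass gives the value function, the initial law the central problem. *)
Variables (m : probability X R) (t : nat).
Implicit Types (pi : nat -> R.-pker X ~> U) (tau : nat -> R.-pker (X * U) ~> X).
Implicit Types r : R -> R.

Definition objective_from pi tau : \bar R :=
  \int[m]_x expected_plus pi tau t x - \int[m]_x expected_minus pi tau t x.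

Definition admissible pi tau :=
  transitions T iota tau /\ \int[m]_x expected_kl pi tau t x < +oo.

Definition optimal_from : \bar R := \int[m]_x (cost_to_go idfun t x)%:E.

Let expected_minusE pi tau x : transitions T iota tau ->
  expected_minus pi tau t x = (wneg lS)%:E * expected_kl pi tau t x.
Proof.
move=> dom; rewrite /expected_kl -expectationZ ?wneg_ge0//.
- by rewrite /expected_minus; congr expectation; apply/funext => y; rewrite mule0.
- exact: (running_kl_ge0 dom).
- exact: (measurable_running_kl dom).
Qed.

Lemma measurable_expected_kl pi tau : transitions T iota tau ->
  measurable_fun setT (expected_kl pi tau t).
Proof.
move=> dom; apply: measurable_expectation => //.
- exact: (running_kl_ge0 dom).
- exact: (measurable_running_kl dom).
Qed.

Lemma expected_kl_ge0 pi tau x : transitions T iota tau -> 0 <= expected_kl pi tau t x.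
Proof. by move=> dom; apply: expectation_ge0 => //; exact: (running_kl_ge0 dom). Qed.

Lemma measurable_expected_plus pi tau : policies T rho pi -> transitions T iota tau ->
  measurable_fun setT (expected_plus pi tau t).
Proof.
move=> pdom dom; apply: measurable_expectation.
- by move=> y; rewrite lee_fin.
- exact/measurable_EFinP.
- exact: (running_plus_ge0 lS lP_gt0 c_ge0 pdom dom).
- exact: (measurable_running_plus lP lS mc pdom dom).
Qed.

Let expected_plus_ge0 pi tau x : policies T rho pi -> transitions T iota tau ->
  0 <= expected_plus pi tau t x.
Proof.
move=> pdom dom; apply: expectation_ge0.
- by move=> y; rewrite lee_fin.
- exact: (running_plus_ge0 lS lP_gt0 c_ge0 pdom dom).
Qed.

Lemma integral_expected_minus pi tau : transitions T iota tau ->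
  \int[m]_x expected_minus pi tau t x =
  (wneg lS)%:E * \int[m]_x expected_kl pi tau t x.
Proof.
move=> dom; rewrite -ge0_integralZl_EFin ?wneg_ge0//.
- by apply: eq_integral => x _; exact: expected_minusE.
- by move=> x _; exact: expected_kl_ge0.
- exact: measurable_expected_kl.
Qed.

Lemma expected_minus_fin pi tau : admissible pi tau ->
  \int[m]_x expected_minus pi tau t x \is a fin_num.
Proof.
move=> [dom klfin]; rewrite integral_expected_minus// fin_numM// ge0_fin_numE//.
by apply: integral_ge0 => x _; exact: expected_kl_ge0.
Qed.

Let expected_minus_ge0 pi tau x : transitions T iota tau -> 0 <= expected_minus pi tau t x.
Proof. by move=> dom; rewrite expected_minusE// mule_ge0 ?lee_fin ?wneg_ge0// expected_kl_ge0. Qed.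

Lemma measurable_expected_minus pi tau : transitions T iota tau ->
  measurable_fun setT (expected_minus pi tau t).
Proof.
move=> dom; rewrite (_ : expected_minus pi tau t = fun x => (wneg lS)%:E * expected_kl pi tau t x).
  by apply: measurable_funeM; exact: measurable_expected_kl.
by apply/funext => x; exact: expected_minusE.
Qed.

Section from_t.
Hypotheses (tT : (t <= T)%N) (fin : finite_from idfun t).

Let tt : (t <= t <= T)%N. Proof. by rewrite leqnn. Qed.

Let w0 (r : R -> R) mr r_itv := @cost_to_go_ge0 _ _ X U R T rho iota c cT lP lS mc c_ge0 mcT cT_ge0 r mr r_itv.
Let mw (r : R -> R) mr r_itv := @measurable_cost_to_go _ _ X U R T rho iota c cT lP lS mc c_ge0 mcT cT_ge0 r mr r_itv.

Let integral_costD r pi tau : measurable_fun setT r ->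
  (forall a, (0 <= a -> 0 <= r a <= a)%R) -> transitions T iota tau ->
  \int[m]_x ((cost_to_go r t x)%:E + expected_minus pi tau t x) =
  \int[m]_x (cost_to_go r t x)%:E + \int[m]_x expected_minus pi tau t x.
Proof.
move=> mr r_itv dom; rewrite ge0_integralD//.
- by move=> x _; rewrite lee_fin; exact: w0.
- by apply/measurable_EFinP; exact: mw.
- by move=> x _; exact: expected_minus_ge0.
- exact: measurable_expected_minus.
Qed.

Lemma objective_from_ge r pi tau : measurable_fun setT r ->
  (forall a, (0 <= a -> 0 <= r a <= a)%R) ->
  policies T rho pi -> admissible pi tau ->
  (forall s z, (t <= s < T)%N -> risk_payoff T rho iota c cT lP lS tau r s z
     <= kernel_payoff T rho iota c cT lP lS tau r s z) ->
  \int[m]_x (cost_to_go r t x)%:E <= objective_from pi tau.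
Proof.
move=> mr r_itv pdom adm payoff; have [dom _] := adm.
rewrite /objective_from leeBrDr; last exact: expected_minus_fin.
rewrite -integral_costD//; apply: ge0_le_integral => //.
- move=> x _; apply: adde_ge0; last exact: expected_minus_ge0.
  by rewrite lee_fin; exact: w0.
- apply: emeasurable_funD; last exact: measurable_expected_minus.
  by apply/measurable_EFinP; exact: mw.
- exact: measurable_expected_plus.
- by move=> x _; exact: (cost_to_go_ge lP_gt0 mc c_ge0 mcT cT_ge0 pdom dom mr r_itv payoff).
Qed.

Lemma objective_from_le pi tau : policies T rho pi -> admissible pi tau ->
  (forall s, (t <= s < T)%N -> is_gibbs_policy idfun pi s) ->
  (forall s z, (t <= s < T)%N -> kernel_payoff T rho iota c cT lP lS tau idfun s z
     <= risk_payoff T rho iota c cT lP lS tau idfun s z) ->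
  objective_from pi tau <= optimal_from.
Proof.
move=> pdom adm gib payoff; have [dom _] := adm.
rewrite /objective_from leeBlDr; last exact: expected_minus_fin.
rewrite /optimal_from -(integral_costD _ (@measurable_idfun R) (@id_itv R) dom).
apply: ge0_le_integral => //.
- by move=> x _; exact: expected_plus_ge0.
- exact: measurable_expected_plus.
- apply: emeasurable_funD; last exact: measurable_expected_minus.
  by apply/measurable_EFinP; apply: mw; [exact: (@measurable_idfun R)|exact: (@id_itv R)].
- move=> x _; exact: (cost_to_go_le lP_gt0 mc c_ge0 mcT cT_ge0 pdom dom
    (@measurable_idfun R) (@id_itv R) (fun=> erefl) gib payoff).
Qed.

Let kernel_payoff_eq r tau : measurable_fun setT r ->
  (forall a, (0 <= a -> 0 <= r a <= a)%R) -> finite_from r t ->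
  (forall s, (t <= s < T)%N -> is_gibbs_transition r tau s) ->
  forall s z, (t <= s < T)%N -> kernel_payoff T rho iota c cT lP lS tau r s z =
    risk_payoff T rho iota c cT lP lS tau r s z.
Proof.
move=> mr r_itv rfin gib s z tsT; have /andP[_ sT] := tsT.
exact: (kernel_payoff_gibbs lS_neq0 mc c_ge0 mcT cT_ge0 mr r_itv sT (rfin s z tsT) (gib s tsT)).
Qed.

(** Along the Gibbs pair each one-step inequality is an equality. *)
Lemma objective_from_gibbs pi tau : policies T rho pi -> admissible pi tau ->
  (forall s, (t <= s < T)%N -> is_gibbs_policy idfun pi s) ->
  (forall s, (t <= s < T)%N -> is_gibbs_transition idfun tau s) ->
  objective_from pi tau = optimal_from.
Proof.
move=> pdom adm pgib tgib.
have payoff := kernel_payoff_eq (@measurable_idfun R) (@id_itv R) fin tgib.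
apply/eqP; rewrite eq_le; apply/andP; split.
  by apply: objective_from_le => // s z tsT; rewrite payoff.
apply: (objective_from_ge (@measurable_idfun R) (@id_itv R) pdom adm) => s z tsT.
by rewrite payoff.
Qed.

(** Against the Gibbs transitions of a cost truncated at [n], divergences are at
    most [- lS * n], hence admissible whatever the policy. *)
Lemma truncated_gibbs_admissible n pi tau : (lS < 0)%R -> transitions T iota tau ->
  (forall s, (t <= s < T)%N -> is_gibbs_transition (truncate n) tau s) ->
  admissible pi tau.
Proof.
move=> l0 dom gib; split=> //; have K0 : (0 <= - lS * n%:R)%R.
  by rewrite mulr_ge0// oppr_ge0 ltW.
have nfin := finite_from_truncate lP_gt0 lS_neq0 mc c_ge0 mcT cT_ge0 fin n.
have kl_le s x : (t <= s < T)%N ->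
    step pi tau s x (running_kl T iota tau s) <= (- lS * n%:R)%:E.
  move=> tsT; have /andP[_ sT] := tsT.
  rewrite -(step_cst pi tau s x (- lS * n%:R)%:E); apply: le_step.
  - exact: (running_kl_ge0 dom).
  - exact: (measurable_running_kl dom).
  - exact: measurable_cst.
  move=> [z y]; rewrite /running_kl sT /=.
  have mcont := measurable_continuation rho iota lP lS mc c_ge0 mcT cT_ge0
    (@measurable_truncate R n) (@truncate_itv R n) sT.
  have cont0 := continuation_ge0 rho iota lP lS mc c_ge0 mcT cT_ge0
    (@measurable_truncate R n) (@truncate_itv R n).
  apply: le_trans (gibbs_kl_le (sigma := kernel_at (iota s) z) lS_neq0
    (measurable_fun_pair2 z mcont) (fun y => cont0 s (z, y) sT) (nfin s z tsT)
    (has_density_at z (gib s tsT)) l0) _.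
  rewrite EFinM; apply: lee_wpmul2l; first by rewrite lee_fin oppr_ge0 ltW.
  rewrite -[leRHS]mule1 -(@prob_kernel _ _ _ _ _ (tau s) z).
  rewrite -(integral_cst _ measurableT); apply: ge0_le_integral => //.
  - by move=> y' _; rewrite lee_fin; exact: cont0.
  - by apply/measurable_EFinP; exact: (measurable_fun_pair2 z mcont).
  - by move=> y' _; rewrite lee_fin /continuation /truncate ge_min lexx orbT.
have mono x : expected_kl pi tau t x <= ((T - t)%:R * (- lS * n%:R))%:E.
  apply: (expectation_le_cst (t0 := t)) => //.
  - exact: (running_kl_ge0 dom).
  - exact: (measurable_running_kl dom).
apply: (@le_lt_trans _ _ (\int[m]_x (cst ((T - t)%:R * (- lS * n%:R))%:E x))); last first.
  by rewrite (integral_cst m measurableT) [X in _ * X](@probability_setT _ _ _ m) mule1 ltry.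
apply: ge0_le_integral => //.
- by move=> x _; exact: expected_kl_ge0.
- exact: measurable_expected_kl.
Qed.

(** When [lS < 0] and the policy is arbitrary, the Gibbs transitions may have an
    infinite expected divergence, hence not be admissible.  The Gibbs transitions
    of the truncated costs are, and their values increase to the optimal one. *)
Theorem optimal_from_le pi : policies T rho pi ->
  optimal_from <= opt lS [set objective_from pi tau | tau in admissible pi].
Proof.
move=> pdom; rewrite /opt; case: ifPn => [l0|].
  apply: le_ereal_inf_tmp => _ [tau adm <-]; have [dom _] := adm.
  apply: (objective_from_ge (@measurable_idfun R) (@id_itv R) pdom adm) => s z tsT.
  have /andP[_ sT] := tsT.
  exact: (kernel_payoff_ge lS_neq0 mc c_ge0 mcT cT_ge0 dom (@measurable_idfun R) (@id_itv R)
    sT l0 (fin z tsT)).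
rewrite -leNgt le_eqVlt (negbTE lS_neq0)/= => l0.
apply: (@integral_cvg_le _ _ _ m (fun n => cost_to_go (truncate n) t)).
- by move=> n; apply: mw; [exact: (@measurable_truncate R n)|exact: (@truncate_itv R n)].
- by move=> n y; apply: w0; [exact: (@measurable_truncate R n)|exact: (@truncate_itv R n)].
- by have [] := cost_to_go_truncate lP_gt0 lS_neq0 mc c_ge0 mcT cT_ge0 fin tt.
move=> n.
have nfin := finite_from_truncate lP_gt0 lS_neq0 mc c_ge0 mcT cT_ge0 fin n.
have [tau [dom gib]] := gibbs_transitions_exist lS_neq0 mc c_ge0 mcT cT_ge0
  (@measurable_truncate R n) (@truncate_itv R n) nfin.
have adm := truncated_gibbs_admissible pi l0 dom gib.
apply: ereal_sup_ge; exists (objective_from pi tau); first by exists tau.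
apply: (objective_from_ge (@measurable_truncate R n) (@truncate_itv R n) pdom adm).
move=> s z tsT.
by rewrite (kernel_payoff_eq (@measurable_truncate R n) (@truncate_itv R n) nfin gib).
Qed.

(** When [lS > 0] the infimum over transitions is bounded by the Gibbs ones; when
    [lS < 0] every admissible transition is bounded by the risk. *)
Theorem optimal_from_ge pi : policies T rho pi ->
  (forall s, (t <= s < T)%N -> is_gibbs_policy idfun pi s) ->
  ((0 < lS)%R -> exists2 tau, admissible pi tau &
     forall s, (t <= s < T)%N -> is_gibbs_transition idfun tau s) ->
  opt lS [set objective_from pi tau | tau in admissible pi] <= optimal_from.
Proof.
move=> pdom pgib tau_adm; rewrite /opt; case: ifPn => [l0|].
  have [tau adm tgib] := tau_adm l0.
  rewrite -(objective_from_gibbs pdom adm pgib tgib).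
  by apply: ereal_inf_lbound; exists tau.
rewrite -leNgt le_eqVlt (negbTE lS_neq0)/= => l0.
apply: ge_ereal_sup => _ [tau adm <-]; have [dom _] := adm.
apply: objective_from_le => // s z tsT; have /andP[_ sT] := tsT.
exact: (kernel_payoff_le lS_neq0 mc c_ge0 mcT cT_ge0 dom (@measurable_idfun R) (@id_itv R)
  sT l0 (fin z tsT)).
Qed.

(** For [lS > 0] a finite optimal value bounds the divergences it contains. *)
Lemma gibbs_admissible_pos pi tau : (0 < lS)%R -> policies T rho pi ->
  transitions T iota tau ->
  (forall s, (t <= s < T)%N -> is_gibbs_policy idfun pi s) ->
  (forall s, (t <= s < T)%N -> is_gibbs_transition idfun tau s) ->
  optimal_from < +oo -> admissible pi tau.
Proof.
move=> l0 pdom dom pgib tgib vfin; split=> //.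
have payoff := kernel_payoff_eq (@measurable_idfun R) (@id_itv R) fin tgib.
have minus0 x : expected_minus pi tau t x = 0.
  by rewrite expected_minusE// (wneg_gt0 l0) mul0e.
have plus_le x : expected_plus pi tau t x <= (cost_to_go idfun t x)%:E.
  rewrite -[leRHS]adde0 -[X in _ <= _ + X](minus0 x).
  apply: (cost_to_go_le lP_gt0 mc c_ge0 mcT cT_ge0 pdom dom
    (@measurable_idfun R) (@id_itv R) (fun=> erefl) pgib _ _ tt) => s z tsT.
  by rewrite payoff.
have lSV0 : (0 <= lS^-1)%R by rewrite invr_ge0 ltW.
have kl0 := running_kl_ge0 dom; have mkl := measurable_running_kl dom.
have kl_plus x : (lS^-1)%:E * expected_kl pi tau t x <= expected_plus pi tau t x.
  rewrite /expected_kl -expectationZ//; apply: le_expectation.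
  - by move=> y; rewrite mule0.
  - by apply: measurable_funeM; exact: measurable_cst.
  - by move=> s w; rewrite mule_ge0.
  - by move=> s; exact: measurable_funeM.
  - exact/measurable_EFinP.
  - exact: (measurable_running_plus lP lS mc pdom dom).
  - by move=> y; rewrite mule0 lee_fin.
  - move=> s w; rewrite /running_kl /running_plus; case: ifPn => [sT|_]; last by rewrite mule0.
    rewrite (wpos_gt0 l0) leeDr// adde_ge0 ?lee_fin ?c_ge0//.
    by rewrite mule_ge0 ?lee_fin ?invr_ge0 ?(ltW lP_gt0)// (policy_kl_ge0 pdom).
have klE x : expected_kl pi tau t x = lS%:E * ((lS^-1)%:E * expected_kl pi tau t x).
  by rewrite muleA -EFinM divff// mul1e.
apply: (@le_lt_trans _ _ (\int[m]_x (lS%:E * (cost_to_go idfun t x)%:E))).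
  apply: ge0_le_integral => //.
  - by move=> x _; exact: expected_kl_ge0.
  - exact: measurable_expected_kl.
  - apply: measurable_funeM; apply/measurable_EFinP.
    by apply: mw; [exact: (@measurable_idfun R)|exact: (@id_itv R)].
  - move=> x _; rewrite klE; apply: lee_wpmul2l; first by rewrite lee_fin ltW.
    exact: le_trans (kl_plus x) (plus_le x).
rewrite ge0_integralZl_EFin//; last 3 first.
- by move=> x _; rewrite lee_fin; apply: w0; [exact: (@measurable_idfun R)|exact: (@id_itv R)].
- by apply/measurable_EFinP; apply: mw; [exact: (@measurable_idfun R)|exact: (@id_itv R)].
- exact: ltW.
by rewrite lte_mul_pinfty// lee_fin ltW.
Qed.

End from_t.
End optimality.

(** * Objectives as differences of expectations *)

(** The integral of a difference of nonnegative functions, only the subtracted one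
    being integrable: both sides may be +oo. *)
Lemma integral_ge0B d (Y : measurableType d) (R : realType)
    (m : {measure set Y -> \bar R}) (f g : Y -> \bar R) :
  (forall y, 0 <= f y) -> measurable_fun setT f ->
  (forall y, 0 <= g y) -> measurable_fun setT g -> \int[m]_y g y < +oo ->
  \int[m]_y (f y - g y) = \int[m]_y f y - \int[m]_y g y.
Proof.
move=> f0 mf g0 mg gfin.
have ig : m.-integrable setT g.
  by apply/integrableP; split=> //; under eq_integral do rewrite gee0_abs//.
have gfin_num : \int[m]_y g y \is a fin_num by exact: integrable_fin_num.
have [ffin|] := ltP (\int[m]_y f y) +oo.
  rewrite integralB//; apply/integrableP; split=> //.
  by under eq_integral do rewrite gee0_abs//.
rewrite leye_eq => /eqP fy; rewrite fy addye; last first.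
  by move: gfin_num; case: (\int[m]_y g y).
have mfg : measurable_fun setT (fun y => f y - g y) by exact: emeasurable_funB.
rewrite integralE.
have neg_fin : \int[m]_y (fun y => f y - g y)^\- y \is a fin_num.
  rewrite ge0_fin_numE; last exact: integral_ge0.
  apply: le_lt_trans gfin; apply: ge0_le_integral => //; first exact: measurable_funeneg.
  move=> y _; rewrite funenegE ge_max g0 andbT.
  have := f0 y; case: (f y) (g y) (g0 y) => [a| |] [b| |]//= b0 a0.
  - by rewrite lee_fin opprB lerBlDr lerDl.
  - by rewrite ?leey ?leNye.
have : +oo <= \int[m]_y (fun y => f y - g y)^\+ y + \int[m]_y g y.
  rewrite -fy -ge0_integralD//; last exact: measurable_funepos.
  apply: ge0_le_integral => //.
    by apply: emeasurable_funD => //; exact: measurable_funepos.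
  move=> y _; have [gy|gy] := eqVneq (g y) +oo.
    rewrite gy addey ?leey// -ltNye; apply: lt_le_trans (funepos_ge0 _ _).
    by rewrite ltNy0.
  rewrite funeposE; apply: (@le_trans _ _ ((f y - g y) + g y)).
    by rewrite subeK// ge0_fin_numE// ltey.
  by rewrite leeD2r// le_max lexx.
rewrite leye_eq => /eqP posy.
suff -> : \int[m]_y (fun y => f y - g y)^\+ y = +oo.
  by rewrite addye//; move: neg_fin; case: (\int[m]_y (fun y => f y - g y)^\- y).
have := integral_ge0 m (D := setT) (f := (fun y => f y - g y)^\+) (fun y _ => funepos_ge0 _ y).
move: posy gfin_num.
by case: (\int[m]_y (fun y => f y - g y)^\+ y) => // r; case: (\int[m]_y g y).
Qed.

Lemma oppe_sum_ge0 (R : realType) (I : Type) (s : seq I) (b : I -> \bar R) :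
  (forall i, 0 <= b i) -> - (\sum_(i <- s) b i) = \sum_(i <- s) - b i.
Proof.
move=> b0; elim: s => [|i s IH]; first by rewrite !big_nil oppe0.
by rewrite !big_cons oppeD ?IH// ge0_adde_def// inE ?sume_ge0.
Qed.

Lemma sume_subr (R : realType) (I : Type) (s : seq I) (a b : I -> \bar R) :
  (forall i, 0 <= b i) ->
  \sum_(i <- s) (a i - b i) = \sum_(i <- s) a i - \sum_(i <- s) b i.
Proof. by move=> b0; rewrite big_split/= oppe_sum_ge0. Qed.

Lemma weightsE (R : realType) (lam : R) (k : \bar R) : (lam != 0)%R ->
  (lam^-1)%:E * k = (wpos lam)%:E * k - (wneg lam)%:E * k.
Proof.
move=> lam0; case: (ltgtP lam 0%R) lam0 => // l0 _.
  by rewrite (wpos_lt0 l0) (wneg_lt0 l0) mul0e add0e EFinN mulNe oppeK.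
by rewrite (wpos_gt0 l0) (wneg_gt0 l0) mul0e sube0.
Qed.

Section segment_problem.
Context dX dU (X : measurableType dX) (U : measurableType dU) (R : realType).
Variables (T : nat) (rho : nat -> R.-pker X ~> U) (iota : nat -> R.-pker (X * U) ~> X).
Variables (c : nat -> X * U -> R) (cT : X -> R) (lP lS : R).
Hypotheses (lP_gt0 : (0 < lP)%R) (lS_neq0 : (lS != 0)%R).
Hypotheses (mc : forall t, (t < T)%N -> measurable_fun setT (c t))
  (c_ge0 : forall t z, (t < T)%N -> (0 <= c t z)%R)
  (mcT : measurable_fun setT cT) (cT_ge0 : forall x, (0 <= cT x)%R).
Variables (pi : nat -> R.-pker X ~> U) (tau : nat -> R.-pker (X * U) ~> X).

Local Notation plus := (running_plus T rho iota c lP lS pi tau).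
Local Notation minus := (running_minus T iota lS tau).

Lemma segment_transition_klE t (xi : segment X U (T - t)) :
  segment_transition_kl iota tau t xi =
  additive (cst 0) (running_kl T iota tau) t xi.
Proof.
rewrite /additive add0e; apply: eq_bigr => i _.
by rewrite /running_kl -ltn_subRL ltn_ord.
Qed.

Lemma integral_segment_transition_kl t x :
  \int[segment_law pi tau (T - t) t x]_xi segment_transition_kl iota tau t xi =
  expected_kl T iota pi tau t x.
Proof. by apply: eq_integral => xi _; exact: segment_transition_klE. Qed.

Hypotheses (pi_dom : policies T rho pi) (tau_dom : transitions T iota tau).

Let integrandE t (xi : segment X U (T - t)) :
  (cT xi.2)%:E + \sum_(i < T - t)
       ((c (t + i)%N (tnth xi.1 i))%:E
        + (lP^-1)%:E * policy_kl rho pi (t + i) (tnth xi.1 i).1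
        + (lS^-1)%:E * transition_kl iota tau (t + i) (tnth xi.1 i)) =
  additive (EFin \o cT) plus t xi - additive (cst 0) minus t xi.
Proof.
rewrite /additive add0e -addeA; congr (_ + _).
rewrite -sume_subr; last by move=> i; exact: running_minus_ge0.
apply: eq_bigr => i _; have tiT : (t + i < T)%N by rewrite -ltn_subRL ltn_ord.
by rewrite /running_plus /running_minus /running_kl tiT /= (weightsE _ lS_neq0) addeA.
Qed.

Lemma segment_objectiveE t x : expected_kl T iota pi tau t x < +oo ->
  segment_objective T rho iota c cT lP lS pi tau t x =
  expected_plus T rho iota c cT lP lS pi tau t x - expected_minus T iota lS pi tau t x.
Proof.
move=> klfin; rewrite /segment_objective.
under eq_integral do rewrite integrandE.
have plus0 := running_plus_ge0 lS lP_gt0 c_ge0 pi_dom tau_dom.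
have mplus := measurable_running_plus lP lS mc pi_dom tau_dom.
have minus0 := running_minus_ge0 lS tau_dom.
have mminus := measurable_running_minus lS tau_dom.
have kl0 := running_kl_ge0 tau_dom; have mkl := measurable_running_kl tau_dom.
apply: integral_ge0B.
- by move=> xi; apply: additive_ge0 => // y; rewrite lee_fin.
- by apply: measurable_additive => //; exact/measurable_EFinP.
- by move=> xi; apply: additive_ge0.
- exact: measurable_additive.
rewrite (_ : integral _ _ _ = (wneg lS)%:E * expected_kl T iota pi tau t x).
  by rewrite lte_mul_pinfty ?lee_fin ?wneg_ge0.
rewrite /expected_kl -expectationZ ?wneg_ge0//.
by congr expectation; apply/funext => y; rewrite mule0.
Qed.

End segment_problem.

(** * Log-likelihood ratios and the central objective *)

Section log_likelihood_ratio.
Context d d' (X : measurableType d) (Y : measurableType d') (R : realType).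
Variables (k s : R.-pker X ~> Y).
Hypothesis dom : kernel_dominated k s.

Definition log_pos (w : X * Y) : \bar R := maxe (log_ratio k s w) 0.
Definition log_neg (w : X * Y) : \bar R := maxe (- log_ratio k s w) 0.

Lemma log_pos_ge0 w : 0 <= log_pos w. Proof. by rewrite le_max lexx orbT. Qed.
Lemma log_neg_ge0 w : 0 <= log_neg w. Proof. by rewrite le_max lexx orbT. Qed.

Lemma log_ratioE w : log_ratio k s w = log_pos w - log_neg w.
Proof.
have := congr1 (fun f => f w) (funeposneg (log_ratio k s)).
by rewrite /= funeposE funenegE.
Qed.

Lemma log_pos_fin w : log_pos w \is a fin_num.
Proof.
rewrite /log_pos /log_ratio /=; case: ifPn => _; last by rewrite -EFin_max.
by rewrite maxC maxEle leeNy_eq.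
Qed.

Let mlog : measurable_fun setT (log_ratio k s).
Proof.
have [mp _ _] := kernel_densityP dom.
apply: (measurableT_comp (@measurable_lne R)); exact/measurable_EFinP.
Qed.

Lemma measurable_log_pos : measurable_fun setT log_pos.
Proof. by apply: measurable_maxe => //; exact: mlog. Qed.

Lemma measurable_log_neg : measurable_fun setT log_neg.
Proof. by apply: measurable_maxe => //; apply: measurableT_comp => //; exact: mlog. Qed.

Let hd x := has_density_at x (kernel_densityP dom).

Lemma integral_log_neg_le1 x : \int[k x]_y log_neg (x, y) <= 1.
Proof.
apply: le_trans (integral_lne_neg_le1 (hd x)).
rewrite le_eqVlt; apply/orP; left; apply/eqP.
by apply: eq_integral => y _; rewrite funenegE.
Qed.

Lemma integral_log_pos x : \int[k x]_y log_pos (x, y) =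
  kl (kernel_at k x) (kernel_at s x) + \int[k x]_y log_neg (x, y).
Proof.
transitivity (\int[kernel_at k x]_y
    (@lne R \o EFin \o (fun y => kernel_density k s (x, y)))^\+ y).
  by apply: eq_integral => y _; rewrite funeposE.
rewrite (integral_lne_pos (hd x)); congr (_ + _).
by apply: eq_integral => y _; rewrite funenegE.
Qed.

End log_likelihood_ratio.

Section integral_init_law.
Context dX dU (X : measurableType dX) (U : measurableType dU) (R : realType).
Variables (p0 : probability X R) (n : nat) (k : R.-pker X ~> segment X U n).

Lemma integral_init_law (F : segment X U n -> \bar R) :
  (forall xi, 0 <= F xi) -> measurable_fun setT F ->
  \int[init_law p0 k]_xi F xi = \int[p0]_x \int[k x]_xi F xi.
Proof.
move=> F0 mF; exact: (integral_kcomp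
  (kprobability (measurable_cst (p0 : pprobability X R)
       : measurable_fun [set: unit] _)) (kernel.kernel_snd k) tt F0 mF).
Qed.

End integral_init_law.

(** Regrouping by sign: [A], [G] are the sums of the positive parts of the
    logarithms, [B], [H] those of the negative parts, which may be infinite. *)
Lemma weighted_log_ratios (R : realType) (a lam C : R) (A B G H : \bar R) :
  (lam != 0)%R -> A \is a fin_num -> G \is a fin_num ->
  0 <= a%:E * B -> 0 <= B -> 0 <= H ->
  C%:E + a%:E * (A - B) + (lam^-1)%:E * (G - H) =
  C%:E + (a%:E * A + ((wpos lam)%:E * G + (wneg lam)%:E * H)) -
  (a%:E * B + ((wpos lam)%:E * H + (wneg lam)%:E * G)).
Proof.
move=> lam0; case: A => // r _; case: G => // s _ aB0 B0 H0.
have distr (k u : R) (Z : \bar R) : 0 <= Z -> k%:E * (u%:E - Z) = (k * u)%:E - k%:E * Z.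
  by move=> Z0; rewrite muleDr// muleN EFinM.
rewrite distr//; move: aB0; move: (a%:E * B) => aB aB0; rewrite -[a%:E * r%:E]EFinM.
case: (ltgtP lam 0%R) lam0 => // l0 _.
  rewrite (wpos_lt0 l0) (wneg_lt0 l0) !mul0e !add0e.
  set b := (- lam^-1)%R.
  have nH : 0 <= b%:E * H.
    by rewrite mule_ge0// lee_fin oppr_ge0 invr_le0 ltW.
  have -> : (lam^-1 = - b)%R by rewrite opprK.
  rewrite EFinN mulNe distr// -[b%:E * s%:E]EFinM.
  move: nH; move: (b%:E * H) => nH nH0; move: (b * s)%R (a * r)%R => u v.
  case: aB aB0 => // [x|] _; case: nH nH0 => // y _.
    by rewrite -!(EFinN, EFinD); congr EFin; ring.
rewrite (wpos_gt0 l0) (wneg_gt0 l0) !mul0e !adde0.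
have kH : 0 <= (lam^-1)%:E * H by rewrite mule_ge0// lee_fin invr_ge0 ltW.
rewrite distr// -[_%:E * s%:E]EFinM.
move: kH; move: ((lam^-1)%:E * H) => kH kH0; move: (lam^-1 * s)%R (a * r)%R => u v.
case: aB aB0 => // [x|] _; case: kH kH0 => // y _.
by rewrite -!(EFinN, EFinD); congr EFin; ring.
Qed.

Section central_problem.
Context dX dU (X : measurableType dX) (U : measurableType dU) (R : realType).
Variables (T : nat) (p0 : probability X R).
Variables (rho : nat -> R.-pker X ~> U) (iota : nat -> R.-pker (X * U) ~> X).
Variables (c : nat -> X * U -> R) (cT : X -> R) (lP lS : R).
Hypotheses (lP_gt0 : (0 < lP)%R) (lS_neq0 : (lS != 0)%R).
Hypotheses (mc : forall t, (t < T)%N -> measurable_fun setT (c t))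
  (c_ge0 : forall t z, (t < T)%N -> (0 <= c t z)%R)
  (mcT : measurable_fun setT cT) (cT_ge0 : forall x, (0 <= cT x)%R).
Variables (pi : nat -> R.-pker X ~> U) (tau : nat -> R.-pker (X * U) ~> X).
Hypothesis tau_dom : transitions T iota tau.

Lemma integral_trajectory_kl :
  \int[trajectory_law p0 pi tau]_xi segment_transition_kl iota tau 0 (n := T) xi =
  \int[p0]_x expected_kl T iota pi tau 0 x.
Proof.
rewrite (eq_integral (additive (cst 0) (running_kl T iota tau) 0)); last first.
  move=> xi _; rewrite /additive add0e; apply: eq_bigr => i _.
  by rewrite /running_kl add0n ltn_ord.
rewrite integral_init_law.
- by apply: eq_integral => x _; rewrite /expected_kl subn0.
- by move=> xi; apply: additive_ge0 => //; exact: (running_kl_ge0 tau_dom).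
- by apply: measurable_additive => //; exact: (measurable_running_kl tau_dom).
Qed.

Hypothesis pi_dom : policies T rho pi.

Let a : R := (lP^-1)%R.
Let a0 : (0 <= a)%R. Proof. by rewrite invr_ge0 ltW. Qed.

(* The common shape of the running terms: a cost, a policy term weighted by
   [1 / lP], and two transition terms weighted by the two parts of [1 / lS]. *)
Let comb (C F G H : (X * U) * X -> \bar R) w : \bar R :=
  C w + (a%:E * F w + ((wpos lS)%:E * G w + (wneg lS)%:E * H w)).

Let Lp s (w : (X * U) * X) := log_pos (pi s) (rho s) w.1.
Let Ln s (w : (X * U) * X) := log_neg (pi s) (rho s) w.1.
Let Mp s (w : (X * U) * X) := log_pos (tau s) (iota s) w.
Let Mn s (w : (X * U) * X) := log_neg (tau s) (iota s) w.
Let cost s (w : (X * U) * X) : \bar R := (c s w.1)%:E.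
Let kp s (w : (X * U) * X) := policy_kl rho pi s w.1.1.
Let kt s (w : (X * U) * X) := transition_kl iota tau s w.1.

(* The integrand of the central objective is [likelihood_plus - likelihood_minus].
   In expectation these exceed [running_plus] and [running_minus] by the same
   [correction], which is bounded because the negative part of a log-likelihood
   ratio has expectation at most 1. *)
Let likelihood_plus s w : \bar R :=
  if (s < T)%N then comb (cost s) (Lp s) (Mp s) (Mn s) w else 0.
Let likelihood_minus s w : \bar R :=
  if (s < T)%N then comb (cst 0) (Ln s) (Mn s) (Mp s) w else 0.
Let correction s w : \bar R :=
  if (s < T)%N then comb (cst 0) (Ln s) (Mn s) (Mn s) w else 0.

Let nonneg_meas (F : (X * U) * X -> \bar R) :=
  (forall w, 0 <= F w) /\ measurable_fun setT F.

Let comb_nm C F G H : nonneg_meas C -> nonneg_meas F -> nonneg_meas G -> nonneg_meas H ->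
  nonneg_meas (comb C F G H).
Proof.
move=> [C0 mC] [F0 mF] [G0 mG] [H0 mH]; split.
  by move=> w; rewrite !adde_ge0// mule_ge0// lee_fin ?wpos_ge0 ?wneg_ge0.
apply: emeasurable_funD => //; apply: emeasurable_funD; first exact: measurable_funeM.
by apply: emeasurable_funD; exact: measurable_funeM.
Qed.

Let guard_nm s (F : (X * U) * X -> \bar R) : ((s < T)%N -> nonneg_meas F) ->
  nonneg_meas (fun w => if (s < T)%N then F w else 0).
Proof.
case: (s < T)%N => [/(_ isT)//|_]; split => //; exact: measurable_cst.
Qed.

Let stepZ s x (b : R) F : (0 <= b)%R -> nonneg_meas F ->
  step pi tau s x (fun w => b%:E * F w) = b%:E * step pi tau s x F.
Proof.
move=> b0 [F0 mF]; rewrite /step -ge0_integralZl_EFin//.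
- apply: eq_integral => u _; rewrite ge0_integralZl_EFin//.
  exact: (measurable_fun_pair2 (x, u)).
- by move=> u _; exact: integral_ge0.
- apply: (measurable_fun_pair2 (f := fun z => \int[tau s z]_y F (z, y))).
  exact: measurable_fun_integral_finite_kernel.
Qed.

Let step_comb s x C F G H : nonneg_meas C -> nonneg_meas F -> nonneg_meas G -> nonneg_meas H ->
  step pi tau s x (comb C F G H) = step pi tau s x C + (a%:E * step pi tau s x F +
    ((wpos lS)%:E * step pi tau s x G + (wneg lS)%:E * step pi tau s x H)).
Proof.
move=> [C0 mC] nF nG nH; have [F0 mF] := nF; have [G0 mG] := nG; have [H0 mH] := nH.
have aF0 w : 0 <= a%:E * F w by rewrite mule_ge0.
have maF : measurable_fun setT (fun w => a%:E * F w) by exact: measurable_funeM.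
have bG0 w : 0 <= (wpos lS)%:E * G w by rewrite mule_ge0 ?lee_fin ?wpos_ge0.
have mbG : measurable_fun setT (fun w => (wpos lS)%:E * G w) by exact: measurable_funeM.
have dH0 w : 0 <= (wneg lS)%:E * H w by rewrite mule_ge0 ?lee_fin ?wneg_ge0.
have mdH : measurable_fun setT (fun w => (wneg lS)%:E * H w) by exact: measurable_funeM.
have GH0 w : 0 <= (wpos lS)%:E * G w + (wneg lS)%:E * H w by rewrite adde_ge0.
have mGH := emeasurable_funD mbG mdH.
have FGH0 w : 0 <= a%:E * F w + ((wpos lS)%:E * G w + (wneg lS)%:E * H w) by rewrite adde_ge0.
rewrite (stepD pi tau s x C0 mC FGH0 (emeasurable_funD maF mGH)).
rewrite (stepD pi tau s x aF0 maF GH0 mGH) (stepD pi tau s x bG0 mbG dH0 mdH).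
by rewrite (stepZ _ _ a0 nF) (stepZ _ _ (wpos_ge0 lS) nG) (stepZ _ _ (wneg_ge0 lS) nH).
Qed.

Let cst0_nm : nonneg_meas (cst 0).
Proof. by split=> //; exact: measurable_cst. Qed.

Let cost_nm s : (s < T)%N -> nonneg_meas (cost s).
Proof.
move=> sT; split=> [w|]; first by rewrite lee_fin c_ge0.
by apply/measurable_EFinP; exact: (measurableT_comp (mc sT)).
Qed.

Let Lp_nm s : (s < T)%N -> nonneg_meas (Lp s).
Proof.
move=> sT; split=> [w|]; first exact: log_pos_ge0.
exact: (measurableT_comp (measurable_log_pos (pi_dom sT)) measurable_fst).
Qed.

Let Ln_nm s : (s < T)%N -> nonneg_meas (Ln s).
Proof.
move=> sT; split=> [w|]; first exact: log_neg_ge0.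
exact: (measurableT_comp (measurable_log_neg (pi_dom sT)) measurable_fst).
Qed.

Let Mp_nm s : (s < T)%N -> nonneg_meas (Mp s).
Proof.
move=> sT; split=> [w|]; [exact: log_pos_ge0|exact: measurable_log_pos (tau_dom sT)].
Qed.

Let Mn_nm s : (s < T)%N -> nonneg_meas (Mn s).
Proof.
move=> sT; split=> [w|]; [exact: log_neg_ge0|exact: measurable_log_neg (tau_dom sT)].
Qed.

Let kp_nm s : (s < T)%N -> nonneg_meas (kp s).
Proof.
move=> sT; split=> [w|]; first exact: policy_kl_ge0 pi_dom _ _ sT.
apply: (measurableT_comp (measurable_policy_kl pi_dom sT)).
exact: (measurableT_comp measurable_fst measurable_fst).
Qed.

Let kt_nm s : (s < T)%N -> nonneg_meas (kt s).
Proof.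
move=> sT; split=> [w|]; first exact: transition_kl_ge0 tau_dom _ _ sT.
exact: (measurableT_comp (measurable_transition_kl tau_dom sT) measurable_fst).
Qed.

Let addnm F G : nonneg_meas F -> nonneg_meas G -> nonneg_meas (fun w => F w + G w).
Proof.
by move=> [F0 mF] [G0 mG]; split=> [w|]; [exact: adde_ge0|exact: emeasurable_funD].
Qed.

(** Likelihood ratios average to divergences; kept positive by moving the
    negative parts of the logarithms to the other side. *)
Let step_Lp s x : (s < T)%N ->
  step pi tau s x (Lp s) = step pi tau s x (fun w => kp s w + Ln s w).
Proof.
move=> sT; have [k0 mk] := kp_nm sT; have [n0 mn] := Ln_nm sT.
have kpE : step pi tau s x (kp s) = policy_kl rho pi s x.
  rewrite -[RHS](step_cst pi tau s x).
  by apply: eq_integral => u _; apply: eq_integral => y _.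
rewrite (stepD pi tau s x k0 mk n0 mn) kpE.
have cstE (f : X * U -> \bar R) :
    step pi tau s x (fun w => f w.1) = \int[pi s x]_u f (x, u).
  apply: eq_integral => u _.
  by rewrite (integral_cst (tau s (x, u)) measurableT (f (x, u))) prob_kernel mule1.
by rewrite /Lp /Ln !cstE (integral_log_pos (pi_dom sT)).
Qed.

Let step_Mp s x : (s < T)%N ->
  step pi tau s x (Mp s) = step pi tau s x (fun w => kt s w + Mn s w).
Proof.
move=> sT; have [n0 mn] := Mn_nm sT; apply: eq_integral => u _.
rewrite (integral_log_pos (tau_dom sT)) ge0_integralD//.
- congr (_ + _); apply/esym.
  apply: etrans (integral_cst (tau s (x, u)) measurableT (transition_kl iota tau s (x, u))) _.
  by rewrite prob_kernel mule1.
- by move=> y _; exact: transition_kl_ge0 tau_dom _ _ sT.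
- exact: (measurable_cst (transition_kl iota tau s (x, u))).
- exact: (measurable_fun_pair2 (x, u) mn).
Qed.

Let step_Ln_le1 s x : (s < T)%N -> step pi tau s x (Ln s) <= 1.
Proof.
move=> sT; apply: le_trans (integral_log_neg_le1 (pi_dom sT) x).
rewrite le_eqVlt; apply/orP; left; apply/eqP; apply: eq_integral => u _.
apply: etrans (integral_cst (tau s (x, u)) measurableT (log_neg (pi s) (rho s) (x, u))) _.
by rewrite prob_kernel mule1.
Qed.

Let step_Mn_le1 s x : (s < T)%N -> step pi tau s x (Mn s) <= 1.
Proof.
move=> sT; have [n0 mn] := Mn_nm sT.
apply: (@le_trans _ _ (\int[pi s x]_u (cst 1 u))); last first.
  by rewrite (integral_cst (pi s x) measurableT 1) prob_kernel mule1.
apply: ge0_le_integral => //.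
- by move=> u _; exact: integral_ge0.
- apply: (measurable_fun_pair2 (f := fun z => \int[tau s z]_y Mn s (z, y))).
  exact: measurable_fun_integral_finite_kernel.
- by move=> u _; exact: integral_log_neg_le1 (tau_dom sT) _.
Qed.

Let plus_nm s : nonneg_meas (likelihood_plus s).
Proof.
apply: guard_nm => sT.
by apply: comb_nm; [exact: cost_nm|exact: Lp_nm|exact: Mp_nm|exact: Mn_nm].
Qed.

Let minus_nm s : nonneg_meas (likelihood_minus s).
Proof.
apply: guard_nm => sT.
by apply: comb_nm; [exact: cst0_nm|exact: Ln_nm|exact: Mn_nm|exact: Mp_nm].
Qed.

Let correction_nm s : nonneg_meas (correction s).
Proof.
apply: guard_nm => sT.
by apply: comb_nm; [exact: cst0_nm|exact: Ln_nm|exact: Mn_nm|exact: Mn_nm].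
Qed.

Let rplus_nm s : nonneg_meas (running_plus T rho iota c lP lS pi tau s).
Proof.
split; first exact: (running_plus_ge0 lS lP_gt0 c_ge0 pi_dom tau_dom).
exact: (measurable_running_plus lP lS mc pi_dom tau_dom).
Qed.

Let rminus_nm s : nonneg_meas (running_minus T iota lS tau s).
Proof.
split; first exact: (running_minus_ge0 lS tau_dom).
exact: (measurable_running_minus lS tau_dom).
Qed.

Let comb_plus s w : (s < T)%N ->
  comb (cost s) (fun w => kp s w + Ln s w) (fun w => kt s w + Mn s w) (Mn s) w =
  running_plus T rho iota c lP lS pi tau s w + correction s w.
Proof.
move=> sT; have [[kp0 _] [kt0 _]] := (kp_nm sT, kt_nm sT).
have [[n0 _] [m0 _]] := (Ln_nm sT, Mn_nm sT).
rewrite /comb /running_plus /correction sT /comb add0e.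
rewrite (ge0_muleDr a%:E (kp0 w) (n0 w)) (ge0_muleDr (wpos lS)%:E (kt0 w) (m0 w)).
have regroup (C K L G M N : \bar R) :
    C + (K + L + (G + M + N)) = C + K + G + (L + (M + N)).
  by rewrite -!addeA; congr (_ + (_ + _)); rewrite addeCA.
exact: regroup.
Qed.

Let comb_minus s w : (s < T)%N ->
  comb (cst 0) (Ln s) (Mn s) (fun w => kt s w + Mn s w) w =
  running_minus T iota lS tau s w + correction s w.
Proof.
move=> sT; have [kt0 _] := kt_nm sT; have [m0 _] := Mn_nm sT.
rewrite /comb /running_minus /running_kl /correction sT /comb !add0e.
rewrite (ge0_muleDr (wneg lS)%:E (kt0 w) (m0 w)).
have regroup (L M K N : \bar R) : L + (M + (K + N)) = K + (L + (M + N)).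
  rewrite [X in L + X]addeCA; exact: addeCA.
exact: regroup.
Qed.

Let cT0 x : 0 <= (EFin \o cT) x. Proof. by rewrite lee_fin. Qed.
Let mEcT : measurable_fun setT (EFin \o cT). Proof. exact/measurable_EFinP. Qed.
Let z0 (x : X) : 0 <= (cst 0 x : \bar R). Proof. by []. Qed.
Let mz : measurable_fun setT (cst 0 : X -> \bar R). Proof. exact: measurable_cst. Qed.

Let step_plus s x : step pi tau s x (likelihood_plus s) =
  step pi tau s x (fun w => running_plus T rho iota c lP lS pi tau s w + correction s w).
Proof.
have [sT|sT] := boolP (s < T)%N; last first.
  by apply: eq_step => w; rewrite /likelihood_plus /running_plus /correction (negbTE sT) adde0.
have Ckn := addnm (kp_nm sT) (Ln_nm sT); have Tkn := addnm (kt_nm sT) (Mn_nm sT).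
transitivity (step pi tau s x (comb (cost s) (Lp s) (Mp s) (Mn s))).
  by apply: eq_step => w; rewrite /likelihood_plus sT.
rewrite (step_comb s x (cost_nm sT) (Lp_nm sT) (Mp_nm sT) (Mn_nm sT)).
rewrite (step_Lp x sT) (step_Mp x sT) -(step_comb s x (cost_nm sT) Ckn Tkn (Mn_nm sT)).
by apply: eq_step => w; exact: comb_plus.
Qed.

Let step_minus s x : step pi tau s x (likelihood_minus s) =
  step pi tau s x (fun w => running_minus T iota lS tau s w + correction s w).
Proof.
have [sT|sT] := boolP (s < T)%N; last first.
  apply: eq_step => w; rewrite /likelihood_minus /running_minus /running_kl /correction.
  by rewrite (negbTE sT) mule0 adde0.
have Tkn := addnm (kt_nm sT) (Mn_nm sT).
transitivity (step pi tau s x (comb (cst 0) (Ln s) (Mn s) (Mp s))).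
  by apply: eq_step => w; rewrite /likelihood_minus sT.
rewrite (step_comb s x cst0_nm (Ln_nm sT) (Mn_nm sT) (Mp_nm sT)).
rewrite (step_Mp x sT) -(step_comb s x cst0_nm (Ln_nm sT) (Mn_nm sT) Tkn).
by apply: eq_step => w; exact: comb_minus.
Qed.

Let expectation_plus x :
  expectation pi tau (EFin \o cT) likelihood_plus T 0 x =
  expected_plus T rho iota c cT lP lS pi tau 0 x +
  expectation pi tau (cst 0) correction T 0 x.
Proof.
have sum_nm s := addnm (rplus_nm s) (correction_nm s).
rewrite (eq_expectation T 0 x cT0 mEcT (fun s => (plus_nm s).1) (fun s => (plus_nm s).2)
  (fun s => (sum_nm s).1) (fun s => (sum_nm s).2) step_plus).
rewrite /expected_plus subn0 -(expectationD _ _ cT0 mEcT (fun s => (rplus_nm s).1)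
  (fun s => (rplus_nm s).2) z0 mz (fun s => (correction_nm s).1)
  (fun s => (correction_nm s).2)).
by congr expectation; apply/funext => y; rewrite /= adde0.
Qed.

Let expectation_minus x :
  expectation pi tau (cst 0) likelihood_minus T 0 x =
  expected_minus T iota lS pi tau 0 x + expectation pi tau (cst 0) correction T 0 x.
Proof.
have sum_nm s := addnm (rminus_nm s) (correction_nm s).
rewrite (eq_expectation T 0 x z0 mz (fun s => (minus_nm s).1) (fun s => (minus_nm s).2)
  (fun s => (sum_nm s).1) (fun s => (sum_nm s).2) step_minus).
rewrite /expected_minus subn0 -(expectationD _ _ z0 mz (fun s => (rminus_nm s).1)
  (fun s => (rminus_nm s).2) z0 mz (fun s => (correction_nm s).1)
  (fun s => (correction_nm s).2)).
by congr expectation; apply/funext => y; rewrite /= adde0.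
Qed.

Let correction_fin x :
  expectation pi tau (cst 0) correction T 0 x <=
  (T%:R * (a + (wpos lS + wneg lS)))%:E.
Proof.
rewrite -[in leLHS](subn0 T) -[in leRHS](subn0 T).
apply: (expectation_le_cst (t0 := 0%N)) => //.
- by move=> s; exact: (correction_nm s).1.
- by move=> s; exact: (correction_nm s).2.
- by rewrite !addr_ge0 ?wpos_ge0 ?wneg_ge0.
move=> s y /= sT.
rewrite (eq_step _ _ _ _ (G := comb (cst 0) (Ln s) (Mn s) (Mn s))); last first.
  by move=> w; rewrite /correction sT.
rewrite (step_comb s y cst0_nm (Ln_nm sT) (Mn_nm sT) (Mn_nm sT)).
rewrite (step_cst pi tau s y 0) add0e !EFinD.
have mul_le1 (b : R) (z : \bar R) : (0 <= b)%R -> z <= 1 -> b%:E * z <= b%:E.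
  by move=> b0 z1; rewrite -[leRHS]mule1; exact: lee_wpmul2l.
apply: leeD; first exact: mul_le1 a0 (step_Ln_le1 y sT).
by apply: leeD; apply: mul_le1 (step_Mn_le1 y sT); [exact: wpos_ge0|exact: wneg_ge0].
Qed.

Let integrandE (xi : segment X U T) :
  (cT xi.2 + \sum_(t < T) c t (tnth xi.1 t))%:E
     + (lP^-1)%:E * \sum_(t < T) log_ratio (pi t) (rho t) (tnth xi.1 t)
     + (lS^-1)%:E * \sum_(t < T)
         log_ratio (tau t) (iota t) (tnth xi.1 t, segment_state xi t.+1) =
  additive (EFin \o cT) likelihood_plus 0 xi - additive (cst 0) likelihood_minus 0 xi.
Proof.
pose w (i : 'I_T) : (X * U) * X := (tnth xi.1 i, segment_state xi i.+1).
set A := \sum_(i < T) Lp i (w i); set B := \sum_(i < T) Ln i (w i).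
set G := \sum_(i < T) Mp i (w i); set H := \sum_(i < T) Mn i (w i).
have B0 : 0 <= B by apply: sume_ge0 => i _; exact: log_neg_ge0.
have H0 : 0 <= H by apply: sume_ge0 => i _; exact: log_neg_ge0.
have A0 : 0 <= A by apply: sume_ge0 => i _; exact: log_pos_ge0.
have G0 : 0 <= G by apply: sume_ge0 => i _; exact: log_pos_ge0.
have Afin : A \is a fin_num by rewrite sum_fin_num; apply/allP => ? /mapP[i _ ->]; exact: log_pos_fin.
have Gfin : G \is a fin_num by rewrite sum_fin_num; apply/allP => ? /mapP[i _ ->]; exact: log_pos_fin.
have -> : \sum_(t < T) log_ratio (pi t) (rho t) (tnth xi.1 t) = A - B.
  rewrite -sume_subr; last by move=> i; exact: log_neg_ge0.
  by apply: eq_bigr => i _; exact: log_ratioE.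
have -> : \sum_(t < T) log_ratio (tau t) (iota t) (tnth xi.1 t, segment_state xi t.+1) = G - H.
  rewrite -sume_subr; last by move=> i; exact: log_neg_ge0.
  by apply: eq_bigr => i _; exact: log_ratioE.
have -> : additive (EFin \o cT) likelihood_plus 0 xi =
    (cT xi.2 + \sum_(t < T) c t (tnth xi.1 t))%:E +
    (a%:E * A + ((wpos lS)%:E * G + (wneg lS)%:E * H)).
  rewrite /additive EFinD -addeA; congr (_ + _); rewrite -sumEFin.
  rewrite !ge0_sume_distrr; try by move=> i _; rewrite ?log_neg_ge0 ?log_pos_ge0.
  rewrite -!big_split /=; apply: eq_bigr => i _.
  by rewrite /likelihood_plus add0n ltn_ord.
have -> : additive (cst 0) likelihood_minus 0 xi =
    a%:E * B + ((wpos lS)%:E * H + (wneg lS)%:E * G).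
  rewrite /additive add0e.
  rewrite !ge0_sume_distrr; try by move=> i _; rewrite ?log_neg_ge0 ?log_pos_ge0.
  rewrite -!big_split /=; apply: eq_bigr => i _.
  by rewrite /likelihood_minus add0n ltn_ord /comb add0e.
by apply: weighted_log_ratios => //; rewrite mule_ge0.
Qed.

(** The logarithms average to divergences once the common, finite, correction has
    been cancelled between the two expectations. *)
Lemma central_objectiveE : \int[p0]_x expected_kl T iota pi tau 0 x < +oo ->
  central_objective T p0 rho iota c cT lP lS pi tau =
  objective_from T rho iota c cT lP lS p0 0 pi tau.
Proof.
move=> klfin; rewrite /central_objective (eq_integral _ _ (fun xi _ => integrandE xi)).
set F := additive _ likelihood_plus _; set G := additive _ likelihood_minus _.
have F0 xi : 0 <= F xi by apply: additive_ge0 => // s; exact: (plus_nm s).1.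
have mF : measurable_fun setT F by apply: measurable_additive => // s; exact: (plus_nm s).2.
have G0 xi : 0 <= G xi by apply: additive_ge0 => // s; exact: (minus_nm s).1.
have mG : measurable_fun setT G by apply: measurable_additive => // s; exact: (minus_nm s).2.
pose K := \int[p0]_x expectation pi tau (cst 0) correction T 0 x.
have corr0 x : 0 <= expectation pi tau (cst 0) correction T 0 x.
  by apply: expectation_ge0 => // s; exact: (correction_nm s).1.
have mcorr : measurable_fun setT (expectation pi tau (cst 0) correction T 0).
  apply: measurable_expectation => // s; [exact: (correction_nm s).1|exact: (correction_nm s).2].
have eplus0 x : 0 <= expected_plus T rho iota c cT lP lS pi tau 0 x.
  by apply: expectation_ge0 => // s; exact: (rplus_nm s).1.
have meplus : measurable_fun setT (expected_plus T rho iota c cT lP lS pi tau 0).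
  by apply: measurable_expectation => // s; [exact: (rplus_nm s).1|exact: (rplus_nm s).2].
have eminus0 x : 0 <= expected_minus T iota lS pi tau 0 x.
  by apply: expectation_ge0 => // s; exact: (rminus_nm s).1.
have meminus : measurable_fun setT (expected_minus T iota lS pi tau 0).
  by apply: measurable_expectation => // s; [exact: (rminus_nm s).1|exact: (rminus_nm s).2].
have Kfin : K \is a fin_num.
  rewrite ge0_fin_numE; last by apply: integral_ge0 => x _; exact: corr0.
  have le_cst : K <= \int[p0]_x (cst (T%:R * (a + (wpos lS + wneg lS)))%:E x).
    by apply: ge0_le_integral.
  apply: le_lt_trans le_cst _; rewrite (integral_cst p0 measurableT).
  by rewrite [X in _ * X](@probability_setT _ _ _ p0) mule1 ltry.
have Mfin := expected_minus_fin lS (conj tau_dom klfin).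
have intF : \int[trajectory_law p0 pi tau]_xi F xi =
    \int[p0]_x expected_plus T rho iota c cT lP lS pi tau 0 x + K.
  rewrite (integral_init_law p0 _ F0 mF) /K.
  rewrite -(ge0_integralD p0 measurableT (fun x _ => eplus0 x) meplus (fun x _ => corr0 x) mcorr).
  by apply: eq_integral => x _; exact: expectation_plus.
have intG : \int[trajectory_law p0 pi tau]_xi G xi =
    \int[p0]_x expected_minus T iota lS pi tau 0 x + K.
  rewrite (integral_init_law p0 _ G0 mG) /K.
  rewrite -(ge0_integralD p0 measurableT (fun x _ => eminus0 x) meminus (fun x _ => corr0 x) mcorr).
  by apply: eq_integral => x _; exact: expectation_minus.
have Gfin : \int[trajectory_law p0 pi tau]_xi G xi < +oo.
  by rewrite intG ltey_eq fin_numD Mfin Kfin.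
rewrite (integral_ge0B F0 mF G0 mG Gfin) intF intG /objective_from fin_num_oppeD//.
by rewrite addeACA subee// adde0.
Qed.

End central_problem.

(** * Value functions *)

Section value_function.
Context dX dU (X : measurableType dX) (U : measurableType dU) (R : realType).
Variables (T : nat) (rho : nat -> R.-pker X ~> U) (iota : nat -> R.-pker (X * U) ~> X).
Variables (c : nat -> X * U -> R) (cT : X -> R) (lP lS : R).
Hypotheses (lP_gt0 : (0 < lP)%R) (lS_neq0 : (lS != 0)%R).
Hypotheses (mc : forall t, (t < T)%N -> measurable_fun setT (c t))
  (c_ge0 : forall t z, (t < T)%N -> (0 <= c t z)%R)
  (mcT : measurable_fun setT cT) (cT_ge0 : forall x, (0 <= cT x)%R).

Local Notation cost_to_go := (cost_to_go T rho iota c cT lP lS idfun).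
Local Notation continuation := (continuation T rho iota c cT lP lS idfun).
Local Notation finite_from := (finite_from T rho iota c cT lP lS idfun).
Local Notation is_gibbs_policy := (is_gibbs_policy T rho iota c cT lP lS idfun).
Local Notation is_gibbs_transition := (is_gibbs_transition T rho iota c cT lP lS idfun).
Local Notation objective_from := (objective_from T rho iota c cT lP lS).
Local Notation optimal_from := (optimal_from T rho iota c cT lP lS).
Local Notation value := (value T rho iota c cT lP lS).
Implicit Types (pi : nat -> R.-pker X ~> U) (tau : nat -> R.-pker (X * U) ~> X).

Let mw t : measurable_fun setT (cost_to_go t).
Proof.
exact: (measurable_cost_to_go rho iota lP lS mc c_ge0 mcT cT_ge0
  (@measurable_idfun R) (@id_itv R)).
Qed.

Let integral_at (x : X) (F : X -> \bar R) : measurable_fun setT F ->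
  \int[(\d_x : probability X R)]_y F y = F x.
Proof. by move=> mF; rewrite integral_dirac// diracT mul1e. Qed.

(** The value function is the case of a point mass as initial law. *)
Lemma optimal_from_dirac t x : optimal_from \d_x t = (cost_to_go t x)%:E.
Proof. by rewrite /optimal_from integral_at//; exact/measurable_EFinP. Qed.

Lemma segment_transitions_dirac pi t x tau :
  segment_transitions T iota pi t x tau <-> admissible T iota \d_x t pi tau.
Proof.
rewrite /segment_transitions /admissible /=.
split=> -[dom klfin]; split=> //; move: klfin;
  by rewrite integral_segment_transition_kl integral_at//; exact: measurable_expected_kl.
Qed.

Lemma segment_objective_dirac pi t x tau : policies T rho pi ->
  admissible T iota \d_x t pi tau ->
  segment_objective T rho iota c cT lP lS pi tau t x = objective_from \d_x t pi tau.
Proof.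
move=> pdom [dom]; rewrite integral_at; last exact: measurable_expected_kl.
move=> klfin; rewrite (segment_objectiveE lP_gt0 lS_neq0 mc c_ge0 mcT cT_ge0 pdom dom klfin).
rewrite /objective_from !integral_at//.
- exact: measurable_expected_minus.
- exact: (measurable_expected_plus lS lP_gt0 mc c_ge0 mcT cT_ge0).
Qed.

Lemma segment_opt_dirac pi t x : policies T rho pi ->
  segment_opt T rho iota c cT lP lS t x pi =
  opt lS [set objective_from \d_x t pi tau | tau in admissible T iota \d_x t pi].
Proof.
move=> pdom; congr (opt lS _); apply/seteqP; split=> _ [tau tauP <-].
  have adm : admissible T iota \d_x t pi tau by apply/segment_transitions_dirac.
  by exists tau => //; rewrite segment_objective_dirac.
exists tau; first exact/segment_transitions_dirac.
by rewrite segment_objective_dirac.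
Qed.

Let gibbs_policies : exists2 pi, policies T rho pi & forall t, (t < T)%N -> is_gibbs_policy pi t.
Proof.
have [pi gib] := gibbs_policies_exist rho iota lS lP_gt0 mc c_ge0 mcT cT_ge0
  (@measurable_idfun R) (@id_itv R).
by exists pi => // t tT; exact: density_kernel_dominated (gib t tT).
Qed.

Lemma segment_opt_gibbs t x pi : (t <= T)%N -> finite_from t -> policies T rho pi ->
  (forall s, (t <= s < T)%N -> is_gibbs_policy pi s) ->
  segment_opt T rho iota c cT lP lS t x pi = (cost_to_go t x)%:E.
Proof.
move=> tT fin pdom gib; rewrite segment_opt_dirac// -optimal_from_dirac.
apply/eqP; rewrite eq_le; apply/andP; split; last first.
  exact: (optimal_from_le lP_gt0 lS_neq0 mc c_ge0 mcT cT_ge0).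
apply: (optimal_from_ge lP_gt0 lS_neq0 mc c_ge0 mcT cT_ge0) => // l0.
have [tau [dom tgib]] := gibbs_transitions_exist lS_neq0 mc c_ge0 mcT cT_ge0
  (@measurable_idfun R) (@id_itv R) fin.
exists tau => //.
apply: (gibbs_admissible_pos lP_gt0 lS_neq0 mc c_ge0 mcT cT_ge0 tT fin l0 pdom dom gib tgib).
by rewrite optimal_from_dirac ltry.
Qed.

Lemma segment_opt_ge t x pi : (t <= T)%N -> finite_from t -> policies T rho pi ->
  (cost_to_go t x)%:E <= segment_opt T rho iota c cT lP lS t x pi.
Proof.
move=> tT fin pdom; rewrite segment_opt_dirac// -optimal_from_dirac.
exact: (optimal_from_le lP_gt0 lS_neq0 mc c_ge0 mcT cT_ge0).
Qed.

Lemma value_cost_to_go t x : (t <= T)%N -> finite_from t -> value t x = (cost_to_go t x)%:E.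
Proof.
move=> tT fin; apply/eqP; rewrite eq_le; apply/andP; split.
  have [pi pdom gib] := gibbs_policies.
  apply: ereal_inf_lbound; exists pi => //.
  by apply: segment_opt_gibbs => // s /andP[_]; exact: gib.
by apply: le_ereal_inf_tmp => _ [pi pdom <-]; exact: segment_opt_ge.
Qed.

(** The hypothesis on the risk at time [t] is about the value function at time
    [t.+1], which is the cost-to-go provided that the risks are finite after [t]:
    the two facts have to be proved together, backwards in time. *)
Lemma finite_risks_finite_from : finite_risks T rho iota c cT lP lS ->
  forall t, (t <= T)%N -> finite_from t.
Proof.
move=> fin_risks t tT.
apply: (@horizon_ind T 0%N (fun t => finite_from t)) => //.
  by move=> s z /andP[Ts sT]; move: sT; rewrite ltnNge Ts.
move=> {tT}t /= tT fin s z /andP[ts sT].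
move: ts; rewrite leq_eqVlt => /predU1P[<-{sT s}|ts]; last by apply: fin; rewrite ts.
have [_ /(_ z)] := fin_risks t tT.
rewrite (_ : (fun y => _) = EFin \o (fun y => continuation t (z, y))); last first.
  by apply/funext => y; rewrite value_cost_to_go.
apply: (entropic_risk_partition (sigma := kernel_at (iota t) z) lS_neq0).
Qed.

End value_function.

(** * Bellman equations *)

Section bellman_equations.
Context dX dU (X : measurableType dX) (U : measurableType dU) (R : realType).
Variables (T : nat) (rho : nat -> R.-pker X ~> U) (iota : nat -> R.-pker (X * U) ~> X).
Variables (c : nat -> X * U -> R) (cT : X -> R) (lP lS : R).
Hypotheses (lP_gt0 : (0 < lP)%R) (lS_neq0 : (lS != 0)%R).
Hypotheses (mc : forall t, (t < T)%N -> measurable_fun setT (c t))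
  (c_ge0 : forall t z, (t < T)%N -> (0 <= c t z)%R)
  (mcT : measurable_fun setT cT) (cT_ge0 : forall x, (0 <= cT x)%R).
Hypothesis fin_risks : finite_risks T rho iota c cT lP lS.

Local Notation cost_to_go := (cost_to_go T rho iota c cT lP lS idfun).
Local Notation continuation := (continuation T rho iota c cT lP lS idfun).
Local Notation action_value := (action_value T rho iota c cT lP lS idfun).
Local Notation finite_from := (finite_from T rho iota c cT lP lS idfun).
Local Notation is_gibbs_policy := (is_gibbs_policy T rho iota c cT lP lS idfun).
Local Notation is_gibbs_transition := (is_gibbs_transition T rho iota c cT lP lS idfun).
Local Notation value := (value T rho iota c cT lP lS).
Local Notation qvalue := (qvalue T rho iota c cT lP lS).

Let lP_neq0 : lP != 0%R. Proof. by rewrite gt_eqF. Qed.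

Let fin t : (t <= T)%N -> finite_from t.
Proof. exact: (finite_risks_finite_from lP_gt0 lS_neq0 mc c_ge0 mcT cT_ge0 fin_risks). Qed.

Lemma valueE t x : (t <= T)%N -> value t x = (cost_to_go t x)%:E.
Proof.
move=> tT; exact: (value_cost_to_go lP_gt0 lS_neq0 mc c_ge0 mcT cT_ge0 x tT (fin tT)).
Qed.

Let continuationE t z : (t < T)%N ->
  (fun y => (c t z)%:E + value t.+1 y) = EFin \o (fun y => continuation t (z, y)).
Proof. by move=> tT; apply/funext => y; rewrite valueE. Qed.

Let mcont t (tT : (t < T)%N) : measurable_fun setT (continuation t).
Proof.
exact: (measurable_continuation rho iota lP lS mc c_ge0 mcT cT_ge0
  (@measurable_idfun R) (@id_itv R) tT).
Qed.

Let cont0 t w (tT : (t < T)%N) : (0 <= continuation t w)%R.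
Proof.
exact: (continuation_ge0 rho iota lP lS mc c_ge0 mcT cT_ge0
  (@measurable_idfun R) (@id_itv R) w tT).
Qed.

Let Zcont t z (tT : (t < T)%N) :
  partition lS (iota t z) (fun y => continuation t (z, y)) < +oo.
Proof. by apply: (fin (ltnW tT)); rewrite leqnn. Qed.

Let mq t (tT : (t < T)%N) : measurable_fun setT (action_value t).
Proof.
exact: (measurable_action_value rho iota lP lS mc c_ge0 mcT cT_ge0
  (@measurable_idfun R) (@id_itv R) tT).
Qed.

Let q0 t z (tT : (t < T)%N) : (0 <= action_value t z)%R.
Proof.
exact: (action_value_ge0 rho iota lP lS mc c_ge0 mcT cT_ge0
  (@measurable_idfun R) (@id_itv R) z tT).
Qed.

Let Zq t x (tT : (t < T)%N) : partition lP (rho t x) (fun u => action_value t (x, u)) < +oo.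
Proof.
exact: (partition_pos_lty (kernel_at (rho t) x) lP_gt0
  (measurable_fun_pair2 x (mq tT)) (fun u => q0 (x, u) tT)).
Qed.

Let gibbs_transition_law t (tT : (t < T)%N) : exists k : R.-pker (X * U) ~> X,
  is_gibbs_transition (fun=> k) t.
Proof.
have [tau [_ gib]] := gibbs_transitions_exist lS_neq0 mc c_ge0 mcT cT_ge0
  (@measurable_idfun R) (@id_itv R) (fin (leq0n T)).
by exists (tau t); apply: gib.
Qed.

(** Only laws of finite divergence compete here, and the Gibbs law may not be one
    of them: its truncated versions are. *)
Lemma qvalue_risk t z : (t < T)%N ->
  qvalue t z = (action_value t z)%:E /\
  qvalue t z = entropic_risk lS (iota t z) (fun y => (c t z)%:E + value t.+1 y).
Proof.
move=> tT; rewrite /qvalue continuationE//.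
have -> : entropic_risk lS (iota t z) (EFin \o (fun y => continuation t (z, y))) =
    (action_value t z)%:E.
  exact: (entropic_riskE (sigma := kernel_at (iota t) z)
    (measurable_fun_pair2 z (mcont tT)) (Zcont z tT)).
suff -> : opt lS [set state_objective iota lS t z
    (EFin \o (fun y => continuation t (z, y))) mu | mu in state_laws iota t z] =
    (action_value t z)%:E by [].
apply: (gibbs_opt (sigma := kernel_at (iota t) z) lS_neq0
  (measurable_fun_pair2 z (mcont tT)) (fun y => cont0 (z, y) tT) (Zcont z tT)).
- move=> n; pose g w := Num.min (continuation t w) n%:R.
  have mg : measurable_fun setT g by exact: measurable_minr (mcont tT) (measurable_cst _).
  have g_itv w : (0 <= g w <= continuation t w)%R.
    by rewrite le_min cont0// ler0n ge_min lexx.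
  have [k kE] := gibbs_kernel_exists lS_neq0 mg (fun z' => partition_le_lty
    (sigma := kernel_at (iota t) z') (measurable_fun_pair2 z' (mcont tT))
    (measurable_fun_pair2 z' mg) (fun y => g_itv (z', y)) (Zcont z' tT)).
  by exists (kernel_at k z); exact: has_density_at z kE.
- have [k kE] := gibbs_transition_law tT.
  by exists (kernel_at k z); exact: has_density_at z kE.
Qed.


Let qvalueE t z (tT : (t < T)%N) : qvalue t z = (action_value t z)%:E.
Proof. by have [] := qvalue_risk z tT. Qed.

Let action_valueE t x : (t < T)%N ->
  (fun u => qvalue t (x, u)) = EFin \o (fun u => action_value t (x, u)).
Proof. by move=> tT; apply/funext => u; rewrite qvalueE. Qed.

Let gibbs_policy_law t (tT : (t < T)%N) : exists k : R.-pker X ~> U,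
  is_gibbs_policy (fun=> k) t.
Proof.
have [pi gib] := gibbs_policies_exist rho iota lS lP_gt0 mc c_ge0 mcT cT_ge0
  (@measurable_idfun R) (@id_itv R).
by exists (pi t); apply: gib.
Qed.

Lemma value_risk t x : (t < T)%N ->
  value t x = ereal_inf [set action_objective rho lP t x (fun u => qvalue t (x, u)) mu
    | mu in action_laws rho t x] /\
  value t x = entropic_risk lP (rho t x) (fun u => qvalue t (x, u)).
Proof.
move=> tT; rewrite (valueE x (ltnW tT)) action_valueE// cost_to_goE//; split.
  have [k kE] := gibbs_policy_law tT.
  apply: esym; exact: (gibbs_inf (sigma := kernel_at (rho t) x) lP_neq0 (measurable_fun_pair2 x (mq tT)) (fun u => q0 (x, u) tT)
    (Zq x tT) (has_density_at x kE) lP_gt0).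
apply: esym; exact: (entropic_riskE (sigma := kernel_at (rho t) x)
  (measurable_fun_pair2 x (mq tT)) (Zq x tT)).
Qed.

Let ratioE (a b : R) : (expeR a%:E / expeR b%:E)%E = (expR (a - b))%:E.
Proof. by rewrite /= inver gt_eqF ?expR_gt0// -EFinM -expRN -expRD. Qed.

Lemma gibbs_policy_density t x u : (t < T)%N ->
  expeR ((- lP)%:E * qvalue t (x, u)) / expeR ((- lP)%:E * value t x) =
  (gibbs_density lP (rho t x) (fun u => action_value t (x, u)) u)%:E.
Proof.
move=> tT; rewrite qvalueE// (valueE x (ltnW tT)) cost_to_goE// -!EFinM ratioE.
by rewrite /gibbs_density mulrBr.
Qed.

Lemma gibbs_transition_density t z y : (t < T)%N ->
  expeR ((- lS)%:E * ((c t z)%:E + value t.+1 y)) / expeR ((- lS)%:E * qvalue t z) =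
  (gibbs_density lS (iota t z) (fun y => continuation t (z, y)) y)%:E.
Proof.
move=> tT; rewrite qvalueE// valueE// -EFinD -!EFinM ratioE.
by rewrite /gibbs_density mulrBr.
Qed.

Lemma gibbs_policyP t x (mu : probability U R) : (t < T)%N ->
  (forall A, measurable A -> mu A = \int[rho t x]_(u in A)
     (expeR ((- lP)%:E * qvalue t (x, u)) / expeR ((- lP)%:E * value t x))) <->
  has_density mu (kernel_at (rho t) x)
    (gibbs_density lP (rho t x) (fun u => action_value t (x, u))).
Proof.
move=> tT; have mg := measurable_gibbs_density (kernel_at (rho t) x) lP
  (measurable_fun_pair2 x (mq tT)).
split=> [muE|[_ _ muE] A mA].
  split=> [//|u|A mA]; first exact: expR_ge0.
  by apply: etrans (muE A mA) _; apply: eq_integral => u _; exact: gibbs_policy_density.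
by apply: etrans (muE A mA) _; apply: eq_integral => u _; rewrite gibbs_policy_density.
Qed.

Lemma gibbs_transitionP t z (mu : probability X R) : (t < T)%N ->
  (forall A, measurable A -> mu A = \int[iota t z]_(y in A)
     (expeR ((- lS)%:E * ((c t z)%:E + value t.+1 y)) / expeR ((- lS)%:E * qvalue t z))) <->
  has_density mu (kernel_at (iota t) z)
    (gibbs_density lS (iota t z) (fun y => continuation t (z, y))).
Proof.
move=> tT; have mg := measurable_gibbs_density (kernel_at (iota t) z) lS
  (measurable_fun_pair2 z (mcont tT)).
split=> [muE|[_ _ muE] A mA].
  split=> [//|u|A mA]; first exact: expR_ge0.
  by apply: etrans (muE A mA) _; apply: eq_integral => u _; exact: gibbs_transition_density.
by apply: etrans (muE A mA) _; apply: eq_integral => u _; rewrite gibbs_transition_density.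
Qed.

Lemma policy_argminP t x (mu : probability U R) : (t < T)%N ->
  is_argmin (action_laws rho t x)
    (action_objective rho lP t x (fun u => qvalue t (x, u))) mu <->
  (forall A, measurable A -> mu A = \int[rho t x]_(u in A)
     (expeR ((- lP)%:E * qvalue t (x, u)) / expeR ((- lP)%:E * value t x))).
Proof.
move=> tT; have [k kE] := gibbs_policy_law tT.
have := gibbs_argoptP (sigma := kernel_at (rho t) x) lP_neq0 (measurable_fun_pair2 x (mq tT)) (fun u => q0 (x, u) tT)
  (Zq x tT) (S := action_laws rho t x) (has_density_at x kE).
rewrite action_valueE// => argP; apply: iff_trans (iff_trans (argP _ _ mu) _).
- by rewrite /is_argopt lP_gt0.
- by move=> nu nurho; split=> // l0; move: lP_gt0; rewrite ltNge (ltW l0).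
- by move=> nu /density_dominates.
- split=> muE A mA; apply: etrans (muE A mA) _; apply: eq_integral => u _;
    by rewrite gibbs_policy_density.
Qed.

Let value_ge0 t y : (t <= T)%N -> 0 <= value t y.
Proof.
move=> tT; rewrite valueE// lee_fin.
exact: (cost_to_go_ge0 rho iota lP lS mc c_ge0 mcT cT_ge0 (@measurable_idfun R) (@id_itv R)).
Qed.

Let measurable_value t : (t <= T)%N -> measurable_fun setT (value t).
Proof.
move=> tT; rewrite (_ : value t = EFin \o cost_to_go t).
  apply/measurable_EFinP.
  exact: (measurable_cost_to_go rho iota lP lS mc c_ge0 mcT cT_ge0
    (@measurable_idfun R) (@id_itv R)).
by apply/funext => y; rewrite /= valueE.
Qed.

Let integral_continuation t z (mu : probability X R) : (t < T)%N ->
  \int[mu]_y (continuation t (z, y))%:E = (c t z)%:E + \int[mu]_y value t.+1 y.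
Proof.
move=> tT; have /(congr1 (fun F => \int[mu]_y F y)) := continuationE z tT.
move=> <-; rewrite ge0_integralD//.
- rewrite (integral_cst mu measurableT (c t z)%:E).
  by rewrite [X in _ * X](@probability_setT _ _ _ mu) mule1.
- by move=> y _; rewrite lee_fin c_ge0.
- by move=> y _; exact: value_ge0.
- exact: measurable_value.
Qed.

Let state_objectiveD t z (mu : probability X R) : (t < T)%N ->
  gibbs_objective (kernel_at (iota t) z) lS (fun y => continuation t (z, y)) mu =
  (c t z)%:E + state_objective iota lS t z (value t.+1) mu.
Proof.
by move=> tT; rewrite /gibbs_objective (integral_continuation z mu tT) -addeA.
Qed.

(** The running cost is constant in the next state, so it shifts the objective
    without moving its extremisers.  The finite moment of the Gibbs law gives it a
    finite divergence, hence a place among the competitors, when [lS < 0]. *)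
Lemma transition_argoptP t z (mu nu : probability X R) : (t < T)%N ->
  has_density nu (kernel_at (iota t) z)
    (gibbs_density lS (iota t z) (fun y => continuation t (z, y))) ->
  \int[nu]_y value t.+1 y < +oo ->
  is_argopt lS (state_laws iota t z) (state_objective iota lS t z (value t.+1)) mu <->
  (forall A, measurable A -> mu A = \int[iota t z]_(y in A)
     (expeR ((- lS)%:E * ((c t z)%:E + value t.+1 y)) / expeR ((- lS)%:E * qvalue t z))).
Proof.
move=> tT hnu nufin.
have mf := measurable_fun_pair2 z (mcont tT); have f0 y := cont0 (z, y) tT.
have := gibbs_argoptP (sigma := kernel_at (iota t) z) lS_neq0 mf f0 (Zcont z tT)
  (S := state_laws iota t z) hnu.
move=> argP; apply: iff_trans (iff_trans (argP _ _ mu) _).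
- split=> -[Smu opt_mu]; split=> // mu' Smu'; move: (opt_mu _ Smu');
    by rewrite !state_objectiveD// !leeD2lE.
- by move=> mu' [].
- move=> mu' hmu'; split; first exact: density_dominates hmu'.
  apply: (gibbs_kl_lty (sigma := kernel_at (iota t) z) lS_neq0 mf f0 (Zcont z tT) hmu') => _.
  have mef : measurable_fun setT (EFin \o (fun y => continuation t (z, y))).
    exact/measurable_EFinP.
  have ef0 y : 0 <= (EFin \o (fun y => continuation t (z, y))) y by rewrite lee_fin.
  rewrite [X in X < _](ge0_integral_density hmu' ef0 mef).
  rewrite -(ge0_integral_density hnu ef0 mef) (integral_continuation z nu tT).
  by rewrite lte_add_pinfty// ltry.
- split=> muE A mA; apply: etrans (muE A mA) _; apply: eq_integral => y _;
    by rewrite gibbs_transition_density.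
Qed.

End bellman_equations.

(** * Optimality of the Gibbs pair *)

Section optimal_pair.
Context dX dU (X : measurableType dX) (U : measurableType dU) (R : realType).
Variables (T : nat) (p0 : probability X R).
Variables (rho : nat -> R.-pker X ~> U) (iota : nat -> R.-pker (X * U) ~> X).
Variables (c : nat -> X * U -> R) (cT : X -> R) (lP lS : R).
Hypotheses (lP_gt0 : (0 < lP)%R) (lS_neq0 : (lS != 0)%R).
Hypotheses (mc : forall t, (t < T)%N -> measurable_fun setT (c t))
  (c_ge0 : forall t z, (t < T)%N -> (0 <= c t z)%R)
  (mcT : measurable_fun setT cT) (cT_ge0 : forall x, (0 <= cT x)%R).

Local Notation finite_from := (finite_from T rho iota c cT lP lS idfun).
Local Notation is_gibbs_policy := (is_gibbs_policy T rho iota c cT lP lS idfun).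
Local Notation is_gibbs_transition := (is_gibbs_transition T rho iota c cT lP lS idfun).
Local Notation objective_from := (objective_from T rho iota c cT lP lS).
Local Notation optimal_from := (optimal_from T rho iota c cT lP lS).
Local Notation central_opt := (central_opt T p0 rho iota c cT lP lS).

Variables (pi : nat -> R.-pker X ~> U) (tau : nat -> R.-pker (X * U) ~> X).
Hypotheses (pi_dom : policies T rho pi).
Hypotheses (pi_gibbs : forall t, (t < T)%N -> is_gibbs_policy pi t)
  (tau_gibbs : forall t, (t < T)%N -> is_gibbs_transition tau t).

Section from_t.
Variables (m : probability X R) (t : nat).
Hypotheses (tT : (t <= T)%N) (fin : finite_from t) (adm : admissible T iota m t pi tau).

Let pgib s : (t <= s < T)%N -> is_gibbs_policy pi s.
Proof. by case/andP=> _; exact: pi_gibbs. Qed.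

Let tgib s : (t <= s < T)%N -> is_gibbs_transition tau s.
Proof. by case/andP=> _; exact: tau_gibbs. Qed.

(** Every other admissible transition is on the wrong side of the optimal value,
    which the Gibbs one attains. *)
Lemma gibbs_transition_argopt :
  is_argopt lS (admissible T iota m t pi) (objective_from m t pi) tau.
Proof.
split; [exact: adm|move=> tau' adm'].
rewrite (objective_from_gibbs lP_gt0 lS_neq0 mc c_ge0 mcT cT_ge0 tT fin pi_dom adm pgib tgib).
have lo := optimal_from_le lP_gt0 lS_neq0 mc c_ge0 mcT cT_ge0 m tT fin pi_dom.
have hi := optimal_from_ge lP_gt0 lS_neq0 mc c_ge0 mcT cT_ge0 tT fin pi_dom pgib
  (fun=> ex_intro2 _ _ tau adm tgib).
move: lo hi; rewrite /opt; case: ifPn => l0 lo hi.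
  by apply: le_trans lo _; apply: ereal_inf_lbound; exists tau'.
by apply: le_trans hi; apply: ereal_sup_ubound; exists tau'.
Qed.

Lemma gibbs_policy_argmin : is_argmin (policies T rho)
  (fun pi' => opt lS [set objective_from m t pi' tau' | tau' in admissible T iota m t pi']) pi.
Proof.
split; [exact: pi_dom|move=> pi' pi'_dom].
apply: (@le_trans _ _ (optimal_from m t)).
  exact: (optimal_from_ge lP_gt0 lS_neq0 mc c_ge0 mcT cT_ge0 tT fin pi_dom pgib
    (fun=> ex_intro2 _ _ tau adm tgib)).
exact: (optimal_from_le lP_gt0 lS_neq0 mc c_ge0 mcT cT_ge0).
Qed.

End from_t.

Lemma segment_optimal t x : (t <= T)%N -> finite_from t ->
  segment_transitions T iota pi t x tau ->
  is_argmin (policies T rho) (segment_opt T rho iota c cT lP lS t x) pi /\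
  is_argopt lS (segment_transitions T iota pi t x)
    (fun tau => segment_objective T rho iota c cT lP lS pi tau t x) tau.
Proof.
move=> tT fin /segment_transitions_dirac adm; split.
  have [_ pi_opt] := gibbs_policy_argmin tT fin adm.
  split; [exact: pi_dom|move=> pi' pi'_dom].
  have optE pi'' (dom : policies T rho pi'') :=
    segment_opt_dirac iota lP_gt0 lS_neq0 mc c_ge0 mcT cT_ge0 t x dom.
  by rewrite (optE _ pi_dom) (optE _ pi'_dom); exact: pi_opt.
have [_ tau_opt] := gibbs_transition_argopt tT fin adm.
split=> [|tau' /segment_transitions_dirac adm']; first exact/segment_transitions_dirac.
have objE tau'' (a : admissible T iota \d_x t pi tau'') :=
  segment_objective_dirac lP_gt0 lS_neq0 mc c_ge0 mcT cT_ge0 pi_dom a.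
by rewrite (objE _ adm) (objE _ adm'); exact: tau_opt.
Qed.

Let central_transitionsP pi' tau' :
  central_transitions T p0 iota pi' tau' <-> admissible T iota p0 0 pi' tau'.
Proof.
by split=> -[dom klfin]; split=> //; move: klfin; rewrite integral_trajectory_kl.
Qed.

Let central_objective_from pi' tau' : policies T rho pi' ->
  admissible T iota p0 0 pi' tau' ->
  central_objective T p0 rho iota c cT lP lS pi' tau' = objective_from p0 0 pi' tau'.
Proof.
move=> pdom [dom klfin].
exact: (central_objectiveE lP_gt0 lS_neq0 mc c_ge0 mcT cT_ge0 dom pdom klfin).
Qed.

Let central_optE pi' : policies T rho pi' -> central_opt pi' =
  opt lS [set objective_from p0 0 pi' tau' | tau' in admissible T iota p0 0 pi'].
Proof.
move=> pdom; congr (opt lS _); apply/seteqP; split=> _ [tau' tau'P <-].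
  have adm : admissible T iota p0 0 pi' tau' by apply/central_transitionsP.
  by exists tau' => //; rewrite central_objective_from.
exists tau'; first exact/central_transitionsP.
by rewrite central_objective_from.
Qed.

Lemma central_optimal : finite_from 0 -> central_transitions T p0 iota pi tau ->
  is_argmin (policies T rho) central_opt pi /\
  is_argopt lS (central_transitions T p0 iota pi)
    (central_objective T p0 rho iota c cT lP lS pi) tau.
Proof.
move=> fin /central_transitionsP adm; split.
  have [_ pi_opt] := gibbs_policy_argmin (leq0n T) fin adm.
  split; [exact: pi_dom|move=> pi' pi'_dom].
  by rewrite (central_optE pi_dom) (central_optE pi'_dom); exact: pi_opt.
have [_ tau_opt] := gibbs_transition_argopt (leq0n T) fin adm.
split=> [|tau' /central_transitionsP adm']; first exact/central_transitionsP.
rewrite (central_objective_from pi_dom adm).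
rewrite (central_objective_from pi_dom adm').
exact: tau_opt.
Qed.

End optimal_pair.

Theorem theorem1 (R : realType) (dX dU : measure_display)
    (X : measurableType dX) (U : measurableType dU)
    (T : nat) (p0 : probability X R)
    (rho : nat -> R.-pker X ~> U) (iota : nat -> R.-pker (X * U) ~> X)
    (c : nat -> X * U -> R) (cT : X -> R) (lP lS : R)
    (lP_gt0 : (0 < lP)%R) (lS_neq0 : (lS != 0)%R)
    (mc : forall t, (t < T)%N -> measurable_fun setT (c t))
    (c_ge0 : forall t z, (t < T)%N -> (0 <= c t z)%R)
    (mcT : measurable_fun setT cT) (cT_ge0 : forall x, (0 <= cT x)%R)
    (V := value T rho iota c cT lP lS)
    (Q := qvalue T rho iota c cT lP lS)
    (fin_risks : finite_risks T rho iota c cT lP lS)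
    (fin_expectations : finite_expectations T p0 rho iota c cT lP lS) :
  (forall x, V T x = (cT x)%:E) /\
  (forall t, (t < T)%N ->
    [/\ forall x,
          V t x = ereal_inf [set action_objective rho lP t x (fun u => Q t (x, u)) mu
                            | mu in action_laws rho t x] /\
          V t x = entropic_risk lP (rho t x) (fun u => Q t (x, u)),
        forall z,
          Q t z = opt lS [set state_objective iota lS t z
                                (fun y => (c t z)%:E + V t.+1 y) mu
                         | mu in state_laws iota t z] /\
          Q t z = entropic_risk lS (iota t z) (fun y => (c t z)%:E + V t.+1 y),
        forall x (mu : probability U R),
          is_argmin (action_laws rho t x)
            (action_objective rho lP t x (fun u => Q t (x, u))) mu <->
          (forall A, measurable A -> mu A =
             \int[rho t x]_(u in A)
               (expeR ((- lP)%:E * Q t (x, u)) / expeR ((- lP)%:E * V t x))) &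
        forall z (mu : probability X R),
          is_argopt lS (state_laws iota t z) (state_objective iota lS t z (V t.+1)) mu <->
          (forall A, measurable A -> mu A =
             \int[iota t z]_(y in A)
               (expeR ((- lS)%:E * ((c t z)%:E + V t.+1 y))
                / expeR ((- lS)%:E * Q t z)))]) /\
  (exists (pistar : nat -> R.-pker X ~> U) (taustar : nat -> R.-pker (X * U) ~> X),
    [/\ forall t, (t < T)%N ->
          (forall x A, measurable A -> pistar t x A =
             \int[rho t x]_(u in A)
               (expeR ((- lP)%:E * Q t (x, u)) / expeR ((- lP)%:E * V t x))) /\
          (forall z A, measurable A -> taustar t z A =
             \int[iota t z]_(y in A)
               (expeR ((- lS)%:E * ((c t z)%:E + V t.+1 y))
                / expeR ((- lS)%:E * Q t z))),
        forall t x, (t < T)%N ->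
          is_argmin (policies T rho) (segment_opt T rho iota c cT lP lS t x) pistar /\
          is_argopt lS (segment_transitions T iota pistar t x)
            (fun tau => segment_objective T rho iota c cT lP lS pistar tau t x) taustar,
        is_argmin (policies T rho) (central_opt T p0 rho iota c cT lP lS) pistar &
        is_argopt lS (central_transitions T p0 iota pistar)
          (central_objective T p0 rho iota c cT lP lS pistar) taustar]).
Proof.
have fin := finite_risks_finite_from lP_gt0 lS_neq0 mc c_ge0 mcT cT_ge0 fin_risks.
have [pistar pgib] := gibbs_policies_exist rho iota lS lP_gt0 mc c_ge0 mcT cT_ge0
  (@measurable_idfun R) (@id_itv R).
have pdom : policies T rho pistar.
  by move=> t tT; exact: density_kernel_dominated (pgib t tT).
have [taustar [tdom tgib']] := gibbs_transitions_exist lS_neq0 mc c_ge0 mcT cT_ge0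
  (@measurable_idfun R) (@id_itv R) (fin 0%N (leq0n T)).
have tgib t (tT : (t < T)%N) := tgib' t tT.
have gibbs : is_gibbs T rho iota c cT lP lS pistar taustar.
  move=> t tT; split=> [x|z].
    have [_] := gibbs_policyP lP_gt0 lS_neq0 mc c_ge0 mcT cT_ge0 fin_risks x
      (kernel_at (pistar t) x) tT.
    by apply; exact: has_density_at x (pgib t tT).
  have [_] := gibbs_transitionP lP_gt0 lS_neq0 mc c_ge0 mcT cT_ge0 fin_risks z
    (kernel_at (taustar t) z) tT.
  by apply; exact: has_density_at z (tgib t tT).
have [Vfin segfin cenfin] := fin_expectations _ _ gibbs.
split; first by move=> x; rewrite /V (valueE lP_gt0) // cost_to_goT.
split=> [t tT|].
  split.
  - move=> x; exact: (value_risk lP_gt0 lS_neq0 mc c_ge0 mcT cT_ge0 fin_risks x tT).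
  - move=> z; split=> //.
    by have [] := qvalue_risk lP_gt0 lS_neq0 mc c_ge0 mcT cT_ge0 fin_risks z tT.
  - move=> x mu; exact: (policy_argminP lP_gt0 lS_neq0 mc c_ge0 mcT cT_ge0 fin_risks x mu tT).
  - move=> z mu.
    exact: (transition_argoptP lP_gt0 lS_neq0 mc c_ge0 mcT cT_ge0 fin_risks mu tT
      (has_density_at z (tgib t tT)) (Vfin t z tT)).
exists pistar, taustar; split; first exact: gibbs.
- move=> t x tT; apply: (segment_optimal lP_gt0 lS_neq0 mc c_ge0 mcT cT_ge0 pdom pgib tgib
    (ltnW tT) (fin t (ltnW tT))).
  exact: (conj tdom (segfin t x tT)).
- by have [] := central_optimal lP_gt0 lS_neq0 mc c_ge0 mcT cT_ge0 pdom pgib tgib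
    (fin 0%N (leq0n T)) (conj tdom cenfin).
- by have [] := central_optimal lP_gt0 lS_neq0 mc c_ge0 mcT cT_ge0 pdom pgib tgib
    (fin 0%N (leq0n T)) (conj tdom cenfin).
Qed.
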